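(* Let $0<q<1$, and let $\mathcal{O}(D_q)$, $x$, $\sigma$, $\omega$, $\omega^*$, $d$, $\Omega^1(D_q)$ and the module $\Omega^2(D_q)$ of 2-forms of the universal extension of $(\Omega^1(D_q),d)$ be as defined in the context. Put $$\mathsf{v}=\frac{q^{-6}}{q^2-1}\left(\omega^*\omega+q^8\omega\omega^*\right)\in\Omega^2(D_q).$$ Then: (1) $\Omega^2(D_q)$ is generated by $\mathsf{v}$ as an $\mathcal{O}(D_q)$-module, $\mathsf{v}a=\sigma^2(a)\mathsf{v}$ for all $a\in\mathcal{O}(D_q)$, and $x\mathsf{v}=0=\mathsf{v}x$. (2) The elements $\mathsf{v}z^n$ ($n\ge 0$) and $\mathsf{v}z^{*m}$ ($m\geq 1$) form a $\mathbb{C}$-basis of $\Omega^2(D_q)$. (3) The annihilator $\{a\in\mathcal{O}(D_q)\mid aw=wa=0 \text{ for all } w\in\Omega^2(D_q)\}$ is the ideal of $\mathcal{O}(D_q)$ generated by $x$; the quotient of $\mathcal{O}(D_q)$ by this ideal is the Laurent polynomial ring $\mathcal{O}(S^1)$ in one variable; and, viewed as a module over $\mathcal{O}(S^1)$, $\Omega^2(D_q)$ is free of rank one, generated by $\mathsf{v}$. On the other hand, $\Omega^2(D_q)$ is a torsion $\mathcal{O}(D_q)$-module (both on the left and on the right), its $\mathcal{O}(D_q)$-dual is zero, and it is not projective as an $\mathcal{O}(D_q)$-module. (4) The following relations hold in $\Omega^2(D_q)$: $$d\omega=q^8z^2\mathsf{v},\quad d\omega^*=-z^{*2}\mathsf{v},\quad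 \omega\omega^*=\mathsf{v},\quad \omega^*\omega=-q^6\mathsf{v},$$ $$\omega^2=q^{12}\,\frac{q^2-1}{q^4+1}\,z^4\mathsf{v},\qquad \omega^{*2}=q^{-4}\,\frac{q^2-1}{q^4+1}\,z^{*4}\mathsf{v}.$$
   Context: $\mathcal{O}(D_q)$ (the quantum disc algebra) is the complex unital $*$-algebra generated by $z$ subject to $z^*z-q^2zz^*=1-q^2$, and $x=1-zz^*$. It is $\mathbb{Z}$-graded by $\deg(z)=1$, $\deg(z^* )=-1$. The automorphism $\sigma$ is given on homogeneous elements by $\sigma(a)=q^{2\deg(a)}a$. The linear maps $\partial,\bar\partial:\mathcal{O}(D_q)\to\mathcal{O}(D_q)$ are the skew-derivations determined by $$\partial(z)=z^*,\quad \partial(z^* )=0,\qquad \bar\partial(z)=0,\quad \bar\partial(z^* )=q^2z,$$ and the right $\sigma$-twisted Leibniz rule $\partial(ab)=\partial(a)\sigma(b)+a\partial(b)$, $\bar\partial(ab)=\bar\partial(a)\sigma(b)+a\bar\partial(b)$ (it is known that these are well defined). $\Omega^1(D_q)$ is the $\mathcal{O}(D_q)$-bimodule that is free as a left module on $\omega,\omega^*$ (where $\omega^*$ is also written $\bar\omega$), with right action determined by $\omega a=\sigma(a)\omega$, $\omega^*a=\sigma(a)\omega^*$, and $d(a)=\partial(a)\omega+\bar\partial(a)\omega^*$. The pair $(\Omega^1(D_q),d)$ is a first-order differential calculus, i.e. $d$ satisfies the Leibniz rule and $\Omega^1(D_q)$ is spanned by the elements $a\,db$. Universal extension: for a first-order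 differential calculus $(\Omega^1,d)$ on an algebra $A$, the module of 2-forms of its universal extension (maximal prolongation) is the $A$-bimodule $\Omega^2=(\Omega^1\otimes_A\Omega^1)/R$, where $R$ is the sub-bimodule generated by all elements $\sum_i da_i\otimes_A db_i$ with $\sum_i a_i\,db_i=0$ in $\Omega^1$. The product of one-forms is the class of their tensor product, and $d:\Omega^1\to\Omega^2$ is given by $d(\sum_i a_i\,db_i)=\sum_i da_i\,db_i$. It satisfies $d^2=0$ and the graded Leibniz rule. Being torsion means that every element is annihilated by some non-zero element of $\mathcal{O}(D_q)$ (acting on the corresponding side). The $\mathcal{O}(D_q)$-dual is the module of $\mathcal{O}(D_q)$-linear maps $\Omega^2(D_q)\to\mathcal{O}(D_q)$. *)

(* Defs.v *)
From HB Require Import structures.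
From mathcomp Require Import all_boot all_order all_algebra.
From mathcomp Require Import finmap boolp reals complex monalg.

Set Implicit Arguments.
Unset Strict Implicit.
Unset Printing Implicit Defensive.

Import Order.TTheory GRing.Theory Num.Theory.

Local Open Scope ring_scope.

(** * Quotient of an abelian group by a subgroup *)

Record subgroup (V : zmodType) := Subgroup {
  subgroup_mem :> V -> Prop;
  subgroup0 : subgroup_mem 0;
  subgroupB : forall x y, subgroup_mem x -> subgroup_mem y ->
    subgroup_mem (x - y) }.

Section QuotientGroup.
Variables (V : zmodType) (S : subgroup V).

Definition subgroup_pred : pred V := fun x => `[< S x >].

Fact subgroup_pred_closed : zmod_closed subgroup_pred.
Proof.
split=> [|x y]; first by apply/asboolP/subgroup0.
by move=> /asboolP Sx /asboolP Sy; apply/asboolP/subgroupB.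
Qed.

HB.instance Definition _ :=
  GRing.isZmodClosed.Build V subgroup_pred subgroup_pred_closed.

Definition subgroup_zmod := GRing.ZmodClosed.clone V subgroup_pred _.

Definition quot : Type := Quotient.quot subgroup_zmod.
HB.instance Definition _ := GRing.Zmodule.on quot.

Definition qpi : V -> quot := \pi_(Quotient.quot subgroup_zmod)%qT.
Definition qrepr (u : quot) : V := repr u.

Fact qpi_is_zmod_morphism : zmod_morphism qpi.
Proof. exact: (@pi_is_zmod_morphism _ _ _ (Quotient.quot subgroup_zmod)). Qed.
HB.instance Definition _ :=
  GRing.isZmodMorphism.Build V quot qpi qpi_is_zmod_morphism.

Lemma qreprK u : qpi (qrepr u) = u.
Proof. exact: reprK. Qed.

Lemma qpiE x y : qpi x = qpi y <-> S (x - y).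
Proof.
rewrite /qpi; split=> [/eqP|Sxy].
  by rewrite -Quotient.idealrBE => /asboolP.
by apply/eqP; rewrite -Quotient.idealrBE; apply/asboolP.
Qed.

Lemma qpi0 x : qpi x = 0 <-> S x.
Proof. by rewrite -(raddf0 qpi) qpiE subr0. Qed.

Lemma qind (P : quot -> Prop) : (forall x, P (qpi x)) -> forall u, P u.
Proof. by move=> Px u; rewrite -[u]qreprK. Qed.

(** The map induced on the quotient by a map [f] vanishing on [S]. *)
Definition qlift (W : Type) (f : V -> W) (u : quot) : W := f (qrepr u).

Lemma qliftE (W : zmodType) (f : {additive V -> W}) :
  (forall x, S x -> f x = 0) -> forall x, qlift f (qpi x) = f x.
Proof.
move=> fS x; apply/eqP; rewrite -subr_eq0 -raddfB; apply/eqP/fS/qpiE.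
exact: qreprK.
Qed.

Lemma qlift_additive (W : zmodType) (f : {additive V -> W}) :
  (forall x, S x -> f x = 0) -> zmod_morphism (qlift f).
Proof.
move=> fS u v; elim/qind: u => x; elim/qind: v => y.
by rewrite -raddfB !qliftE // raddfB.
Qed.

End QuotientGroup.

(** * Quotient of an algebra by a two-sided ideal *)

Section AlgebraQuotient.
Variables (K : comNzRingType) (A : algType K) (S : A -> Prop).

(** The two-sided ideal generated by [S]. *)
Inductive ideal_gen : A -> Prop :=
| ideal_gen0 : ideal_gen 0
| ideal_genD a b : ideal_gen a -> ideal_gen b -> ideal_gen (a + b)
| ideal_genM a s b : S s -> ideal_gen (a * s * b).

Lemma ideal_genMl a b : ideal_gen b -> ideal_gen (a * b).
Proof.
elim=> [|b1 b2 _ ? _ ?|b1 s b2 Ss]; first by rewrite mulr0; exact: ideal_gen0.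
  by rewrite mulrDr; exact: ideal_genD.
by rewrite !mulrA; exact: ideal_genM.
Qed.

Lemma ideal_genMr a b : ideal_gen a -> ideal_gen (a * b).
Proof.
elim=> [|b1 b2 _ ? _ ?|b1 s b2 Ss]; first by rewrite mul0r; exact: ideal_gen0.
  by rewrite mulrDl; exact: ideal_genD.
by rewrite -mulrA; exact: ideal_genM.
Qed.

Lemma ideal_genB a b : ideal_gen a -> ideal_gen b -> ideal_gen (a - b).
Proof.
by move=> Ia Ib; apply: ideal_genD => //; rewrite -mulN1r; apply: ideal_genMl.
Qed.

Lemma ideal_gen_id s : S s -> ideal_gen s.
Proof. by move=> /(ideal_genM 1 1); rewrite mul1r mulr1. Qed.

Lemma ideal_gen_morph (B : pzRingType) (f : {rmorphism A -> B}) :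
  (forall s, S s -> f s = 0) -> forall a, ideal_gen a -> f a = 0.
Proof.
move=> fS a; elim=> [|b c _ fb _ fc|b s c /fS fs]; first exact: rmorph0.
  by rewrite rmorphD fb fc addr0.
by rewrite !rmorphM fs mulr0 mul0r.
Qed.

Definition ideal_subgroup := Subgroup ideal_gen0 ideal_genB.

(** The quotient of [A] by the two-sided ideal generated by [S]; properness of
    the ideal is required because an [algType] has [1 != 0]. *)
Definition alg_quot (_ : ~ ideal_gen 1) : Type := quot ideal_subgroup.

Variable S_proper : ~ ideal_gen 1.
Local Notation Q := (alg_quot S_proper).

HB.instance Definition _ := GRing.Zmodule.on Q.

Definition alg_pi : A -> Q := qpi ideal_subgroup.
HB.instance Definition _ := GRing.Additive.on alg_pi.

Fact alg_quot_key : unit. Proof. exact: tt. Qed.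
Definition alg_quot_one : Q := alg_pi 1.
Definition alg_quot_mul : Q -> Q -> Q :=
  locked_with alg_quot_key (fun u v => alg_pi (qrepr u * qrepr v)).
Definition alg_quot_scale : K -> Q -> Q :=
  locked_with alg_quot_key (fun c u => alg_pi (c *: qrepr u)).

Lemma alg_piE a b : alg_pi a = alg_pi b <-> ideal_gen (a - b).
Proof. exact: qpiE. Qed.

Lemma alg_ind (P : Q -> Prop) : (forall a, P (alg_pi a)) -> forall u, P u.
Proof. exact: qind. Qed.

Fact alg_pi_mul a b : alg_pi (a * b) = alg_quot_mul (alg_pi a) (alg_pi b).
Proof.
rewrite /alg_quot_mul; case: alg_quot_key.
apply/alg_piE; set a' := qrepr _; set b' := qrepr _.
have Ia : ideal_gen (a - a') by apply/alg_piE/esym/qreprK.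
have Ib : ideal_gen (b - b') by apply/alg_piE/esym/qreprK.
rewrite -[a * b](subrK (a' * b)) -addrA -mulrBl -mulrBr.
by apply: ideal_genD; [apply: ideal_genMr | apply: ideal_genMl].
Qed.

Fact alg_pi_scale c a : alg_pi (c *: a) = alg_quot_scale c (alg_pi a).
Proof.
rewrite /alg_quot_scale; case: alg_quot_key.
apply/alg_piE; rewrite -scalerBr -mulr_algl.
by apply: ideal_genMl; apply/alg_piE/esym/qreprK.
Qed.

Fact alg_quot_mulA : associative alg_quot_mul.
Proof.
elim/alg_ind=> a; elim/alg_ind=> b; elim/alg_ind=> c.
by rewrite -!alg_pi_mul mulrA.
Qed.
Fact alg_quot_mul1 : left_id alg_quot_one alg_quot_mul.
Proof. by elim/alg_ind=> a; rewrite -alg_pi_mul mul1r. Qed.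
Fact alg_quot_1mul : right_id alg_quot_one alg_quot_mul.
Proof. by elim/alg_ind=> a; rewrite -alg_pi_mul mulr1. Qed.
Fact alg_quot_mulDl : left_distributive alg_quot_mul +%R.
Proof.
elim/alg_ind=> a; elim/alg_ind=> b; elim/alg_ind=> c.
by rewrite -raddfD -!alg_pi_mul -raddfD mulrDl.
Qed.
Fact alg_quot_mulDr : right_distributive alg_quot_mul +%R.
Proof.
elim/alg_ind=> a; elim/alg_ind=> b; elim/alg_ind=> c.
by rewrite -raddfD -!alg_pi_mul -raddfD mulrDr.
Qed.
Fact alg_quot_1neq0 : alg_quot_one != 0.
Proof. by apply/eqP => /qpi0 /S_proper. Qed.

HB.instance Definition _ := GRing.Zmodule_isNzRing.Build Q
  alg_quot_mulA alg_quot_mul1 alg_quot_1mul alg_quot_mulDl alg_quot_mulDr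
  alg_quot_1neq0.

Fact alg_quot_scaleA c d u :
  alg_quot_scale c (alg_quot_scale d u) = alg_quot_scale (c * d) u.
Proof. by elim/alg_ind: u => a; rewrite -!alg_pi_scale scalerA. Qed.
Fact alg_quot_scale1 : left_id 1 alg_quot_scale.
Proof. by elim/alg_ind=> a; rewrite -alg_pi_scale scale1r. Qed.
Fact alg_quot_scaleDr : right_distributive alg_quot_scale +%R.
Proof.
move=> c; elim/alg_ind=> a; elim/alg_ind=> b.
by rewrite -raddfD -!alg_pi_scale -raddfD scalerDr.
Qed.
Fact alg_quot_scaleDl u : {morph alg_quot_scale^~ u : c d / c + d}.
Proof.
by elim/alg_ind: u => a c d; rewrite -!alg_pi_scale scalerDl raddfD.
Qed.

HB.instance Definition _ := GRing.Zmodule_isLmodule.Build K Q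
  alg_quot_scaleA alg_quot_scale1 alg_quot_scaleDr alg_quot_scaleDl.

Fact alg_quot_scaleAl c (u v : Q) : c *: (u * v) = (c *: u) * v.
Proof.
elim/alg_ind: u => a; elim/alg_ind: v => b.
rewrite /GRing.mul /GRing.scale /=.
by rewrite -alg_pi_scale -!alg_pi_mul -alg_pi_scale scalerAl.
Qed.

HB.instance Definition _ := GRing.Lmodule_isLalgebra.Build K Q alg_quot_scaleAl.

Fact alg_quot_scaleAr c (u v : Q) : c *: (u * v) = u * (c *: v).
Proof.
elim/alg_ind: u => a; elim/alg_ind: v => b.
rewrite /GRing.mul /GRing.scale /=.
by rewrite -alg_pi_scale -!alg_pi_mul -alg_pi_scale scalerAr.
Qed.

HB.instance Definition _ := GRing.Lalgebra_isAlgebra.Build K Q alg_quot_scaleAr.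

Fact alg_pi_monoid_morphism : monoid_morphism alg_pi.
Proof. by split=> // a b; rewrite alg_pi_mul. Qed.
HB.instance Definition _ :=
  GRing.isMonoidMorphism.Build A Q alg_pi alg_pi_monoid_morphism.

Fact alg_pi_scalable : scalable alg_pi.
Proof. by move=> c a; rewrite alg_pi_scale. Qed.
HB.instance Definition _ :=
  GRing.isScalable.Build K A Q *:%R alg_pi alg_pi_scalable.

Definition alg_lift (B : pzRingType) (f : A -> B) : Q -> B := qlift f.

Lemma alg_liftE (B : pzRingType) (f : {rmorphism A -> B}) :
  (forall s, S s -> f s = 0) -> forall a, alg_lift f (alg_pi a) = f a.
Proof.
by move=> fS a; apply: qliftE => b; apply: ideal_gen_morph.
Qed.

Lemma alg_lift_additive (B : pzRingType) (f : {rmorphism A -> B}) :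
  (forall s, S s -> f s = 0) -> zmod_morphism (alg_lift f).
Proof.
by move=> fS; apply: qlift_additive => b; apply: ideal_gen_morph.
Qed.

Lemma alg_lift_monoid (B : pzRingType) (f : {rmorphism A -> B}) :
  (forall s, S s -> f s = 0) -> monoid_morphism (alg_lift f).
Proof.
move=> fS; split=> [|u v].
  by rewrite -(rmorph1 alg_pi) alg_liftE // rmorph1.
elim/alg_ind: u => a; elim/alg_ind: v => b.
by rewrite -rmorphM !alg_liftE // rmorphM.
Qed.

End AlgebraQuotient.

Arguments alg_pi {K A S} S_proper.

(** * The free algebra on a type of generators *)

Fact malg_scaleAr (M : monomType) (K : comNzRingType) (c : K)
  (x y : {malg K[M]}) : c *: (x * y) = x * (c *: y).
Proof.
rewrite -(mul_malgC c (x * y)) -(mul_malgC c y) !mulrA; congr (_ * y).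
rewrite !malgM_def fgmulUg fgmulgU; apply: eq_bigr => k _.
by rewrite mul1m mulm1 mulrC.
Qed.

Section FreeAlgebra.
Variables (K : comNzRingType) (I : choiceType).

Definition free_alg : Type := {malg K[{fmonom I}]}.
HB.instance Definition _ := GRing.Lalgebra.on free_alg.

HB.instance Definition _ :=
  GRing.Lalgebra_isAlgebra.Build K free_alg
    (@malg_scaleAr {fmonom I} K).

Definition free_gen (i : I) : free_alg := << fmu i >>.

Section Eval.
Variables (B : nzRingType) (iota : {rmorphism K -> B}) (h : I -> B).

Definition fmonom_eval (m : {fmonom I}) : B := \prod_(i <- m) h i.

Fact fmonom_eval_mmorphism : mmorphism fmonom_eval.
Proof.
split=> [m n|]; first by rewrite /fmonom_eval fmM big_cat.
by rewrite /fmonom_eval fm1 big_nil.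
Qed.
HB.instance Definition _ :=
  isMultiplicative.Build {fmonom I} B fmonom_eval fmonom_eval_mmorphism.

(** The ring morphism which is [iota] on scalars and [h] on generators; the
    scalars have to act centrally. *)
Definition free_eval (_ : forall c b, iota c * b = b * iota c)
  (x : free_alg) : B := mmap iota fmonom_eval x.

Hypothesis iota_central : forall c b, iota c * b = b * iota c.
Local Notation ev := (free_eval iota_central).

Fact free_eval_additive : zmod_morphism ev.
Proof. by move=> x y; rewrite /free_eval raddfB. Qed.
HB.instance Definition _ :=
  GRing.isZmodMorphism.Build free_alg B ev free_eval_additive.

Fact free_eval_monoid : monoid_morphism ev.
Proof.
have [evM ev1] := @commr_mmap_is_multiplicative _ _ _ iota fmonom_eval
  (fun x m n => iota_central _ _).
by split=> [|x y]; [exact: ev1 | exact: evM].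
Qed.
HB.instance Definition _ :=
  GRing.isMonoidMorphism.Build free_alg B ev free_eval_monoid.

Lemma free_evalZ c x : ev (c *: x) = iota c * ev x.
Proof. exact: mmapZ. Qed.

Lemma free_eval_gen i : ev (free_gen i) = h i.
Proof. by rewrite /free_eval mmapU /= rmorph1 mul1r /fmonom_eval fmU big_seq1. Qed.

End Eval.

Lemma free_alg_ind (P : free_alg -> Prop) :
  P 0 -> (forall x y, P x -> P y -> P (x + y)) ->
  (forall c x, P x -> P (c *: x)) -> P 1 ->
  (forall i x, P x -> P (free_gen i * x)) -> forall x, P x.
Proof.
move=> P0 PD PZ P1 PM x; rewrite (monalgE x); apply: big_ind => // m _.
have -> : << x@_m *g m >> = x@_m *: (<< m >> : free_alg).
  by rewrite -[RHS](mul_malgC x@_m << m >>) malgM_def fgmulUU mulr1 mul1m.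
apply: PZ; rewrite -(fmK m); elim: (m : seq I) => [|i s IHs].
  by rewrite -fmoneE.
rewrite (_ : << _ >> = free_gen i * << FMonom s >>); first exact: PM.
by rewrite malgM_def fgmulUU mulr1 /= /free_gen /mul /= fmmulE fmuE.
Qed.

End FreeAlgebra.

(** * The quantum disc algebra *)

Section QuantumDisc.
Variables (C : numClosedFieldType) (q : C).

Definition disc_relator (A : algType C) (z zs : A) : A :=
  zs * z - q ^+ 2 *: (z * zs) - (1 - q ^+ 2)%:A.

Lemma disc_relator_morph (A : algType C) (B : nzRingType)
    (iota : {rmorphism C -> B}) (f : {rmorphism A -> B}) (z zs : A) :
  (forall c a, f (c *: a) = iota c * f a) ->
  f (disc_relator z zs) =
  f zs * f z - iota (q ^+ 2) * (f z * f zs) - iota (1 - q ^+ 2).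
Proof.
by move=> fZ; rewrite /disc_relator 2!(rmorphB f) !fZ !(rmorphM f) (rmorph1 f) mulr1.
Qed.

(** The generator [false] stands for [z] and [true] for [z^*]. *)
Definition disc_rel (x : free_alg C bool) : Prop :=
  x = disc_relator (free_gen C false) (free_gen C true).

Section DiscEval.
Variables (B : nzRingType) (iota : {rmorphism C -> B}) (b bs : B).
Hypothesis iota_central : forall c b, iota c * b = b * iota c.
Hypothesis b_rel : bs * b - iota (q ^+ 2) * (b * bs) = iota (1 - q ^+ 2).

Definition disc_free_eval : {rmorphism free_alg C bool -> B} :=
  free_eval (fun i : bool => if i then bs else b) iota_central.

Lemma disc_free_evalZ c x : disc_free_eval (c *: x) = iota c * disc_free_eval x.
Proof. exact: free_evalZ. Qed.

Lemma disc_free_eval_gen i :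
  disc_free_eval (free_gen C i) = if i then bs else b.
Proof. exact: free_eval_gen. Qed.

Lemma disc_free_eval_rel x : disc_rel x -> disc_free_eval x = 0.
Proof.
move=> ->; rewrite (disc_relator_morph _ _ disc_free_evalZ).
by rewrite !disc_free_eval_gen b_rel subrr.
Qed.

End DiscEval.

Fact disc_proper : ~ ideal_gen disc_rel 1.
Proof.
have idC (c b : C) : idfun c * b = b * idfun c by exact: mulrC.
have rel : (1 : C) * 1 - idfun (q ^+ 2) * (1 * 1) = idfun (1 - q ^+ 2).
  by rewrite !mulr1.
move=> /(ideal_gen_morph (disc_free_eval_rel idC rel)) /eqP.
by rewrite (rmorph1 (disc_free_eval _ _ _)) oner_eq0.
Qed.

Definition disc : Type := alg_quot disc_proper.
HB.instance Definition _ := GRing.Algebra.on disc.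

Definition disc_pi : free_alg C bool -> disc := alg_pi disc_proper.
HB.instance Definition _ := GRing.LRMorphism.on disc_pi.

Definition disc_z : disc := disc_pi (free_gen C false).
Definition disc_zs : disc := disc_pi (free_gen C true).
Definition disc_x : disc := 1 - disc_z * disc_zs.

Lemma disc_relE : disc_relator disc_z disc_zs = 0.
Proof.
have piZ c a : disc_pi (c *: a) = in_alg disc c * disc_pi a.
  by rewrite linearZ /= mulr_algl.
transitivity (disc_pi (disc_relator (free_gen C false) (free_gen C true))).
  by rewrite (disc_relator_morph _ _ piZ) /disc_relator mulr_algl.
by apply/qpi0; apply: ideal_gen_id.
Qed.

Section DiscLift.
Variables (B : nzRingType) (iota : {rmorphism C -> B}) (b bs : B).

(** The ring morphism on [disc] sending [z] to [b], [z^*] to [bs] and which is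
    [iota] on scalars. *)
Definition disc_lift
  (iota_central : forall c b, iota c * b = b * iota c) : disc -> B :=
  alg_lift (disc_free_eval b bs iota_central).

Hypothesis iota_central : forall c b, iota c * b = b * iota c.
Hypothesis b_rel : bs * b - iota (q ^+ 2) * (b * bs) = iota (1 - q ^+ 2).
Local Notation L := (disc_lift iota_central).

Lemma disc_lift_additive : zmod_morphism L.
Proof. exact: alg_lift_additive (disc_free_eval_rel _ b_rel). Qed.

Lemma disc_lift_monoid : monoid_morphism L.
Proof. exact: alg_lift_monoid (disc_free_eval_rel _ b_rel). Qed.

Lemma disc_lift_pi x : L (disc_pi x) = disc_free_eval b bs iota_central x.
Proof. exact: (alg_liftE _ (disc_free_eval_rel _ b_rel)). Qed.

Lemma disc_lift_z : L disc_z = b.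
Proof. by rewrite disc_lift_pi disc_free_eval_gen. Qed.

Lemma disc_lift_zs : L disc_zs = bs.
Proof. by rewrite disc_lift_pi disc_free_eval_gen. Qed.

Lemma disc_liftZ c a : L (c *: a) = iota c * L a.
Proof.
elim/alg_ind: a => x; rewrite -[alg_pi _ x]/(disc_pi x) -linearZ.
by rewrite !disc_lift_pi disc_free_evalZ.
Qed.
End DiscLift.

Lemma disc_ind (P : disc -> Prop) :
  P 0 -> (forall a b, P a -> P b -> P (a + b)) ->
  (forall c a, P a -> P (c *: a)) -> P 1 ->
  (forall a, P a -> P (disc_z * a)) -> (forall a, P a -> P (disc_zs * a)) ->
  forall a, P a.
Proof.
move=> P0 PD PZ P1 Pz Pzs; elim/alg_ind => x.
rewrite -[alg_pi _ x]/(disc_pi x).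
elim/free_alg_ind: x => [|x y Px Py|c x Px||i x Px].
- by rewrite rmorph0.
- by rewrite rmorphD; apply: PD.
- by rewrite linearZ; apply: PZ.
- by rewrite rmorph1.
- by rewrite rmorphM; case: i; [apply: Pzs | apply: Pz].
Qed.
End QuantumDisc.
Lemma subr_of_eqD (V : zmodType) (a b c : V) : a = b + c -> a - b = c.
Proof. by move=> ->; rewrite addrAC subrr add0r. Qed.

Lemma converseM (A : pzRingType) (a b : A^c) : a * b = (b : A) * (a : A).
Proof. by []. Qed.

Section AlgebraScalars.
Variables (C : numClosedFieldType) (A : algType C).

(** Scalars act on the opposite ring through complex conjugation. *)
Definition conj_alg (c : C) : A^c := ((Num.conj c)%:A : A).

Fact conj_alg_additive : zmod_morphism conj_alg.
Proof. by move=> c d; rewrite /conj_alg rmorphB scalerBl. Qed.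
Fact conj_alg_monoid : monoid_morphism conj_alg.
Proof.
split=> [|c d]; first by rewrite /conj_alg rmorph1 scale1r.
rewrite converseM /conj_alg rmorphM mulrC.
exact: (rmorphM (in_alg A)).
Qed.
HB.instance Definition _ :=
  GRing.isZmodMorphism.Build C A^c conj_alg conj_alg_additive.
HB.instance Definition _ :=
  GRing.isMonoidMorphism.Build C A^c conj_alg conj_alg_monoid.

Lemma alg_central (c : C) (a : A) : c%:A * a = a * c%:A.
Proof. by rewrite mulr_algl mulr_algr. Qed.

Fact conj_alg_central c (a : A^c) : conj_alg c * a = a * conj_alg c.
Proof. exact/esym/alg_central. Qed.

Fact conj_alg_rel (c : C) (z zs : A) : Num.conj c = c ->
  zs * z = c *: (z * zs) + (1 - c)%:A ->
  (z : A^c) * (zs : A^c) - conj_alg c * ((zs : A^c) * (z : A^c)) =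
  conj_alg (1 - c).
Proof.
move=> cR zszE; rewrite !converseM /conj_alg rmorphB rmorph1 /= cR mulr_algr.
exact: subr_of_eqD zszE.
Qed.

Fact sigma_alg_rel (c : C) (z zs : A) : c != 0 ->
  zs * z = c *: (z * zs) + (1 - c)%:A ->
  (c^-1 *: zs) * (c *: z) - in_alg A c * ((c *: z) * (c^-1 *: zs)) =
  in_alg A (1 - c).
Proof.
move=> c0 zszE; rewrite /= mulr_algl -!scalerAl -!scalerAr !scalerA.
rewrite mulVf // mulfK // scale1r; exact: subr_of_eqD zszE.
Qed.
End AlgebraScalars.

(** Upper triangular matrices: ring morphisms [a |-> upper a (D a) (s a)] are
    the same as pairs of a ring morphism [s] and a map [D] with
    [D (a * b) = D a * s b + a * D b]. *)
Section UpperMatrix.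
Variables (C : numClosedFieldType) (A : algType C).

Definition upper (a b c : A) : 'M[A]_2 :=
  \matrix_(i, j) if i == ord0 then (if j == ord0 then a else b)
                 else (if j == ord0 then 0 else c).

Lemma upperE (M N : 'M[A]_2) :
  M ord0 ord0 = N ord0 ord0 -> M ord0 ord_max = N ord0 ord_max ->
  M ord_max ord0 = N ord_max ord0 -> M ord_max ord_max = N ord_max ord_max ->
  M = N.
Proof.
move=> h1 h2 h3 h4; apply/matrixP => i j.
have ord2 (k : 'I_2) : k = ord0 \/ k = ord_max.
  by case: k => [[|[|k]] hk] //; [left | right]; apply: val_inj.
by case: (ord2 i) => ->; case: (ord2 j) => ->.
Qed.

Lemma upperM a b c a' b' c' :
  upper a b c * upper a' b' c' = upper (a * a') (a * b' + b * c') (c * c').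
Proof.
by apply: upperE; rewrite !mxE !big_ord_recl big_ord0 !mxE /=;
  rewrite ?mul0r ?mulr0 ?addr0 ?add0r.
Qed.

Lemma upperB a b c a' b' c' :
  upper a b c - upper a' b' c' = upper (a - a') (b - b') (c - c').
Proof. by apply: upperE; rewrite !mxE /= ?subrr. Qed.

Definition upper_alg (c : C) : 'M[A]_2 := upper c%:A 0 c%:A.

Lemma upper01 a b c : upper a b c ord0 ord_max = b.
Proof. by rewrite mxE. Qed.

Lemma upper1 : upper 1 0 1 = 1.
Proof. by apply: upperE; rewrite !mxE. Qed.

Fact upper_alg_additive : zmod_morphism upper_alg.
Proof. by move=> c d; rewrite /upper_alg upperB subrr scalerBl. Qed.
Fact upper_alg_monoid : monoid_morphism upper_alg.
Proof.
split=> [|c d].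
  by rewrite /upper_alg scale1r upper1.
by rewrite /upper_alg upperM mulr0 mul0r addr0 mulr_algl scalerA.
Qed.
HB.instance Definition _ :=
  GRing.isZmodMorphism.Build C 'M[A]_2 upper_alg upper_alg_additive.
HB.instance Definition _ :=
  GRing.isMonoidMorphism.Build C 'M[A]_2 upper_alg upper_alg_monoid.

Lemma upper_algM c a b d :
  upper_alg c * upper a b d = upper (c *: a) (c *: b) (c *: d).
Proof. by rewrite /upper_alg upperM mul0r addr0 !mulr_algl. Qed.

Fact upper_alg_central c (M : 'M[A]_2) : upper_alg c * M = M * upper_alg c.
Proof.
have lift2 : lift ord0 ord0 = ord_max :> 'I_2 by exact: val_inj.
by apply: upperE; rewrite !mxE !big_ord_recl !big_ord0 !mxE /= ?lift2;
  rewrite ?mul0r ?mulr0 ?addr0 ?add0r alg_central.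
Qed.

Fact upper_alg_rel (c : C) (z zs dz dzs : A) : c != 0 ->
  zs * z = c *: (z * zs) + (1 - c)%:A ->
  zs * dz + dzs * (c *: z) = c *: (z * dzs + dz * (c^-1 *: zs)) ->
  upper zs dzs (c^-1 *: zs) * upper z dz (c *: z) -
    upper_alg c * (upper z dz (c *: z) * upper zs dzs (c^-1 *: zs)) =
  upper_alg (1 - c).
Proof.
move=> c0 zszE dE; rewrite (upperM zs) (upperM z) upper_algM upperB /upper_alg dE subrr.
have := sigma_alg_rel c0 zszE; rewrite /= mulr_algl => ->.
by rewrite (subr_of_eqD zszE).
Qed.
End UpperMatrix.

Section DiscStructure.
Variables (C : numClosedFieldType) (q : C).
Local Notation disc := (disc q).
Local Notation z := (disc_z q).
Local Notation zs := (disc_zs q).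
Local Notation x := (disc_x q).

Lemma disc_zszE : zs * z = q ^+ 2 *: (z * zs) + (1 - q ^+ 2)%:A.
Proof. by apply/eqP; rewrite -subr_eq0 opprD addrA; apply/eqP/disc_relE. Qed.

(** The homogeneous components of the grading with [deg z = 1] and
    [deg z^* = -1]. *)
Inductive homog : int -> disc -> Prop :=
| homog_scalar c : homog 0 c%:A
| homog_z : homog 1 z
| homog_zs : homog (-1) zs
| homogD n a b : homog n a -> homog n b -> homog n (a + b)
| homogM m n a b : homog m a -> homog n b -> homog (m + n) (a * b).

Section Calculus.
Hypothesis q01 : 0 < q < 1.

Fact q_neq0 : q != 0.
Proof. by have /andP[/lt0r_neq0] := q01. Qed.

Fact conj_q2 : Num.conj (q ^+ 2) = q ^+ 2.
Proof. by apply/conj_Creal/rpredX/ger0_real/ltW; have /andP[] := q01. Qed.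

(** The involution: the conjugate-linear antimultiplicative map exchanging [z]
    and [z^*]. *)
Definition disc_star : disc -> disc :=
  disc_lift (zs : disc^c) (z : disc^c) (@conj_alg_central C disc).

Fact disc_star_rel : (z : disc^c) * (zs : disc^c) -
  conj_alg disc (q ^+ 2) * ((zs : disc^c) * (z : disc^c)) =
  conj_alg disc (1 - q ^+ 2).
Proof. exact: conj_alg_rel conj_q2 disc_zszE. Qed.

Lemma disc_star_z : disc_star z = zs.
Proof. exact: disc_lift_z disc_star_rel. Qed.
Lemma disc_star_zs : disc_star zs = z.
Proof. exact: disc_lift_zs disc_star_rel. Qed.
Lemma disc_starB a b : disc_star (a - b) = disc_star a - disc_star b.
Proof. exact: disc_lift_additive disc_star_rel a b. Qed.
Lemma disc_starM a b : disc_star (a * b) = disc_star b * disc_star a.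
Proof. 
etransitivity; first exact: ((disc_lift_monoid _ disc_star_rel).2 a b).
exact: (@converseM disc). Qed.
Lemma disc_starZ (c : C) a : disc_star (c *: a) = Num.conj c *: disc_star a.
Proof.
rewrite /disc_star (disc_liftZ _ disc_star_rel).
by rewrite converseM /conj_alg mulr_algr.
Qed.

Definition disc_sigma (_ : 0 < q < 1) : disc -> disc :=
  @disc_lift C q disc (in_alg disc) (q ^+ 2 *: z) (q ^- 2 *: zs)
    (@alg_central C disc).

Local Notation sigma := (disc_sigma q01).

Fact disc_sigma_rel : (q ^- 2 *: zs) * (q ^+ 2 *: z) -
  in_alg disc (q ^+ 2) * ((q ^+ 2 *: z) * (q ^- 2 *: zs)) =
  in_alg disc (1 - q ^+ 2).
Proof. exact: (sigma_alg_rel (expf_neq0 2 q_neq0) disc_zszE). Qed.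

Fact disc_sigma_additive : zmod_morphism sigma.
Proof. exact: disc_lift_additive disc_sigma_rel. Qed.
HB.instance Definition _ :=
  GRing.isZmodMorphism.Build disc disc sigma disc_sigma_additive.
Fact disc_sigma_monoid : monoid_morphism sigma.
Proof. exact: disc_lift_monoid disc_sigma_rel. Qed.
HB.instance Definition _ :=
  GRing.isMonoidMorphism.Build disc disc sigma disc_sigma_monoid.
Fact disc_sigma_scalable : scalable sigma.
Proof.
by move=> c a; rewrite /disc_sigma (disc_liftZ _ disc_sigma_rel) /= mulr_algl.
Qed.
HB.instance Definition _ :=
  GRing.isScalable.Build C disc disc *:%R sigma disc_sigma_scalable.

Lemma disc_sigma_z : sigma z = q ^+ 2 *: z.
Proof. exact: disc_lift_z disc_sigma_rel. Qed.
Lemma disc_sigma_zs : sigma zs = q ^- 2 *: zs.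
Proof. exact: disc_lift_zs disc_sigma_rel. Qed.

Lemma disc_sigma_homog n a : homog n a -> sigma a = (q ^ (2 * n)) *: a.
Proof.
elim=> {n a} [c||| n a b _ IHa _ IHb|m n a b _ IHa _ IHb].
- by rewrite linearZ /= rmorph1 mulr0 scale1r.
- by rewrite disc_sigma_z.
- by rewrite disc_sigma_zs.
- by rewrite raddfD /= IHa IHb scalerDr.
- by rewrite rmorphM /= IHa IHb -scalerAl -scalerAr scalerA mulrDr expfzDr ?q_neq0.
Qed.
(** The [sigma]-skew derivation with prescribed values on [z] and [z^*]. *)
Definition disc_der (dz dzs a : disc) : disc :=
  disc_lift (upper z dz (q ^+ 2 *: z)) (upper zs dzs (q ^- 2 *: zs))
    (@upper_alg_central C disc) a ord0 ord_max.

Section Derivation.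
Variables dz dzs : disc.
Hypothesis dE : zs * dz + dzs * (q ^+ 2 *: z) =
  q ^+ 2 *: (z * dzs + dz * (q ^- 2 *: zs)).
Local Notation D := (disc_der dz dzs).

Let der_rel := upper_alg_rel (expf_neq0 2 q_neq0) disc_zszE dE.
Let U : disc -> _ := disc_lift (upper z dz (q ^+ 2 *: z)) (upper zs dzs (q ^- 2 *: zs))
    (@upper_alg_central C disc).

Let disc_derU a : D a = U a ord0 ord_max. Proof. by []. Qed.

Fact disc_der_upper a : U a = upper a (D a) (sigma a).
Proof.
suff [b Ub] : exists b, U a = upper a b (sigma a).
  have -> : D a = b by rewrite /disc_der -/U Ub upper01.
  exact: Ub.
have UM b c : U (b * c) = U b * U c by exact: (disc_lift_monoid _ der_rel).2.
have Uz : U z = upper z dz (q ^+ 2 *: z) := disc_lift_z _ der_rel.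
have Uzs : U zs = upper zs dzs (q ^- 2 *: zs) := disc_lift_zs _ der_rel.
have UB b c : U (b - c) = U b - U c.
  exact: (disc_lift_additive (@upper_alg_central C disc) der_rel).
have UZ c b : U (c *: b) = upper_alg disc c * U b := disc_liftZ _ der_rel c b.
have U1 : U 1 = upper 1 0 1.
  by rewrite upper1; exact: (disc_lift_monoid _ der_rel).1.
elim/disc_ind: a => [|a b [a' Ea] [b' Eb]|c a [a' Ea]||a [a' Ea]|a [a' Ea]].
- by exists (0 - 0); rewrite -{1}(subrr 1) UB U1 upperB !subrr raddf0.
- exists (a' - - b'); rewrite -{1}(opprK b) -(scaleN1r b) UB UZ Ea Eb.
  by rewrite upper_algM upperB !scaleN1r !opprK (raddfD sigma).
- by exists (c *: a'); rewrite UZ Ea upper_algM (linearZ_LR sigma).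
- by exists 0; rewrite U1 (rmorph1 sigma).
- by eexists; rewrite UM Uz Ea upperM (rmorphM sigma) /= disc_sigma_z.
- by eexists; rewrite UM Uzs Ea upperM (rmorphM sigma) /= disc_sigma_zs.
Qed.

Lemma disc_der_z : D z = dz.
Proof. by rewrite /disc_der (disc_lift_z _ der_rel) upper01. Qed.

Lemma disc_der_zs : D zs = dzs.
Proof. by rewrite /disc_der (disc_lift_zs _ der_rel) upper01. Qed.

Lemma disc_derB a b : D (a - b) = D a - D b.
Proof.
have UE : U (a - b) = U a - U b.
  exact: (disc_lift_additive (@upper_alg_central C disc) der_rel).
by rewrite [LHS]disc_derU UE !disc_der_upper upperB upper01.
Qed.

Lemma disc_derZ c a : D (c *: a) = c *: D a.
Proof.
have UE : U (c *: a) = upper_alg disc c * U a := disc_liftZ _ der_rel c a.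
by rewrite [LHS]disc_derU UE disc_der_upper upper_algM upper01.
Qed.

Lemma disc_derM a b : D (a * b) = D a * sigma b + a * D b.
Proof.
have UE : U (a * b) = U a * U b by exact: (disc_lift_monoid _ der_rel).2.
by rewrite [LHS]disc_derU UE !disc_der_upper upperM upper01 addrC.
Qed.
End Derivation.

Definition disc_partial (_ : 0 < q < 1) : disc -> disc := disc_der zs 0.
Definition disc_partialbar (_ : 0 < q < 1) : disc -> disc :=
  disc_der 0 (q ^+ 2 *: z).
Local Notation partial := (disc_partial q01).
Local Notation partialbar := (disc_partialbar q01).

Fact disc_partial_rel : zs * zs + 0 * (q ^+ 2 *: z) =
  q ^+ 2 *: (z * 0 + zs * (q ^- 2 *: zs)).
Proof.
rewrite mul0r mulr0 addr0 add0r -scalerAr scalerA mulfV ?scale1r //.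
exact: expf_neq0 q_neq0.
Qed.

Fact disc_partialbar_rel : zs * 0 + (q ^+ 2 *: z) * (q ^+ 2 *: z) =
  q ^+ 2 *: (z * (q ^+ 2 *: z) + 0 * (q ^- 2 *: zs)).
Proof. by rewrite mulr0 mul0r add0r addr0 -scalerAl. Qed.

Lemma disc_partial_z : partial z = zs.
Proof. exact: disc_der_z disc_partial_rel. Qed.
Lemma disc_partial_zs : partial zs = 0.
Proof. exact: disc_der_zs disc_partial_rel. Qed.
Lemma disc_partialbar_z : partialbar z = 0.
Proof. exact: disc_der_z disc_partialbar_rel. Qed.
Lemma disc_partialbar_zs : partialbar zs = q ^+ 2 *: z.
Proof. exact: disc_der_zs disc_partialbar_rel. Qed.
Lemma disc_partialM a b :
  partial (a * b) = partial a * sigma b + a * partial b.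
Proof. exact: disc_derM disc_partial_rel a b. Qed.
Lemma disc_partialbarM a b : partialbar (a * b) =
  partialbar a * sigma b + a * partialbar b.
Proof. exact: disc_derM disc_partialbar_rel a b. Qed.

Lemma disc_partialB a b :
  partial (a - b) = partial a - partial b.
Proof. exact: disc_derB disc_partial_rel a b. Qed.
Lemma disc_partialZ c a : partial (c *: a) = c *: partial a.
Proof. exact: disc_derZ disc_partial_rel c a. Qed.
Lemma disc_partialbarB a b :
  partialbar (a - b) = partialbar a - partialbar b.
Proof. exact: disc_derB disc_partialbar_rel a b. Qed.
Lemma disc_partialbarZ c a : partialbar (c *: a) = c *: partialbar a.
Proof. exact: disc_derZ disc_partialbar_rel c a. Qed.

HB.instance Definition _ :=
  GRing.isZmodMorphism.Build disc disc partial disc_partialB.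
HB.instance Definition _ :=
  GRing.isScalable.Build C disc disc *:%R partial disc_partialZ.
HB.instance Definition _ :=
  GRing.isZmodMorphism.Build disc disc partialbar disc_partialbarB.
HB.instance Definition _ :=
  GRing.isScalable.Build C disc disc *:%R partialbar disc_partialbarZ.

End Calculus.
End DiscStructure.
(** * Bimodules *)

Reserved Notation "v <* a" (at level 40, left associativity).

HB.mixin Record Lmodule_isBimodule (A : pzRingType) V of GRing.Lmodule A V := {
  ract : V -> A -> V;
  ract1 : forall v, ract v 1 = v;
  ractA : forall v a b, ract v (a * b) = ract (ract v a) b;
  ractDl : forall v w a, ract (v + w) a = ract v a + ract w a;
  ractDr : forall v a b, ract v (a + b) = ract v a + ract v b;
  ractZ : forall a v b, ract (a *: v) b = a *: ract v b
}.

#[short(type="bimodType")]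
HB.structure Definition Bimodule (A : pzRingType) :=
  {V of GRing.Lmodule A V & Lmodule_isBimodule A V}.

Notation "v <* a" := (ract v a) : ring_scope.

Section BimoduleTheory.
Variables (A : pzRingType) (V : bimodType A).

Lemma ract0l (a : A) : (0 : V) <* a = 0.
Proof. by apply: (addrI (0 <* a)); rewrite -ractDl !addr0. Qed.

Lemma ractNl (v : V) (a : A) : (- v) <* a = - (v <* a).
Proof. by rewrite -!scaleN1r ractZ. Qed.

Lemma ractBl (v w : V) (a : A) : (v - w) <* a = v <* a - w <* a.
Proof. by rewrite ractDl ractNl. Qed.

(** A bimodule as a right module, i.e. as a left module over the opposite
    ring. *)
Definition right_module : Type := V.
HB.instance Definition _ := GRing.Zmodule.on right_module.

Definition right_scale (a : A^c) (v : right_module) : right_module :=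
  (v : V) <* (a : A).

Fact right_scaleA a b v : right_scale a (right_scale b v) = right_scale (a * b) v.
Proof. by rewrite /right_scale -ractA. Qed.
Fact right_scale1 : left_id 1 right_scale.
Proof. by move=> v; rewrite /right_scale ract1. Qed.
Fact right_scaleDr : right_distributive right_scale +%R.
Proof. by move=> a v w; rewrite /right_scale ractDl. Qed.
Fact right_scaleDl v : {morph right_scale^~ v : a b / a + b}.
Proof. by move=> a b; rewrite /right_scale ractDr. Qed.
HB.instance Definition _ := GRing.Zmodule_isLmodule.Build A^c right_module
  right_scaleA right_scale1 right_scaleDr right_scaleDl.

(** The explicit type prevents [right_module] from being unfolded to the left
    module [V] during unification. *)
Definition right_lmod : lmodType A^c := right_module.

Lemma right_lmodE (a : A) (v : V) :
  (a : A^c) *: (v : right_lmod) = (v <* a : V).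
Proof. by []. Qed.
End BimoduleTheory.

(** The quotient of a bimodule by the sub-bimodule generated by [S]. *)
Section BimoduleQuotient.
Variables (A : pzRingType) (V : bimodType A) (S : V -> Prop).

Inductive submod_gen : V -> Prop :=
| submod_gen0 : submod_gen 0
| submod_genD v w : submod_gen v -> submod_gen w -> submod_gen (v + w)
| submod_genZ a s b : S s -> submod_gen (a *: s <* b).

Lemma submod_gen_scale a v : submod_gen v -> submod_gen (a *: v).
Proof.
elim=> [|v1 v2 _ ? _ ?|b s c Ss]; first by rewrite scaler0; exact: submod_gen0.
  by rewrite scalerDr; exact: submod_genD.
by rewrite -ractZ scalerA; exact: submod_genZ.
Qed.

Lemma submod_gen_ract v a : submod_gen v -> submod_gen (v <* a).
Proof.
elim=> [|v1 v2 _ ? _ ?|b s c Ss]; first by rewrite ract0l; exact: submod_gen0.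
  by rewrite ractDl; exact: submod_genD.
by rewrite -ractA; exact: submod_genZ.
Qed.

Lemma submod_genB v w : submod_gen v -> submod_gen w -> submod_gen (v - w).
Proof.
move=> Sv Sw; apply: submod_genD => //; rewrite -scaleN1r.
exact: submod_gen_scale.
Qed.

Definition submod_subgroup := Subgroup submod_gen0 submod_genB.

Definition bimod_quot : Type := quot submod_subgroup.
HB.instance Definition _ := GRing.Zmodule.on bimod_quot.

Definition bimod_pi : V -> bimod_quot := qpi submod_subgroup.
HB.instance Definition _ := GRing.Additive.on bimod_pi.

Fact bimod_quot_key : unit. Proof. exact: tt. Qed.
Definition bimod_quot_scale : A -> bimod_quot -> bimod_quot :=
  locked_with bimod_quot_key (fun a u => bimod_pi (a *: qrepr u)).
Definition bimod_quot_ract : bimod_quot -> A -> bimod_quot :=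
  locked_with bimod_quot_key (fun u a => bimod_pi (qrepr u <* a)).

Lemma bimod_piE v w : bimod_pi v = bimod_pi w <-> submod_gen (v - w).
Proof. exact: qpiE. Qed.

Lemma bimod_ind (P : bimod_quot -> Prop) :
  (forall v, P (bimod_pi v)) -> forall u, P u.
Proof. exact: qind. Qed.

Fact bimod_pi_scale a v : bimod_pi (a *: v) = bimod_quot_scale a (bimod_pi v).
Proof.
rewrite /bimod_quot_scale; case: bimod_quot_key; apply/bimod_piE.
by rewrite -scalerBr; apply/submod_gen_scale/bimod_piE/esym/qreprK.
Qed.

Fact bimod_pi_ract v a : bimod_pi (v <* a) = bimod_quot_ract (bimod_pi v) a.
Proof.
rewrite /bimod_quot_ract; case: bimod_quot_key; apply/bimod_piE.
by rewrite -ractBl; apply/submod_gen_ract/bimod_piE/esym/qreprK.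
Qed.

Fact bimod_quot_scaleA a b u :
  bimod_quot_scale a (bimod_quot_scale b u) = bimod_quot_scale (a * b) u.
Proof. by elim/bimod_ind: u => v; rewrite -!bimod_pi_scale scalerA. Qed.
Fact bimod_quot_scale1 : left_id 1 bimod_quot_scale.
Proof. by elim/bimod_ind=> v; rewrite -bimod_pi_scale scale1r. Qed.
Fact bimod_quot_scaleDr : right_distributive bimod_quot_scale +%R.
Proof.
move=> a; elim/bimod_ind=> v; elim/bimod_ind=> w.
by rewrite -raddfD -!bimod_pi_scale -raddfD scalerDr.
Qed.
Fact bimod_quot_scaleDl u : {morph bimod_quot_scale^~ u : a b / a + b}.
Proof. by elim/bimod_ind: u => v a b; rewrite -!bimod_pi_scale scalerDl raddfD. Qed.
HB.instance Definition _ := GRing.Zmodule_isLmodule.Build A bimod_quot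
  bimod_quot_scaleA bimod_quot_scale1 bimod_quot_scaleDr bimod_quot_scaleDl.

Fact bimod_quot_ract1 u : bimod_quot_ract u 1 = u.
Proof. by elim/bimod_ind: u => v; rewrite -bimod_pi_ract ract1. Qed.
Fact bimod_quot_ractA u a b :
  bimod_quot_ract u (a * b) = bimod_quot_ract (bimod_quot_ract u a) b.
Proof. by elim/bimod_ind: u => v; rewrite -!bimod_pi_ract ractA. Qed.
Fact bimod_quot_ractDl u w a :
  bimod_quot_ract (u + w) a = bimod_quot_ract u a + bimod_quot_ract w a.
Proof.
elim/bimod_ind: u => v; elim/bimod_ind: w => v'.
by rewrite -raddfD -!bimod_pi_ract -raddfD ractDl.
Qed.
Fact bimod_quot_ractDr u a b :
  bimod_quot_ract u (a + b) = bimod_quot_ract u a + bimod_quot_ract u b.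
Proof. by elim/bimod_ind: u => v; rewrite -!bimod_pi_ract ractDr raddfD. Qed.
Fact bimod_quot_ractZ a u b :
  bimod_quot_ract (a *: u) b = a *: bimod_quot_ract u b.
Proof.
elim/bimod_ind: u => v; rewrite /GRing.scale /=.
by rewrite -bimod_pi_scale -!bimod_pi_ract -bimod_pi_scale ractZ.
Qed.
HB.instance Definition _ := Lmodule_isBimodule.Build A bimod_quot
  bimod_quot_ract1 bimod_quot_ractA bimod_quot_ractDl bimod_quot_ractDr
  bimod_quot_ractZ.

Lemma bimod_piZ a v : bimod_pi (a *: v) = a *: bimod_pi v.
Proof. exact: bimod_pi_scale. Qed.

Lemma bimod_piR v a : bimod_pi (v <* a) = bimod_pi v <* a.
Proof. exact: bimod_pi_ract. Qed.

Lemma bimod_pi0 v : bimod_pi v = 0 <-> submod_gen v.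
Proof. exact: qpi0. Qed.
End BimoduleQuotient.

(** * Tensor product of bimodules over a ring *)

Section FreeAbelian.
Variables (T : choiceType) (W : zmodType) (h : T -> W).

Definition fab_lift (x : {malg int[T]}) : W := \sum_(t <- msupp x) h t *~ x@_t.

Lemma fab_liftEw (d : {fset T}) x :
  (msupp x `<=` d)%fset -> fab_lift x = \sum_(t <- d) h t *~ x@_t.
Proof.
move=> le; rewrite [LHS](big_fset_incl _ le) => //= t _ /mcoeff_outdom ->.
by rewrite mulr0z.
Qed.

Fact fab_lift_additive : zmod_morphism fab_lift.
Proof.
move=> x y; set d := (msupp x `|` msupp y)%fset.
rewrite (fab_liftEw (msuppB_le x y)) (@fab_liftEw d x) ?fsubsetUl //.
rewrite (@fab_liftEw d y) ?fsubsetUr // -sumrB; apply: eq_bigr => t _.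
by rewrite mcoeffB mulrzBr.
Qed.
HB.instance Definition _ :=
  GRing.isZmodMorphism.Build {malg int[T]} W fab_lift fab_lift_additive.

Lemma fab_liftU t : fab_lift << t >> = h t.
Proof. by rewrite (fab_liftEw msuppU_le) big_seq_fset1 mcoeffUU. Qed.
End FreeAbelian.

Lemma fab_ind (T : choiceType) (P : {malg int[T]} -> Prop) :
  P 0 -> (forall t, P << t >>) -> (forall x y, P x -> P y -> P (x - y)) ->
  forall x, P x.
Proof.
move=> P0 P1 PB x.
have PN y : P y -> P (- y) by move=> Py; rewrite -sub0r; apply: PB.
have PD y z : P y -> P z -> P (y + z).
  by move=> Py Pz; rewrite -[z]opprK; apply: PB => //; apply: PN.
have PU t (n : nat) : P << n%:Z *g t >>.
  elim: n => [|n IHn]; first by rewrite monalgU0.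
  by rewrite -addn1 PoszD monalgUD; apply: PD.
rewrite (monalgE x); apply: big_ind => // t _; case: (x@_t) => n //.
by rewrite NegzE monalgUN; apply: PN.
Qed.

Section Tensor.
Variables (A : pzRingType) (V W : bimodType A).

Local Notation gen v w := (<< ((v, w) : (V * W)%type) >> : {malg int[(V * W)%type]}).

Inductive tens_rel : {malg int[(V * W)%type]} -> Prop :=
| tens_rel0 : tens_rel 0
| tens_relB x y : tens_rel x -> tens_rel y -> tens_rel (x - y)
| tens_relDl v v' w : tens_rel (gen (v + v') w - gen v w - gen v' w)
| tens_relDr v w w' : tens_rel (gen v (w + w') - gen v w - gen v w')
| tens_relA v a w : tens_rel (gen (v <* a) w - gen v (a *: w)).

Definition tens_subgroup := Subgroup tens_rel0 tens_relB.

Definition tensor : Type := quot tens_subgroup.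
HB.instance Definition _ := GRing.Zmodule.on tensor.

Definition tens (v : V) (w : W) : tensor :=
  qpi tens_subgroup (gen v w).

Lemma tensDl v v' w : tens (v + v') w = tens v w + tens v' w.
Proof.
apply/eqP; rewrite -subr_eq0 opprD addrA; apply/eqP.
by rewrite /tens -!raddfB; apply/qpi0/tens_relDl.
Qed.

Lemma tensDr v w w' : tens v (w + w') = tens v w + tens v w'.
Proof.
apply/eqP; rewrite -subr_eq0 opprD addrA; apply/eqP.
by rewrite /tens -!raddfB; apply/qpi0/tens_relDr.
Qed.

Lemma tensA v a w : tens (v <* a) w = tens v (a *: w).
Proof. by apply/qpiE/tens_relA. Qed.

(** The additive map induced by a balanced biadditive map. *)
Definition tens_lift (U : zmodType) (h : V -> W -> U) : tensor -> U :=
  qlift (fab_lift (fun vw => h vw.1 vw.2)).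

Definition balanced (U : zmodType) (h : V -> W -> U) : Prop :=
  [/\ forall v v' w, h (v + v') w = h v w + h v' w,
      forall v w w', h v (w + w') = h v w + h v w' &
      forall v a w, h (v <* a) w = h v (a *: w)].

Section Lift.
Variables (U : zmodType) (h : V -> W -> U).
Hypothesis hB : balanced h.

Let f_rel x : tens_rel x -> fab_lift (fun vw => h vw.1 vw.2) x = 0.
Proof.
have [hDl hDr hA] := hB.
elim=> [|y z _ fy _ fz|v v' w|v w w'|v a w]; first exact: raddf0.
- by rewrite raddfB /= fy fz subr0.
- by rewrite !raddfB /= !fab_liftU /= hDl addrAC addrK subrr.
- by rewrite !raddfB /= !fab_liftU /= hDr addrAC addrK subrr.
- by rewrite !raddfB /= !fab_liftU /= hA subrr.
Qed.

Lemma tens_lift_additive : zmod_morphism (tens_lift h).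
Proof. exact: (@qlift_additive _ tens_subgroup _ _ f_rel). Qed.

Lemma tens_liftE v w : tens_lift h (tens v w) = h v w.
Proof. by rewrite /tens_lift (@qliftE _ tens_subgroup _ _ f_rel) /= fab_liftU. Qed.
End Lift.

Lemma tens_ind (P : tensor -> Prop) : P 0 -> (forall v w, P (tens v w)) ->
  (forall s t, P s -> P t -> P (s - t)) -> forall t, P t.
Proof.
move=> P0 Pt PB; elim/qind => x; elim/fab_ind: x => [|[v w]|x y Px Py] //.
- by rewrite raddf0.
- exact: Pt.
- by rewrite raddfB; apply: PB.
Qed.

Lemma tens_ext (U : zmodType) (f g : tensor -> U) :
  zmod_morphism f -> zmod_morphism g ->
  (forall v w, f (tens v w) = g (tens v w)) -> forall t, f t = g t.
Proof.
move=> fB gB fg; elim/tens_ind => [|v w|s t fs ft] //.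
  by rewrite -(subrr 0) fB gB !subrr.
by rewrite fB gB fs ft.
Qed.

Definition tens_scale (a : A) : tensor -> tensor :=
  tens_lift (fun v w => tens (a *: v) w).
Definition tens_ract (t : tensor) (a : A) : tensor :=
  tens_lift (fun v w => tens v (w <* a)) t.

Fact tens_scale_balanced a : balanced (fun v w => tens (a *: v) w).
Proof.
split=> [v v' w|v w w'|v b w]; first by rewrite scalerDr tensDl.
  by rewrite tensDr.
by rewrite -ractZ tensA.
Qed.
Fact tens_ract_balanced a : balanced (fun v w => tens v (w <* a)).
Proof.
split=> [v v' w|v w w'|v b w]; first by rewrite tensDl.
  by rewrite ractDl tensDr.
by rewrite tensA ractZ.
Qed.

Lemma tens_scaleE a v w : tens_scale a (tens v w) = tens (a *: v) w.
Proof. exact: (tens_liftE (tens_scale_balanced a)). Qed.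
Lemma tens_ractE a v w : tens_ract (tens v w) a = tens v (w <* a).
Proof. exact: (tens_liftE (tens_ract_balanced a)). Qed.

Fact tens_scaleB a : zmod_morphism (tens_scale a).
Proof. exact: (tens_lift_additive (tens_scale_balanced a)). Qed.
Fact tens_ractB a : zmod_morphism (tens_ract^~ a).
Proof. exact: (tens_lift_additive (tens_ract_balanced a)). Qed.

Lemma zmod_morphismD (U U' : zmodType) (f : U -> U') :
  zmod_morphism f -> {morph f : x y / x + y}.
Proof.
move=> fB x y; have f0 : f 0 = 0 by rewrite -(subrr 0) fB subrr.
by rewrite -{1}[y]opprK fB -[- y]sub0r fB f0 sub0r opprK.
Qed.

Fact tens_scaleA a b t : tens_scale a (tens_scale b t) = tens_scale (a * b) t.
Proof.
apply: (@tens_ext _ (fun t => tens_scale a (tens_scale b t))) t => [s t|s t|v w].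
- by rewrite !tens_scaleB.
- by rewrite tens_scaleB.
- by rewrite !tens_scaleE scalerA.
Qed.
Fact tens_scale1 : left_id 1 tens_scale.
Proof.
apply: (@tens_ext _ (tens_scale 1) id) => [s t|s t|v w] //.
  by rewrite tens_scaleB.
by rewrite tens_scaleE scale1r.
Qed.
Fact tens_scaleDr : right_distributive tens_scale +%R.
Proof. by move=> a; apply/zmod_morphismD/tens_scaleB. Qed.
Fact tens_scaleDl t : {morph tens_scale^~ t : a b / a + b}.
Proof.
move=> a b.
apply: (@tens_ext _ (tens_scale (a + b))
          (fun t => tens_scale a t + tens_scale b t)) t => [s t|s t|v w].
- by rewrite tens_scaleB.
- by rewrite !tens_scaleB opprD addrACA.
- by rewrite !tens_scaleE scalerDl tensDl.
Qed.
HB.instance Definition _ := GRing.Zmodule_isLmodule.Build A tensor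
  tens_scaleA tens_scale1 tens_scaleDr tens_scaleDl.

Fact tens_ract1 t : tens_ract t 1 = t.
Proof.
apply: (@tens_ext _ (tens_ract^~ 1) id) t => [s t|s t|v w] //.
  by rewrite tens_ractB.
by rewrite tens_ractE ract1.
Qed.
Fact tens_ractA t a b : tens_ract t (a * b) = tens_ract (tens_ract t a) b.
Proof.
apply: (@tens_ext _ (tens_ract^~ (a * b))
          (fun t => tens_ract (tens_ract t a) b)) t => [s t|s t|v w].
- by rewrite tens_ractB.
- by rewrite !tens_ractB.
- by rewrite !tens_ractE ractA.
Qed.
Fact tens_ractDl s t a : tens_ract (s + t) a = tens_ract s a + tens_ract t a.
Proof. exact: (zmod_morphismD (tens_ractB a)). Qed.
Fact tens_ractDr t a b : tens_ract t (a + b) = tens_ract t a + tens_ract t b.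
Proof.
apply: (@tens_ext _ (tens_ract^~ (a + b))
          (fun t => tens_ract t a + tens_ract t b)) t => [s t|s t|v w].
- by rewrite tens_ractB.
- by rewrite !tens_ractB opprD addrACA.
- by rewrite !tens_ractE ractDr tensDr.
Qed.
Fact tens_ractZ a t b : tens_ract (a *: t) b = a *: tens_ract t b.
Proof.
apply: (@tens_ext _ (fun t => tens_ract (tens_scale a t) b)
          (fun t => tens_scale a (tens_ract t b))) t => [s t|s t|v w].
- by rewrite tens_scaleB tens_ractB.
- by rewrite tens_ractB tens_scaleB.
- by rewrite !(tens_ractE, tens_scaleE).
Qed.
HB.instance Definition _ := Lmodule_isBimodule.Build A tensor
  tens_ract1 tens_ractA tens_ractDl tens_ractDr tens_ractZ.
End Tensor.

(** * First-order calculi and the 2-forms of the universal extension *)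

Record fodc (A : pzRingType) := Fodc {
  forms1 : bimodType A;
  fodc_d : {additive A -> forms1};
  fodc_leibniz : forall a b,
    fodc_d (a * b) = fodc_d a <* b + a *: fodc_d b;
  fodc_span : forall w : forms1, exists s : seq (A * A),
    w = \sum_(ab <- s) ab.1 *: fodc_d ab.2 }.

Section UniversalExtension.
Variables (A : pzRingType) (F : fodc A).
Local Notation d := (fodc_d F).

Definition forms2_rel (t : tensor (forms1 F) (forms1 F)) : Prop :=
  exists s : seq (A * A), \sum_(ab <- s) ab.1 *: d ab.2 = 0 /\
    t = \sum_(ab <- s) tens (d ab.1) (d ab.2).

Definition forms2 : Type := bimod_quot forms2_rel.
HB.instance Definition _ := Bimodule.on forms2.

Definition wedge (u v : forms1 F) : forms2 := bimod_pi forms2_rel (tens u v).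

(** [d (\sum_i a_i *: d b_i) = \sum_i (d a_i) (d b_i)], computed on a chosen
    presentation; [d1E] shows that the choice is irrelevant. *)
Definition d1 (w : forms1 F) : forms2 :=
  \sum_(ab <- projT1 (cid (fodc_span w))) wedge (d ab.1) (d ab.2).

Lemma wedgeDl u u' v : wedge (u + u') v = wedge u v + wedge u' v.
Proof. by rewrite /wedge tensDl raddfD. Qed.

Lemma wedgeZl a u v : wedge (a *: u) v = a *: wedge u v.
Proof. by rewrite /wedge -bimod_piZ [a *: tens _ _]tens_scaleE. Qed.

Lemma wedge_rel (s : seq (A * A)) : \sum_(ab <- s) ab.1 *: d ab.2 = 0 ->
  \sum_(ab <- s) wedge (d ab.1) (d ab.2) = 0.
Proof.
move=> s0; rewrite /wedge -raddf_sum; apply/bimod_pi0.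
rewrite -[X in submod_gen _ X]scale1r -[X in submod_gen _ X]ract1.
by apply: submod_genZ; exists s.
Qed.

Lemma d1E (s : seq (A * A)) : d1 (\sum_(ab <- s) ab.1 *: d ab.2) =
  \sum_(ab <- s) wedge (d ab.1) (d ab.2).
Proof.
rewrite /d1; case: cid => /= r sr.
have wN a v : wedge (- a) v = - wedge a v by rewrite -!scaleN1r wedgeZl.
have /wedge_rel : \sum_(ab <- s ++ [seq (- ab.1, ab.2) | ab <- r])
    ab.1 *: d ab.2 = 0.
  rewrite big_cat big_map /= sr; apply/eqP; rewrite addr_eq0 -sumrN; apply/eqP.
  by apply: eq_bigr => ab _; rewrite scaleNr opprK.
rewrite big_cat big_map /= => /eqP; rewrite addr_eq0 -sumrN => /eqP ->.
by apply: eq_bigr => ab _; rewrite raddfN wN opprK.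
Qed.
End UniversalExtension.
(** * The calculus on the quantum disc *)

Fact span_alg_rel1 (C : numClosedFieldType) (A : algType C) (c : C) (z zs : A) :
  c != 0 -> 1 - c != 0 -> zs * z = c *: (z * zs) + (1 - c)%:A ->
  ((1 - c)^-1 / c)%:A * (zs * (c *: z)) + - ((1 - c)^-1 * c)%:A * (z * zs) = 1.
Proof.
move=> c0 c1 zszE; rewrite mulNr !mulr_algl -scalerAr scalerA mulfVK // zszE.
by rewrite scalerDr scalerA addrAC subrr add0r scalerA mulVf // scale1r.
Qed.

Fact span_alg_rel2 (C : numClosedFieldType) (A : algType C) (c : C) (z zs : A) :
  c != 0 -> 1 - c != 0 -> zs * z = c *: (z * zs) + (1 - c)%:A ->
  ((1 - c)^-1 / c)%:A * (zs * (c *: z)) +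
    - ((1 - c)^-1 * c)%:A * ((c *: z) * (c^-1 *: zs)) = 1.
Proof.
move=> c0 c1 zszE; rewrite -(scalerAl c z) -(scalerAr c^-1) scalerA mulfV // scale1r.
exact: span_alg_rel1.
Qed.

Section DiscCalculus.
Variables (C : numClosedFieldType) (q : C) (q01 : 0 < q < 1).
Local Notation disc := (disc q).
Local Notation z := (disc_z q).
Local Notation zs := (disc_zs q).
Local Notation sigma := (disc_sigma q01).
Local Notation partial := (disc_partial q01).
Local Notation partialbar := (disc_partialbar q01).

(** The pair [(a, b)] stands for [a omega + b omega^*]. *)
Definition disc_forms1 (_ : 0 < q < 1) : Type := (disc * disc)%type.
Local Notation Om := (disc_forms1 q01).
HB.instance Definition _ := GRing.Zmodule.copy Om (disc * disc)%type.

Definition form (a b : disc) : Om := (a, b).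
Definition omega : Om := form 1 0.
Definition omegabar : Om := form 0 1.

Lemma formD a b a' b' : form a b + form a' b' = form (a + a') (b + b').
Proof. by []. Qed.
Lemma formB a b a' b' : form a b - form a' b' = form (a - a') (b - b').
Proof. by []. Qed.

Definition omega1_scale (c : disc) (u : Om) : Om :=
  form (c * u.1) (c * u.2).
Definition omega1_ract (u : Om) (c : disc) : Om :=
  form (u.1 * sigma c) (u.2 * sigma c).

Fact omega1_scaleA c e u :
  omega1_scale c (omega1_scale e u) = omega1_scale (c * e) u.
Proof. by case: u => a b; rewrite /omega1_scale /= !mulrA. Qed.
Fact omega1_scale1 : left_id 1 omega1_scale.
Proof. by case=> a b; rewrite /omega1_scale /= !mul1r. Qed.
Fact omega1_scaleDr : right_distributive omega1_scale +%R.
Proof. by move=> c [a b] [a' b']; rewrite /omega1_scale formD /= !mulrDr. Qed.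
Fact omega1_scaleDl u : {morph omega1_scale^~ u : c e / c + e}.
Proof. by case: u => a b c e; rewrite /omega1_scale formD /= !mulrDl. Qed.
HB.instance Definition _ := GRing.Zmodule_isLmodule.Build disc Om
  omega1_scaleA omega1_scale1 omega1_scaleDr omega1_scaleDl.

Fact omega1_ract1 u : omega1_ract u 1 = u.
Proof. by case: u => a b; rewrite /omega1_ract rmorph1 /= !mulr1. Qed.
Fact omega1_ractA u c e :
  omega1_ract u (c * e) = omega1_ract (omega1_ract u c) e.
Proof. by case: u => a b; rewrite /omega1_ract rmorphM /= !mulrA. Qed.
Fact omega1_ractDl u v c :
  omega1_ract (u + v) c = omega1_ract u c + omega1_ract v c.
Proof. by case: u v => a b [a' b']; rewrite /omega1_ract formD /= !mulrDl. Qed.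
Fact omega1_ractDr u c e :
  omega1_ract u (c + e) = omega1_ract u c + omega1_ract u e.
Proof. by case: u => a b; rewrite /omega1_ract formD raddfD /= !mulrDr. Qed.
Fact omega1_ractZ c u e : omega1_ract (c *: u) e = c *: omega1_ract u e.
Proof.
by case: u => a b; rewrite /GRing.scale /= /omega1_ract /omega1_scale /= !mulrA.
Qed.
HB.instance Definition _ := Lmodule_isBimodule.Build disc Om
  omega1_ract1 omega1_ractA omega1_ractDl omega1_ractDr omega1_ractZ.

Definition disc_d (a : disc) : Om :=
  partial a *: omega + partialbar a *: omegabar.

Lemma form_scale c a b : c *: form a b = form (c * a) (c * b).
Proof. by []. Qed.
Lemma form_ract a b c : form a b <* c = form (a * sigma c) (b * sigma c).
Proof. by []. Qed.

Fact form_omega a b : a *: omega + b *: omegabar = form a b.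
Proof.
by rewrite /omega /omegabar !form_scale formD !mulr1 !mulr0 addr0 add0r.
Qed.

Lemma disc_dE a : disc_d a = form (partial a) (partialbar a).
Proof. exact: form_omega. Qed.

Fact disc_d_additive : zmod_morphism disc_d.
Proof. by move=> a b; rewrite !disc_dE formB !raddfB. Qed.
HB.instance Definition _ :=
  GRing.isZmodMorphism.Build disc Om disc_d disc_d_additive.

Fact disc_d_leibniz a b : disc_d (a * b) = disc_d a <* b + a *: disc_d b.
Proof.
by rewrite !disc_dE disc_partialM disc_partialbarM form_ract form_scale formD.
Qed.

Let spanned (u : Om) := exists s : seq (disc * disc),
  u = \sum_(ab <- s) ab.1 *: disc_d ab.2.

Let spannedD u v : spanned u -> spanned v -> spanned (u + v).
Proof. by move=> [s ->] [t ->]; exists (s ++ t); rewrite big_cat. Qed.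

Let spannedZ a u : spanned u -> spanned (a *: u).
Proof.
move=> [s ->]; exists [seq (a * ab.1, ab.2) | ab <- s].
by rewrite big_map scaler_sumr; apply: eq_bigr => ab _; rewrite scalerA.
Qed.

Let spanned_d a : spanned (disc_d a).
Proof. by exists [:: (1, a)]; rewrite big_seq1 scale1r. Qed.

Let spannedR u a : spanned u -> spanned (u <* a).
Proof.
case=> s ->; elim: s => [|[b c] s IHs].
  by rewrite big_nil ract0l; exists [::]; rewrite big_nil.
rewrite big_cons ractDl /=; apply: spannedD => //.
rewrite ractZ; apply: spannedZ.
have /eqP := disc_d_leibniz c a; rewrite -subr_eq => /eqP <-.
by apply: spannedD; rewrite // -scaleN1r scalerA; apply: spannedZ.
Qed.

Fact disc_d_span (u : Om) : spanned u.
Proof.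
have q1 : 1 - q ^+ 2 != 0.
  have /andP[q0 q1] := q01.
  by rewrite subr_eq0 eq_sym lt_eqF // exprn_ilt1 // ltW.
have q2 : q ^+ 2 != 0 by rewrite expf_neq0 ?q_neq0.
pose c1 : disc := ((1 - q ^+ 2)^-1 / q ^+ 2)%:A.
pose c2 : disc := ((1 - q ^+ 2)^-1 * q ^+ 2)%:A.
have om : spanned omega.
  have -> : omega = c1 *: (disc_d z <* z) + (- c2) *: (z *: disc_d z).
    rewrite disc_dE disc_partial_z disc_partialbar_z form_ract !form_scale formD.
    rewrite mul0r !mulr0 addr0 disc_sigma_z.
    by rewrite (span_alg_rel1 q2 q1 (disc_zszE q)).
  by apply: spannedD; apply: spannedZ; [apply: spannedR|apply: spannedZ].
have omb : spanned omegabar.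
  have -> : omegabar = c1 *: (zs *: disc_d zs) + (- c2) *: (disc_d zs <* zs).
    rewrite disc_dE disc_partial_zs disc_partialbar_zs form_ract !form_scale.
    rewrite formD mul0r !mulr0 addr0 disc_sigma_zs.
    by rewrite (span_alg_rel2 q2 q1 (disc_zszE q)).
  by apply: spannedD; apply: spannedZ; [apply: spannedZ|apply: spannedR].
have -> : u = u.1 *: omega + u.2 *: omegabar.
  by case: u => a b; rewrite form_omega.
by apply: spannedD; apply: spannedZ.
Qed.

Definition disc_calculus : fodc disc := Fodc disc_d_leibniz disc_d_span.

End DiscCalculus.

(** * Laurent polynomials *)

(** The subring [K[X, X^-1]] of the field of rational functions. *)
Section Laurent.
Variable K : fieldType.
Local Notation F := {fraction {poly K}}.
Local Notation toF := (@tofrac {poly K}).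

Definition laurent_pred : pred F :=
  fun f => `[< exists (p : {poly K}) (n : nat), f = toF p / toF 'X^n >].

Fact laurent_subring_closed : subring_closed laurent_pred.
Proof.
have X0 n : toF 'X^n != 0 by rewrite tofrac_eq0 monic_neq0 ?monicXn.
split=> [|f g|f g].
- by apply/asboolP; exists 1, 0; rewrite expr0 rmorph1 divr1.
- move=> /asboolP[p [m ->]] /asboolP[r [n ->]]; apply/asboolP.
  exists (p * 'X^n - r * 'X^m), (m + n).
  by rewrite -mulNr addf_div // exprD rmorphB !rmorphM mulNr.
- move=> /asboolP[p [m ->]] /asboolP[r [n ->]]; apply/asboolP.
  by exists (p * r), (m + n); rewrite exprD !rmorphM mulf_div.
Qed.
HB.instance Definition _ :=
  GRing.isSubringClosed.Build F laurent_pred laurent_subring_closed.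

Record laurent := Laurent { laurent_val : F; _ : laurent_val \in laurent_pred }.
HB.instance Definition _ := [isSub for laurent_val].
HB.instance Definition _ := [Choice of laurent by <:].
HB.instance Definition _ := [SubChoice_isSubComNzRing of laurent by <:].

Fact laurent_const (c : K) : toF c%:P \in laurent_pred.
Proof. by apply/asboolP; exists c%:P, 0; rewrite expr0 rmorph1 divr1. Qed.

Definition laurentC (c : K) : laurent := Laurent (laurent_const c).

Fact laurentC_additive : zmod_morphism laurentC.
Proof. by move=> c d; apply: val_inj; rewrite /= polyCB !rmorphB. Qed.
Fact laurentC_monoid : monoid_morphism laurentC.
Proof. by split=> [|c d]; apply: val_inj; rewrite /= ?polyCM ?rmorphM ?rmorph1. Qed.
HB.instance Definition _ :=
  GRing.isZmodMorphism.Build K laurent laurentC laurentC_additive.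
HB.instance Definition _ :=
  GRing.isMonoidMorphism.Build K laurent laurentC laurentC_monoid.

Definition laurent_scale (c : K) (f : laurent) : laurent := laurentC c * f.
Fact laurent_scaleA c d f :
  laurent_scale c (laurent_scale d f) = laurent_scale (c * d) f.
Proof. by rewrite /laurent_scale rmorphM mulrA. Qed.
Fact laurent_scale1 : left_id 1 laurent_scale.
Proof. by move=> f; rewrite /laurent_scale rmorph1 mul1r. Qed.
Fact laurent_scaleDr : right_distributive laurent_scale +%R.
Proof. by move=> c f g; rewrite /laurent_scale mulrDr. Qed.
Fact laurent_scaleDl f : {morph laurent_scale^~ f : c d / c + d}.
Proof. by move=> c d; rewrite /laurent_scale raddfD mulrDl. Qed.
HB.instance Definition _ := GRing.Zmodule_isLmodule.Build K laurent
  laurent_scaleA laurent_scale1 laurent_scaleDr laurent_scaleDl.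
Fact laurent_scaleAl c (f g : laurent) : c *: (f * g) = (c *: f) * g.
Proof. exact: mulrA. Qed.
HB.instance Definition _ :=
  GRing.Lmodule_isLalgebra.Build K laurent laurent_scaleAl.
HB.instance Definition _ := GRing.Lalgebra_isComAlgebra.Build K laurent.
End Laurent.

(** * Properties of modules *)

Definition torsion (A : pzRingType) (M : lmodType A) : Prop :=
  forall m : M, exists2 a : A, a != 0 & a *: m = 0.

Definition dual_is_zero (A : nzRingType) (M : lmodType A) : Prop :=
  forall (f : {linear M -> A^o}) (m : M), f m = 0.

Definition projective (A : pzRingType) (M : lmodType A) : Prop :=
  forall (N P : lmodType A) (g : {linear N -> P}) (f : {linear M -> P}),
  (forall p, exists n, g n = p) ->
  exists h : {linear M -> N}, forall m, g (h m) = f m.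

(** [m] is a basis of the free module [M] of rank one. *)
Definition free_on (A : pzRingType) (M : lmodType A) (m : M) : Prop :=
  bijective (fun a : A => a *: m).

(** [e] is a basis over the scalars [K] of the module [M] over the [K]-algebra
    [A]; the scalars act through [c |-> c%:A]. *)
Definition is_basis (K : comNzRingType) (A : algType K) (M : lmodType A)
    (I : eqType) (e : I -> M) : Prop :=
  (forall m : M, exists (s : seq I) (c : I -> K),
     m = \sum_(i <- s) (c i)%:A *: e i) /\
  (forall (s : seq I) (c : I -> K), uniq s ->
     \sum_(i <- s) (c i)%:A *: e i = 0 -> forall i, i \in s -> c i = 0).

(** * Two-forms on the quantum disc and the circle *)

Section DiscTwoForms.
Variables (C : numClosedFieldType) (q : C).
Local Notation disc := (disc q).

(** The two-sided ideal generated by [x]. *)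
Definition disc_x_ideal : disc -> Prop := ideal_gen (fun a => a = disc_x q).

Fact disc_x_proper : ~ disc_x_ideal 1.
Proof.
have idC (c b : C) : idfun c * b = b * idfun c by exact: mulrC.
have rel : (1 : C) * 1 - idfun (q ^+ 2) * (1 * 1) = idfun (1 - q ^+ 2).
  by rewrite !mulr1.
pose f : disc -> C := disc_lift 1 1 idC.
have fB : zmod_morphism f := disc_lift_additive idC rel.
have [f1 fM] : monoid_morphism f := disc_lift_monoid idC rel.
have f0 : f 0 = 0 by rewrite -(subrr 1) fB subrr.
have fx : f (disc_x q) = 0.
  have fz : f (disc_z q) = 1 := disc_lift_z idC rel.
  have fzs : f (disc_zs q) = 1 := disc_lift_zs idC rel.
  by rewrite /disc_x fB fM f1 fz fzs mulr1 subrr.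
suff fI a : disc_x_ideal a -> f a = 0.
  by move=> /fI /eqP; rewrite f1 oner_eq0.
elim=> {a} [|a b _ fa _ fb|a s b ->] //; last by rewrite !fM fx mulr0 mul0r.
by rewrite (zmod_morphismD fB) fa fb addr0.
Qed.

(** The quotient of the disc algebra by the ideal generated by [x]. *)
Definition disc_mod_x : Type := alg_quot disc_x_proper.
HB.instance Definition _ := GRing.Algebra.on disc_mod_x.
Definition disc_mod_x_pi : disc -> disc_mod_x := alg_pi disc_x_proper.
HB.instance Definition _ := GRing.LRMorphism.on disc_mod_x_pi.

Section Omega2.
Hypothesis q01 : 0 < q < 1.

Definition disc_forms2 : Type := forms2 (disc_calculus q01).
HB.instance Definition _ := Bimodule.on disc_forms2.

Definition disc_mul1 (u v : disc_forms1 q01) : disc_forms2 :=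
  @wedge _ (disc_calculus q01) u v.
Definition disc_d1 (u : disc_forms1 q01) : disc_forms2 :=
  @d1 _ (disc_calculus q01) u.

Definition disc_v : disc_forms2 :=
  (q ^- 6 / (q ^+ 2 - 1))%:A *:
    (disc_mul1 (omegabar q01) (omega q01) +
     (q ^+ 8)%:A *: disc_mul1 (omega q01) (omegabar q01)).
End Omega2.
End DiscTwoForms.

Lemma complex_01 (R : realType) (q : R) : 0 < q < 1 -> 0 < (q%:C%C : R[i]) < 1.
Proof. by rewrite -[0 : R[i]]/(0%:C%C) -[1 : R[i]]/(1%:C%C) !ltcR. Qed.

(* Main.v *)
From HB Require Import structures.
Require Import Defs.
From mathcomp Require Import all_boot all_order all_algebra.
From mathcomp Require Import boolp reals complex ring.

Set Implicit Arguments.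
Unset Strict Implicit.
Unset Printing Implicit Defensive.

Import Order.TTheory GRing.Theory Num.Theory.
Local Open Scope ring_scope.

(** Write [t] for [q ^+ 2], [v] for [disc_v] and [symbol] for the morphism from
    the disc algebra to the Laurent polynomials [laurent C] which restricts to
    the boundary circle: it sends [z] to the variable and [zs], the adjoint of
    [z], to its inverse.

    The two-forms are bounded from above and from below. From above: the
    equations [d (d z) = 0] and [d (d zs) = 0], together with the differentials
    of the commutation relations of [omega] and [omegabar] with [z] and [zs],
    form a linear system for [d omega], [d omegabar] and the four products of
    [omega] and [omegabar]. Solving it ([two_form_relations]) expresses all of
    them by [v = omega * omegabar] and shows that [x] kills [v]; so the
    two-forms are a cyclic module over the disc algebra modulo [x]. Exchanging
    [z] with [zs] and [t] with [t^-1] preserves the system, and one half of it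
    is solved in [HalfRelations].

    From below: the formulas found in this way define a pairing of one-forms
    with values in [laurent C], and a map [D] on one-forms standing for the
    differential. If [D] satisfies the graded Leibniz rule and kills exact
    forms, then the pairing vanishes on the relations of the universal
    extension and descends to a map [Phi] on two-forms ([forms2_lift]). Both
    conditions pass to products, so they are checked on [z] and [zs]
    only ([d1_compatible_z], [d1_compatible_zs]). Since [Phi v = 1] and [Phi]
    is semilinear along [symbol], the annihilator of [v] is exactly the kernel
    of [symbol].

    It remains to understand the disc algebra. Every element is
    [\sum_j x ^+ j * b_j] for finitely many linear combinations [b_j] of the
    [z ^+ n] and [zs ^+ n] ([x_length_ex]), whence the kernel of [symbol] is
    generated by [x] ([symbol_eq0]). The element [x] is not a zero divisor
    ([x_lreg]): [disc_partial] sends [x] to a multiple of [zs ^+ 2], whose symbol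
    is a unit, so repeated derivation of [x ^+ n * b = 0] shows that [b] is again
    divisible by [x], and this cannot go on forever. As [x] is regular and
    annihilates the two-forms, these are torsion with zero dual, and a nonzero
    cyclic module with zero dual is not projective. *)

(** * Monomial basis of the Laurent polynomials *)

Section LaurentMonomials.
Variable K : fieldType.
Local Notation F := {fraction {poly K}}.
Local Notation toF := (@tofrac {poly K}).

Fact tofracX_neq0 n : toF 'X^n != 0.
Proof. by rewrite tofrac_eq0 monic_neq0 ?monicXn. Qed.

Fact laurentX_subproof (i : int) : toF 'X ^ i \in @laurent_pred K.
Proof.
apply/asboolP; case: i => n.
  by exists 'X^n, 0; rewrite expr0 rmorph1 divr1 rmorphXn.
by exists 1, n.+1; rewrite rmorph1 div1r rmorphXn.
Qed.

Definition laurentX (i : int) : laurent K := Laurent (laurentX_subproof i).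

Lemma laurentX0 : laurentX 0 = 1.
Proof. exact: val_inj. Qed.

Lemma laurentXD i j : laurentX (i + j) = laurentX i * laurentX j.
Proof.
apply: val_inj; rewrite /= expfzDr //.
by have := tofracX_neq0 1; rewrite expr1.
Qed.

(** [P] and [m] stand for the Laurent polynomial [P / X ^ m]; its value under
    the linear map sending [X ^ i] to [e i]. *)
Definition laurent_sum (V : lmodType K) (e : int -> V) m (P : {poly K}) : V :=
  \sum_(k < size P) P`_k *: e (k%:Z - m%:Z).

Section Lift.
Variables (V : lmodType K) (e : int -> V).

Lemma laurent_sumEw n m (P : {poly K}) : (size P <= n)%N ->
  laurent_sum e m P = \sum_(k < n) P`_k *: e (k%:Z - m%:Z).
Proof.
move=> leP; rewrite /laurent_sum (big_ord_widen n (fun k => P`_k *: e (k%:Z - m%:Z))) //.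
rewrite big_mkcond; apply: eq_bigr => k _; case: ltnP => // leP'.
by rewrite nth_default ?scale0r.
Qed.

Lemma laurent_sum_linear m : linear (laurent_sum e m).
Proof.
move=> c P Q; set n := maxn (size P) (size Q).
have leP : (size P <= n)%N by rewrite leq_maxl.
have leQ : (size Q <= n)%N by rewrite leq_maxr.
have leS : (size (c *: P + Q)%R <= n)%N.
  rewrite (leq_trans (size_polyD _ _)) // geq_max leQ andbT.
  exact: leq_trans (size_scale_leq _ _) leP.
rewrite !(@laurent_sumEw n) // scaler_sumr -big_split; apply: eq_bigr => k _.
by rewrite coefD coefZ scalerDl scalerA.
Qed.

Lemma laurent_sum_shift n m (P : {poly K}) :
  laurent_sum e (m + n) (P * 'X^n) = laurent_sum e m P.
Proof.
have le : (size (P * 'X^n)%R <= n + size P)%N.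
  by rewrite (leq_trans (size_polyMleq _ _)) // size_polyXn addnS addnC.
rewrite (laurent_sumEw _ le) big_split_ord /= big1 ?add0r => [|k _].
  apply: eq_bigr => k _; rewrite coefMXn ltnNge leq_addr /= addKn.
  by congr (_ *: e _); rewrite !PoszD; ring.
by rewrite coefMXn ltn_ord scale0r.
Qed.

(** The value does not depend on the presentation of the Laurent polynomial. *)
Lemma laurent_sum_eq m n (P Q : {poly K}) :
  toF P / toF 'X^m = toF Q / toF 'X^n -> laurent_sum e m P = laurent_sum e n Q.
Proof.
move=> /eqP; rewrite eqr_div ?tofracX_neq0 // -!rmorphM tofrac_eq => /eqP PQ.
by rewrite -(laurent_sum_shift n m P) -(laurent_sum_shift m n Q) PQ addnC.
Qed.

(** The monomials are a basis: linear maps out of the Laurent polynomials may be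
    prescribed on them. *)
Lemma laurent_lift : exists g : {linear laurent K -> V},
  forall i, g (laurentX i) = e i.
Proof.
have rep (f : laurent K) : exists Pm : {poly K} * nat,
    val f = toF Pm.1 / toF 'X^(Pm.2).
  by case: f => f /= /asboolP[P [m ->]]; exists (P, m).
pose g f := let Pm := projT1 (cid (rep f)) in laurent_sum e Pm.2 Pm.1.
have gE P m (f : laurent K) : val f = toF P / toF 'X^m -> g f = laurent_sum e m P.
  by rewrite /g; case: cid => -[P' m'] /= -> /laurent_sum_eq.
have gl : linear g.
  move=> c f f'; have [[P m] /= Pf] := rep f; have [[Q n] /= Qf] := rep f'.
  rewrite (gE _ _ _ Pf) (gE _ _ _ Qf).
  rewrite -(laurent_sum_shift n m) -(laurent_sum_shift m n) (addnC n m).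
  rewrite -laurent_sum_linear; apply: gE.
  rewrite /= Pf Qf mulrA addf_div ?tofracX_neq0 // -!rmorphM -exprD -rmorphD.
  by rewrite -mul_polyC mulrA.
pose G := GRing.isLinear.Build K (laurent K) V _ g gl.
pose gL : {linear laurent K -> V} := HB.pack g G.
exists gL => -[n|n] /=.
  rewrite (gE 'X^n 0); last by rewrite expr0 rmorph1 divr1 rmorphXn.
  rewrite (@laurent_sumEw n.+1) ?size_polyXn // big_ord_recr /= coefXn eqxx.
  rewrite scale1r subr0 big1 ?add0r // => k _.
  by rewrite coefXn ltn_eqF ?scale0r.
rewrite (gE 1 n.+1); last by rewrite rmorph1 div1r rmorphXn.
by rewrite /laurent_sum size_poly1 big_ord1 coefC eqxx scale1r sub0r.
Qed.
End Lift.

Lemma laurent_span (f : laurent K) :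
  exists m (P : {poly K}), f = laurent_sum laurentX m P.
Proof.
case: f => f /= fP; have /asboolP[P [m Pf]] := fP; exists m, P.
apply: val_inj; rewrite /= {1}Pf.
rewrite (big_morph (@laurent_val K) (fun _ _ => erefl) (erefl _)) /=.
rewrite -{1}[P]coefK poly_def rmorph_sum mulr_suml; apply: eq_bigr => k _.
rewrite -mul_polyC !rmorphM -mulrA; congr (_ * _).
have X0 : toF 'X != 0 by have := tofracX_neq0 1; rewrite expr1.
by rewrite expfzDr // !rmorphXn /= -exprnN.
Qed.

Lemma laurent_ind (P : laurent K -> Prop) :
  P 0 -> (forall c i f, P f -> P (c *: laurentX i + f)) -> forall f, P f.
Proof.
move=> P0 PD f; have [m [Q ->]] := laurent_span f; rewrite /laurent_sum.
by elim/big_rec: _ => // k g _; apply: PD.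
Qed.

Lemma laurentX_free (s : seq int) (c : int -> K) : uniq s ->
  \sum_(i <- s) c i *: laurentX i = 0 -> forall i, i \in s -> c i = 0.
Proof.
move=> us s0 i si.
(* [g] is the functional of the coefficient of [X ^ i]. *)
have [g gE] := @laurent_lift K^o (fun j => (i == j)%:R).
have := congr1 g s0; rewrite linear0 linear_sum (bigD1_seq i) //=.
rewrite linearZ /= gE eqxx big1 => [|j ji].
  by rewrite addr0 => <-; rewrite [RHS]mulr1.
by rewrite linearZ /= gE eq_sym (negPf ji) scaler0.
Qed.

Lemma laurentX_inv : laurentX 1 * laurentX (-1) = 1.
Proof. by rewrite -laurentXD laurentX0. Qed.

Lemma laurentCE (c : K) : laurentC c = c%:A :> laurent K.
Proof. by rewrite -[RHS]/(laurentC c * 1) mulr1. Qed.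

Lemma laurentX_exp (i : int) n : laurentX i ^+ n = laurentX (i * n%:Z).
Proof.
elim: n => [|n IHn]; first by rewrite mulr0 laurentX0.
by rewrite exprS IHn -laurentXD intS mulrDr mulr1.
Qed.
End LaurentMonomials.

(** * The linear system satisfied by the two-forms *)

Section ScalarAction.
Variables (C : fieldType) (A : algType C) (M : lmodType A).

(** The action of the scalars, as an operation of its own so that it can be
    moved past the action of [A] by rewriting. *)
Definition cscale (c : C) (w : M) : M := c%:A *: w.
Local Notation "c *' w" := (cscale c w) (at level 40, left associativity).

Lemma cscaleA c e w : c *' (e *' w) = (c * e) *' w.
Proof. by rewrite /cscale scalerA mulr_algl scalerA. Qed.
Lemma cscaleDl c e w : (c + e) *' w = c *' w + e *' w.
Proof. by rewrite /cscale scalerDl scalerDl. Qed.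
Lemma cscaleDr c w w' : c *' (w + w') = c *' w + c *' w'.
Proof. exact: scalerDr. Qed.
Lemma cscaleBr c w w' : c *' (w - w') = c *' w - c *' w'.
Proof. exact: scalerBr. Qed.
Lemma cscaleNl c w : (- c) *' w = - (c *' w).
Proof. by rewrite /cscale !scaleNr. Qed.
Lemma cscale1 w : 1 *' w = w.
Proof. by rewrite /cscale !scale1r. Qed.
Lemma cscale0 c : c *' 0 = 0.
Proof. exact: scaler0. Qed.
Lemma cscaleC (a : A) c w : a *: (c *' w) = c *' (a *: w).
Proof. by rewrite /cscale !scalerA mulr_algl mulr_algr. Qed.
Lemma scale_cscale c (a : A) w : (c *: a) *: w = c *' (a *: w).
Proof. by rewrite /cscale scalerA mulr_algl. Qed.
Lemma cscaleK c w w' : c != 0 -> c *' w = w' -> w = c^-1 *' w'.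
Proof. by move=> c0 <-; rewrite cscaleA mulVf // cscale1. Qed.
Lemma cscale_eq0 c w : c != 0 -> c *' w = 0 -> w = 0.
Proof. by move=> c0 /(cscaleK c0) ->; rewrite cscale0. Qed.
End ScalarAction.

Notation "c *' w" := (cscale c w) (at level 40, left associativity).

Section HalfRelations.
Variables (C : fieldType) (A : algType C) (M : bimodType A).
Hypothesis ract_alg : forall c (w : M), w <* c%:A = c *' w.

Lemma ract_cscale c (w : M) (a : A) : (c *' w) <* a = c *' (w <* a).
Proof. exact: ractZ. Qed.

Lemma ract_scale c (w : M) (a : A) : w <* (c *: a) = c *' (w <* a).
Proof. by rewrite -mulr_algl ractA ract_alg ract_cscale. Qed.

Variables (t : C) (z zs : A).
Hypotheses (t0 : t != 0) (t1 : 1 - t != 0) (t2 : 1 + t ^+ 2 != 0).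
Hypothesis t3 : 1 - t ^+ 3 != 0.
Let x : A := 1 - z * zs.
Hypothesis zszE : zs * z = t *: (z * zs) + (1 - t)%:A.

Let zzs : z * zs = 1 - x. Proof. by rewrite /x subKr. Qed.
Let zszx : zs * z = 1 - t *: x.
Proof.
rewrite zszE /x scalerBr scalerBl scale1r opprB addrC addrA.
by rewrite addrAC.
Qed.
Let xz : x * z = t *: (z * x).
Proof.
transitivity (z - z * (zs * z)); first by rewrite mulrBl mul1r mulrA.
by rewrite zszx mulrBr mulr1 subKr scalerAr.
Qed.
Let zsx : zs * x = t *: (x * zs).
Proof.
transitivity (zs - (zs * z) * zs); first by rewrite mulrBr mulr1 mulrA.
by rewrite zszx mulrBl mul1r subKr scalerAl.
Qed.

(** [zs * z - t *: (z * zs)] is a nonzero scalar. *)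
Lemma z_zs_eq0 (w : M) : z *: (zs *: w) = 0 -> zs *: (z *: w) = 0 -> w = 0.
Proof.
rewrite !scalerA => h1 h2; apply: (cscale_eq0 t1).
rewrite /cscale; have <- : zs * z - t *: (z * zs) = (1 - t)%:A.
  by rewrite zszE addrAC subrr add0r.
by rewrite scalerBl scale_cscale h1 h2 cscale0 subr0.
Qed.

(** The commutation [w <* a = sigma (sigma a) *: w] on the generators. *)
Definition twisted (w : M) : Prop :=
  w <* z = t ^+ 2 *' (z *: w) /\ w <* zs = t ^- 2 *' (zs *: w).

(** [D], [P], [Q] and [R] play the parts of [d omega], [omegabar * omega],
    [omega * omegabar] and [omega * omega]; the hypotheses are [d (d z) = 0] and
    [d] of the two commutation relations of [omega]. *)
Variables D P Q R : M.
Hypotheses (twP : twisted P) (twQ : twisted Q) (twR : twisted R).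
Hypothesis zsD : zs *: D = (- t) *' (z *: P).
Hypothesis Dz : D <* z = t *' (z *: D) + (t + t^-1) *' (zs *: R).
Hypothesis Dzs : D <* zs = t ^+ 2 *' (z *: Q).

Let k : C := - (1 + t ^- 2) / (1 - t).

Let k_neq0 : k != 0.
Proof.
rewrite /k mulf_neq0 ?invr_eq0 // oppr_eq0.
have -> : 1 + t ^- 2 = (1 + t ^+ 2) / t ^+ 2 by field.
by rewrite mulf_neq0 ?invr_eq0 ?expf_neq0.
Qed.

(** Compute [D <* (zs * z)] in two ways: directly, and after rewriting [zs * z]
    by the relation of the algebra. The terms in [Q] cancel. *)
Lemma half_D : D = k *' (zs ^+ 2 *: R).
Proof.
have e1 : D <* (zs * z) = t ^+ 4 *' (z ^+ 2 *: Q).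
  rewrite ractA Dzs ract_cscale ractZ (proj1 twQ) cscaleC cscaleA scalerA.
  by rewrite -exprD.
have e2 : D <* (z * zs) = t ^+ 3 *' (z ^+ 2 *: Q)
    + ((t + t^-1) / t ^+ 2) *' (zs ^+ 2 *: R).
  rewrite ractA Dz ractDl !ract_cscale !ractZ Dzs (proj2 twR) !cscaleC.
  by rewrite !cscaleA !scalerA -exprS.
have : D <* (zs * z) = t *' (D <* (z * zs)) + (1 - t) *' D.
  by rewrite zszE ractDr ract_scale ract_alg.
rewrite e1 e2 cscaleDr !cscaleA -exprS -addrA -{1}[LHS]addr0 => /addrI/esym/eqP.
rewrite addr_eq0 eq_sym eqr_oppLR -cscaleNl => /eqP/(cscaleK t1) ->.
rewrite cscaleA; congr (_ *' _); rewrite /k; field.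
by rewrite t0 t1.
Qed.

(** [z *: P] and [z *: Q] are multiples of the same element, which links them. *)
Lemma half_zP : z *: P = (- (k / t)) *' (zs ^+ 3 *: R).
Proof.
have nt : - t != 0 by rewrite oppr_eq0.
rewrite (cscaleK nt (esym zsD)) half_D cscaleC cscaleA scalerA -exprS.
by congr (_ *' _); field; rewrite t0 nt.
Qed.

Lemma half_zQ : z *: Q = (k / t ^+ 4) *' (zs ^+ 3 *: R).
Proof.
rewrite (cscaleK (expf_neq0 2 t0) (esym Dzs)) half_D ract_cscale ractZ.
rewrite (proj2 twR) cscaleC !cscaleA scalerA -exprSr.
by congr (_ *' _); field.
Qed.

Lemma half_PQ : z *: (P + t ^+ 3 *' Q) = 0.
Proof.
rewrite scalerDr cscaleC half_zP half_zQ cscaleA -cscaleDl.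
by rewrite (_ : _ + _ = 0) ?/cscale ?scale0r ?scale0r //; field.
Qed.

(** Substituting [half_D] into the commutation of [D] with [z], the terms in
    [zs *: R] cancel and a multiple of [(zs * x) *: R] is left. *)
Lemma half_zsxR : (zs * x) *: R = 0.
Proof.
have e1 : zs ^+ 2 * z = zs - t *: (zs * x).
  by rewrite exprS expr1 -mulrA zszx mulrBr mulr1 scalerAr.
have e2 : z * zs ^+ 2 = zs - t^-1 *: (zs * x).
  by rewrite exprS mulrA zzs mulrBl mul1r zsx scalerA mulVf // scale1r.
have := Dz; rewrite half_D ract_cscale ractZ (proj1 twR) !cscaleC !scalerA.
rewrite e1 e2 !scalerBl !scale_cscale -!cscaleNl !cscaleDr !cscaleA.
set a := zs *: R; set b := (zs * x) *: R => /eqP.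
rewrite addrAC -cscaleDl -subr_eq0 opprD addrACA -!cscaleNl -!cscaleDl.
set c := (X in X *' a + _); set d := (X in _ + X *' b).
have -> : c = 0 by rewrite /c /k; field; rewrite t0 t1.
rewrite /cscale scale0r scale0r add0r => /eqP /cscale_eq0; apply.
have -> : d = k * (1 - t ^+ 3) by rewrite /d; field.
by rewrite mulf_neq0.
Qed.

Lemma x_fixed_eq0 (w : M) : (1 - x) *: w = 0 -> (1 - t *: x) *: w = 0 -> w = 0.
Proof. by rewrite -zzs -zszx -!scalerA; apply: z_zs_eq0. Qed.

(** Since [R] is [twisted], multiplying [(zs * x) *: R = 0] by [z] on the right
    also gives [(zs * z) *: (x *: R) = 0]. *)
Lemma half_xR : x *: R = 0.
Proof.
apply: x_fixed_eq0; first by rewrite -zzs scalerA -mulrA -scalerA half_zsxR scaler0.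
have : ((zs * x) *: R) <* z = 0 by rewrite half_zsxR ract0l.
rewrite ractZ (proj1 twR) cscaleC => /(cscale_eq0 (expf_neq0 2 t0)).
rewrite scalerA -mulrA xz -scalerAr mulrA zszx scale_cscale.
by move=> /(cscale_eq0 t0); rewrite scalerA.
Qed.

(** [x] commutes up to scalars with [z] and [zs], so that [x *: R = 0] can be
    carried through [half_zQ]. *)
Lemma half_zxQ : z *: (x *: Q) = 0.
Proof.
have /cscaleK : t *' (z *: (x *: Q)) = x *: (z *: Q).
  by rewrite !scalerA xz scale_cscale.
move=> ->; rewrite // half_zQ cscaleC cscaleA.
have [c e] : exists c : C, x * zs ^+ 3 = c *: (zs ^+ 3 * x).
  elim: 3%N => [|n [c IHn]]; first by exists 1; rewrite scale1r mulr1 mul1r.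
  exists (c / t); rewrite exprSr mulrA IHn -scalerAl -[_ * x * zs]mulrA.
  have -> : x * zs = t^-1 *: (zs * x) by rewrite zsx scalerA mulVf // scale1r.
  by rewrite -scalerAr scalerA mulrA.
by rewrite scalerA e scale_cscale -scalerA half_xR scaler0 !cscale0.
Qed.

Lemma x_z_exp n (w : M) : x *: w = 0 -> x *: (z ^+ n *: w) = 0.
Proof.
move=> xw; elim: n => [|n IHn]; first by rewrite scale1r.
by rewrite exprS -scalerA scalerA xz scale_cscale -scalerA IHn scaler0 cscale0.
Qed.

(** On elements killed by [x], the actions of [z] and [zs] are inverse to each
    other. *)
Lemma zs_z_exp n (w : M) : x *: w = 0 -> zs ^+ n *: (z ^+ n *: w) = w.
Proof.
move=> xw; elim: n => [|n IHn]; first by rewrite !scale1r.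
rewrite exprSr exprS -!scalerA [zs *: _]scalerA zszx scalerBl scale_cscale.
by rewrite x_z_exp // cscale0 subr0 scale1r.
Qed.

Lemma z_zs_exp n (w : M) : x *: w = 0 -> z ^+ n *: (zs ^+ n *: w) = w.
Proof.
have xzs : x * zs = t^-1 *: (zs * x) by rewrite zsx scalerA mulVf // scale1r.
move=> xw; elim: n => [|n IHn]; first by rewrite !scale1r.
have e m : x *: (zs ^+ m *: w) = 0.
  elim: m => [|m IHm]; first by rewrite scale1r.
  by rewrite exprS -scalerA scalerA xzs scale_cscale -scalerA IHm scaler0 cscale0.
rewrite exprSr exprS -!scalerA [z *: (zs *: _)]scalerA zzs scalerBl e.
by rewrite subr0 scale1r.
Qed.

Hypothesis xQ : x *: Q = 0.

Let t2' : t ^+ 2 + 1 != 0. Proof. by rewrite addrC. Qed.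

Lemma half_R_Q : R = (t ^+ 6 * ((t - 1) / (t ^+ 2 + 1))) *' (z ^+ 4 *: Q).
Proof.
have kt : k / t ^+ 4 != 0 by rewrite mulf_neq0 ?invr_eq0 ?expf_neq0.
rewrite -{1}(z_zs_exp 3 half_xR) (cscaleK kt (esym half_zQ)) cscaleC scalerA.
rewrite -exprSr; congr (_ *' _); rewrite /k; field.
by rewrite ?oppr_eq0 t0 t1 t2'.
Qed.

Lemma half_D_Q : D = t ^+ 4 *' (z ^+ 2 *: Q).
Proof.
rewrite half_D half_R_Q cscaleC cscaleA (exprD z 2 2) -scalerA zs_z_exp.
  by congr (_ *' _); rewrite /k; field; rewrite ?oppr_eq0 t0 t1 t2'.
exact: x_z_exp.
Qed.
End HalfRelations.

Section TwoFormRelations.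
Variables (C : fieldType) (A : algType C) (M : bimodType A).
Hypothesis ract_alg : forall c (w : M), w <* c%:A = c *' w.
Variables (t : C) (z zs : A).
Hypotheses (t0 : t != 0) (t1 : 1 - t != 0) (t2 : 1 + t ^+ 2 != 0).
Hypothesis t3 : 1 - t ^+ 3 != 0.
Let x : A := 1 - z * zs.
Hypothesis zszE : zs * z = t *: (z * zs) + (1 - t)%:A.
Variables D D' P Q R S : M.
Hypotheses (twP : twisted t z zs P) (twQ : twisted t z zs Q).
Hypotheses (twR : twisted t z zs R) (twS : twisted t z zs S).
Hypothesis zsD : zs *: D = (- t) *' (z *: P).
Hypothesis Dz : D <* z = t *' (z *: D) + (t + t^-1) *' (zs *: R).
Hypothesis Dzs : D <* zs = t ^+ 2 *' (z *: Q).
Hypothesis zD' : z *: D' = - (zs *: Q).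
Hypothesis D'zs : D' <* zs = t^-1 *' (zs *: D') + (1 + t ^+ 2) *' (z *: S).
Hypothesis D'z : D' <* z = t^-1 *' (zs *: P).

(** The hypotheses are invariant under exchanging [z] and [zs], replacing [t]
    by its inverse and rescaling the products of one-forms. *)
Lemma two_form_relations :
  [/\ P = (- t ^+ 3) *' Q, x *: Q = 0,
      D = t ^+ 4 *' (z ^+ 2 *: Q) /\ D' = (-1) *' (zs ^+ 2 *: Q),
      R = (t ^+ 6 * ((t - 1) / (t ^+ 2 + 1))) *' (z ^+ 4 *: Q) &
      S = (t ^- 2 * ((t - 1) / (t ^+ 2 + 1))) *' (zs ^+ 4 *: Q)].
Proof.
have s0 : t^-1 != 0 by rewrite invr_eq0.
have s1 : 1 - t^-1 != 0.
  have -> : 1 - t^-1 = - (1 - t) / t by field.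
  by rewrite mulf_neq0 // oppr_eq0.
have s2 : 1 + t^-1 ^+ 2 != 0.
  have -> : 1 + t^-1 ^+ 2 = (1 + t ^+ 2) / t ^+ 2 by field.
  by rewrite mulf_neq0 // invr_eq0 expf_neq0.
have s3 : 1 - t^-1 ^+ 3 != 0.
  have -> : 1 - t^-1 ^+ 3 = - (1 - t ^+ 3) / t ^+ 3 by field.
  by rewrite mulf_neq0 ?oppr_eq0 // invr_eq0 expf_neq0.
have zzsE : z * zs = t^-1 *: (zs * z) + (1 - t^-1)%:A.
  rewrite zszE scalerDr !scalerA mulVf // scale1r -addrA -scalerDl.
  by rewrite (_ : t^-1 * (1 - t) + _ = 0) ?scale0r ?addr0 //; field.
have sw (w : M) c : twisted t z zs w -> twisted t^-1 zs z (c *' w).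
  move=> [wz wzs]; split; rewrite ract_cscale ?wz ?wzs cscaleC !cscaleA.
    by congr (_ *' _); rewrite exprVn mulrC.
  by congr (_ *' _); rewrite exprVn invrK mulrC.
have D'E : z *: D' = (- t^-1) *' (zs *: (t *' Q)).
  by rewrite cscaleC cscaleA mulNr mulVf // cscaleNl cscale1.
have D'zsE : D' <* zs =
    t^-1 *' (zs *: D') + (t^-1 + t^-1^-1) *' (z *: (t *' S)).
  rewrite cscaleC cscaleA D'zs; congr (_ + _ *' _).
  by rewrite invrK mulrDl mulVf.
have D'zE : D' <* z = t^-1 ^+ 2 *' (zs *: (t *' P)).
  by rewrite cscaleC cscaleA D'z; congr (_ *' _); field.
have zPQ := half_PQ ract_alg t0 t1 zszE twQ twR zsD Dz Dzs.
(* In the exchanged system [P] and [Q] trade places up to the factor [t]. *)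
have zsPQ := half_PQ ract_alg s0 s1 zzsE (sw _ _ twP) (sw _ _ twS)
  D'E D'zsE D'zE.
have PQ : P = (- t ^+ 3) *' Q.
  apply/eqP; rewrite cscaleNl -addr_eq0; apply/eqP.
  apply: (z_zs_eq0 t1 zszE); last by rewrite zPQ scaler0.
  suff -> : zs *: (P + t ^+ 3 *' Q) = 0 by rewrite scaler0.
  have <- : t ^+ 2 *' (t *' Q + t^-1 ^+ 3 *' (t *' P)) = P + t ^+ 3 *' Q.
    rewrite cscaleDr !cscaleA -exprSr addrC -[P in RHS]cscale1.
    by congr (_ *' _ + _); field.
  by rewrite cscaleC zsPQ cscale0.
have zxQ := half_zxQ ract_alg t0 t1 t2 t3 zszE twQ twR Dz Dzs.
have zsxP := half_zxQ ract_alg s0 s1 s2 s3 zzsE (sw _ _ twP) (sw _ _ twS)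
  D'zsE D'zE.
have xx : 1 - zs * z = t *: x.
  by rewrite zszE /x scalerBr scalerBl scale1r opprD opprB addrC addrA subrK addrC.
have xQ : x *: Q = 0.
  apply: (z_zs_eq0 t1 zszE); last by rewrite zxQ scaler0.
  suff -> : zs *: (x *: Q) = 0 by rewrite scaler0.
  have : t *' ((t * (- t ^+ 3)) *' (zs *: (x *: Q))) = 0.
    by rewrite -[RHS]zsxP xx PQ [in RHS]cscaleA scale_cscale !cscaleC.
  by move=> /(cscale_eq0 t0)/cscale_eq0; apply; rewrite mulf_neq0 ?oppr_eq0 ?expf_neq0.
have xP : (1 - zs * z) *: (t *' P) = 0.
  by rewrite xx PQ cscaleA scale_cscale cscaleC xQ !cscale0.
have RQ := half_R_Q ract_alg t0 t1 t2 t3 zszE twQ twR Dz Dzs.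
have DQ := half_D_Q ract_alg t0 t1 t2 t3 zszE twQ twR Dz Dzs xQ.
have SP := half_R_Q ract_alg s0 s1 s2 s3 zzsE (sw _ _ twP) (sw _ _ twS)
  D'zsE D'zE.
have D'P := half_D_Q ract_alg s0 s1 s2 s3 zzsE (sw _ _ twP) (sw _ _ twS)
  D'zsE D'zE xP.
split=> //; first split=> //.
  rewrite D'P PQ cscaleA cscaleC cscaleA; congr (_ *' _); field.
  by [].
rewrite (cscaleK t0 SP) PQ !cscaleC !cscaleA; congr (_ *' _); field.
by rewrite t0 addrC t2.
Qed.
End TwoFormRelations.

(** * The differential calculus of the universal extension *)

Section GradedLeibniz.
Variables (A : pzRingType) (F : fodc A).
Local Notation d := (fodc_d F).
Implicit Types (a b : A) (u v w : forms1 F).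

Lemma wedgeDr u v w : wedge u (v + w) = wedge u v + wedge u w.
Proof. by rewrite /wedge tensDr raddfD. Qed.

Lemma wedgeBl u v w : wedge (u - v) w = wedge u w - wedge v w.
Proof. by rewrite wedgeDl -[- v]scaleN1r wedgeZl scaleN1r. Qed.

Lemma wedge0l w : wedge 0 w = 0.
Proof. by rewrite -(subrr 0) wedgeBl subrr. Qed.

Lemma wedge0r u : wedge u 0 = 0.
Proof. by apply: (addrI (wedge u 0)); rewrite -wedgeDr !addr0. Qed.

Lemma wedgeA u a v : wedge (u <* a) v = wedge u (a *: v).
Proof. by rewrite /wedge tensA. Qed.

Lemma wedgeR u v a : wedge u (v <* a) = wedge u v <* a.
Proof. by rewrite /wedge -bimod_piR [tens _ _ <* a]tens_ractE. Qed.

Lemma fodc_d1 : d 1 = 0.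
Proof.
have /eqP := fodc_leibniz F 1 1.
by rewrite mulr1 ract1 scale1r -{1}[d 1]addr0 (inj_eq (addrI _)) eq_sym => /eqP.
Qed.

Lemma d1_gen a b : d1 (a *: d b) = wedge (d a) (d b).
Proof. by have := d1E F [:: (a, b)]; rewrite !big_seq1. Qed.

Lemma d1D u v : d1 (u + v) = d1 u + d1 v.
Proof.
have [s ->] := fodc_span u; have [r ->] := fodc_span v.
by rewrite -big_cat !d1E big_cat.
Qed.

Lemma d10 : d1 (0 : forms1 F) = 0.
Proof. by have := d1E F [::]; rewrite !big_nil. Qed.

Lemma d1N u : d1 (- u) = - d1 u.
Proof.
by apply/eqP; rewrite -addr_eq0 -d1D addNr d10.
Qed.

Lemma d1_d a : d1 (d a) = 0.
Proof.
by rewrite -[d a]scale1r d1_gen fodc_d1 wedge0l.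
Qed.

Lemma forms1_ind (P : forms1 F -> Prop) :
  P 0 -> (forall u v, P u -> P v -> P (u + v)) -> (forall a b, P (a *: d b)) ->
  forall u, P u.
Proof. by move=> P0 PD Pd u; have [s ->] := fodc_span u; apply: big_ind. Qed.

(** Both forms of the graded Leibniz rule reduce to a one-form [b *: d c], on
    which [d1] is given by [d1_gen]. *)
Lemma d1_scale a u : d1 (a *: u) = wedge (d a) u + a *: d1 u.
Proof.
elim/forms1_ind: u => [|u v IHu IHv|b c].
- by rewrite !scaler0 d10 wedge0r scaler0 addr0.
- by rewrite scalerDr !d1D IHu IHv wedgeDr scalerDr addrACA.
- by rewrite scalerA !d1_gen fodc_leibniz wedgeDl wedgeA wedgeZl.
Qed.

Lemma d1_ract u a : d1 (u <* a) = d1 u <* a - wedge u (d a).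
Proof.
elim/forms1_ind: u => [|u v IHu IHv|b c].
- by rewrite !ract0l d10 ract0l wedge0l subr0.
- by rewrite ractDl !d1D IHu IHv wedgeDl ractDl opprD addrACA.
- have e : d c <* a = d (c * a) - c *: d a by rewrite fodc_leibniz addrK.
  rewrite ractZ e scalerBr d1D d1N scalerA !d1_gen !fodc_leibniz.
  rewrite wedgeDr wedgeDl wedgeR wedgeA wedgeZl opprD addrA.
  by rewrite addrK.
Qed.
End GradedLeibniz.

Section DiscTypeCalculus.
Variables (C : fieldType) (A : algType C) (F : fodc A).
Local Notation d := (fodc_d F).
Hypothesis forms1_ract_alg : forall (c : C) (u : forms1 F), u <* c%:A = cscale c u.

Hypothesis d_alg : forall c : C, d c%:A = 0.

Lemma fodc_dZ c a : d (c *: a) = cscale c (d a).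
Proof. by rewrite -mulr_algl fodc_leibniz d_alg ract0l add0r. Qed.

Lemma tensor_ract_alg c (y : tensor (forms1 F) (forms1 F)) :
  y <* c%:A = cscale c y.
Proof.
elim/tens_ind: y => [|u w|s r IHs IHr].
- by rewrite ract0l cscale0.
- rewrite [LHS]tens_ractE /cscale [RHS]tens_scaleE.
  by rewrite forms1_ract_alg -tensA forms1_ract_alg.
- by rewrite ractBl cscaleBr IHs IHr.
Qed.

Lemma forms2_ract_alg c (w : forms2 F) : w <* c%:A = cscale c w.
Proof.
elim/bimod_ind: w => y.
by rewrite -bimod_piR tensor_ract_alg /cscale bimod_piZ.
Qed.

Lemma wedge_cscale c (u w : forms1 F) :
  wedge (cscale c u) w = cscale c (wedge u w).
Proof. exact: wedgeZl. Qed.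

Variables (t : C) (z zs : A) (om oms : forms1 F).
Hypotheses (t0 : t != 0) (t1 : 1 - t != 0) (t2 : 1 + t ^+ 2 != 0).
Hypothesis t3 : 1 - t ^+ 3 != 0.
Hypothesis zszE : zs * z = t *: (z * zs) + (1 - t)%:A.

(** The commutation [u <* a = sigma a *: u] on the generators. *)
Definition frame (u : forms1 F) : Prop :=
  u <* z = (t *: z) *: u /\ u <* zs = (t^-1 *: zs) *: u.

Hypotheses (omR : frame om) (omsR : frame oms).
Hypotheses (dz : d z = zs *: om) (dzs : d zs = (t *: z) *: oms).

Lemma wedge_frame u w : frame u ->
  wedge u (z *: w) = cscale t (z *: wedge u w) /\
  wedge u (zs *: w) = cscale t^-1 (zs *: wedge u w).
Proof. by case=> uz uzs; rewrite -!wedgeA uz uzs !wedgeZl !scale_cscale. Qed.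

Lemma wedge_twisted u w : frame u -> frame w -> twisted t z zs (wedge u w).
Proof.
move=> uR [wz wzs]; have [h hs] := wedge_frame w uR.
have scal c (a : A) : wedge u (cscale c (a *: w)) = cscale c (wedge u (a *: w)).
  by rewrite /cscale -wedgeA forms1_ract_alg wedge_cscale.
split; rewrite -wedgeR.
  by rewrite wz scale_cscale scal h cscaleA.
by rewrite wzs scale_cscale scal hs cscaleA -expr2 exprVn.
Qed.

(** The differential of the commutation relations of [u]. *)
Lemma d1_frame u : frame u ->
  d1 u <* z = cscale t (wedge (d z) u + z *: d1 u) + wedge u (d z) /\
  d1 u <* zs = cscale t^-1 (wedge (d zs) u + zs *: d1 u) + wedge u (d zs).
Proof.
have e c a (w : forms1 F) : d1 ((c *: a) *: w) = cscale c (wedge (d a) w + a *: d1 w).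
  by rewrite d1_scale fodc_dZ wedge_cscale scale_cscale cscaleDr.
by case=> uz uzs; rewrite -!e -uz -uzs !d1_ract !subrK.
Qed.

Lemma fodc_two_form_relations : let Q := wedge om oms in
  [/\ wedge oms om = cscale (- t ^+ 3) Q, (1 - z * zs) *: Q = 0,
      d1 om = cscale (t ^+ 4) (z ^+ 2 *: Q) /\
        d1 oms = cscale (-1) (zs ^+ 2 *: Q),
      wedge om om = cscale (t ^+ 6 * ((t - 1) / (t ^+ 2 + 1))) (z ^+ 4 *: Q) &
      wedge oms oms = cscale (t ^- 2 * ((t - 1) / (t ^+ 2 + 1))) (zs ^+ 4 *: Q)].
Proof.
move=> Q.
have scal u (w : forms1 F) c : wedge u (cscale c w) = cscale c (wedge u w).
  by rewrite /cscale -wedgeA forms1_ract_alg wedge_cscale.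
have zsD : zs *: d1 om = cscale (- t) (z *: wedge oms om).
  have /eqP := d1_d F z; rewrite dz d1_scale dzs wedgeZl scale_cscale addrC.
  by rewrite addr_eq0 => /eqP ->; rewrite cscaleNl.
have zD' : z *: d1 oms = - (zs *: Q).
  have := d1_d F zs; rewrite dzs d1_scale fodc_dZ dz wedge_cscale wedgeZl.
  rewrite scale_cscale -cscaleDr => /(cscale_eq0 t0)/eqP.
  by rewrite addrC addr_eq0 => /eqP.
have [Dz Dzs] := d1_frame omR; have [D'z D'zs] := d1_frame omsR.
move: Dz Dzs D'z D'zs; rewrite dz dzs !wedgeZl !scale_cscale !scal.
rewrite !(proj1 (wedge_frame _ omR)) !(proj2 (wedge_frame _ omR)).
rewrite !(proj1 (wedge_frame _ omsR)) !(proj2 (wedge_frame _ omsR)).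
rewrite zsD zD' addrN cscale0 add0r => Dz Dzs D'z D'zs.
apply: (two_form_relations forms2_ract_alg t0 t1 t2 t3 zszE) zsD _ _ zD' _ _;
  try exact: wedge_twisted.
- by rewrite Dz cscaleDr cscaleDl [RHS]addrCA addrA.
- by rewrite Dzs cscaleNl addrN cscale0 add0r cscaleA.
- by rewrite D'zs cscaleDr !cscaleA mulVf // cscaleDl [RHS]addrCA addrA.
- exact: D'z.
Qed.
End DiscTypeCalculus.

(** * Constructing maps out of the two-forms *)

Section TwoFormLift.
Variables (A : pzRingType) (F : fodc A) (R : comNzRingType).
Local Notation d := (fodc_d F).
Variables (p p2 : {rmorphism A -> R}) (h : forms1 F -> forms1 F -> R).
Hypothesis h_balanced : balanced h.
Hypothesis hZ : forall a u w, h (a *: u) w = p a * h u w.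
Hypothesis hR : forall a u w, h u (w <* a) = h u w * p2 a.
(** [D] is the candidate for the composite of [d1] with the map to be built. *)
Variable D : forms1 F -> R.
Hypothesis D_add : {morph D : u w / u + w}.
Hypothesis D_scale : forall a u, D (a *: u) = h (d a) u + p a * D u.

Let hDl u u' w : h (u + u') w = h u w + h u' w.
Proof. by case: h_balanced. Qed.
Let hDr u w w' : h u (w + w') = h u w + h u w'.
Proof. by case: h_balanced. Qed.
Let hA u a w : h (u <* a) w = h u (a *: w).
Proof. by case: h_balanced. Qed.

(** The graded Leibniz rule of [D] for a product with [a] on the right, and the
    vanishing of [D] on [d a]: two properties that pass to products. *)
Definition d1_compatible (a : A) : Prop :=
  D (d a) = 0 /\ forall u, D (u <* a) = D u * p2 a - h u (d a).

Let D0 : D 0 = 0.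
Proof. by apply: (addrI (D 0)); rewrite -D_add !addr0. Qed.
Let h0r u : h u 0 = 0.
Proof. by apply: (addrI (h u 0)); rewrite -hDr !addr0. Qed.

Lemma d1_compatible1 : d1_compatible 1.
Proof.
by split=> [|u]; rewrite fodc_d1 ?D0 // ract1 rmorph1 mulr1 h0r subr0.
Qed.

Lemma d1_compatible0 : d1_compatible 0.
Proof.
split=> [|u]; rewrite (raddf0 d) ?D0 // rmorph0 mulr0 h0r subr0.
suff -> : u <* 0 = 0 by rewrite D0.
by apply: (addrI (u <* 0)); rewrite -ractDr !addr0.
Qed.

Lemma d1_compatibleD a b :
  d1_compatible a -> d1_compatible b -> d1_compatible (a + b).
Proof.
move=> [Da aR] [Db bR]; split=> [|u]; rewrite (raddfD d).
  by rewrite D_add Da Db addr0.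
by rewrite ractDr D_add aR bR rmorphD mulrDr hDr opprD addrACA.
Qed.

Lemma d1_compatibleM a b :
  d1_compatible a -> d1_compatible b -> d1_compatible (a * b).
Proof.
move=> [Da aR] [Db bR]; split=> [|u]; rewrite fodc_leibniz.
  by rewrite D_add bR Da mul0r sub0r D_scale Db mulr0 addr0 addNr.
rewrite ractA bR aR mulrBl rmorphM mulrA hDr hR opprD addrA; congr (_ - _).
exact: hA.
Qed.

Hypothesis D_d : forall a, D (d a) = 0.

Let H : tensor (forms1 F) (forms1 F) -> R := tens_lift h.

Let HB : zmod_morphism H. Proof. exact: tens_lift_additive. Qed.

Let HE u w : H (tens u w) = h u w. Proof. exact: tens_liftE. Qed.

Let H_scale a y : H (a *: y) = p a * H y.
Proof.
apply: (@tens_ext _ _ _ _ (fun y => H (a *: y)) (fun y => p a * H y)) y => [s r|s r|u w].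
- by rewrite scalerBr HB.
- by rewrite HB mulrBr.
- by rewrite [a *: _]tens_scaleE !HE hZ.
Qed.

Let H_ract a y : H (y <* a) = H y * p2 a.
Proof.
apply: (@tens_ext _ _ _ _ (fun y => H (y <* a)) (fun y => H y * p2 a)) y => [s r|s r|u w].
- by rewrite ractBl HB.
- by rewrite HB mulrBl.
- by rewrite [_ <* a]tens_ractE !HE hR.
Qed.

(* [D_scale] and [D_d] give [h (d a) (d b) = D (a *: d b)]. *)
Let H_rel y : forms2_rel y -> H y = 0.
Proof.
case=> s [s0 ->].
have HD := zmod_morphismD HB.
have H0 : H 0 = 0 by rewrite -(subrr 0) HB subrr.
rewrite (big_morph H HD H0) -[RHS]D0 -s0 (big_morph D D_add D0).
by apply: eq_bigr => ab _; rewrite HE D_scale D_d mulr0 addr0.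
Qed.

Let H_gen y : submod_gen (@forms2_rel A F) y -> H y = 0.
Proof.
elim=> [|y1 y2 _ IH1 _ IH2|a s b /H_rel Hs].
- by rewrite -(subrr 0) HB subrr.
- by rewrite (zmod_morphismD HB) IH1 IH2 addr0.
- by rewrite H_ract H_scale Hs mulr0 mul0r.
Qed.

(** The universal property of the two-forms, for targets on which the algebra
    acts through two morphisms to a commutative ring. *)
Lemma forms2_lift : exists Phi : {additive forms2 F -> R},
  [/\ forall u w, Phi (wedge u w) = h u w,
      forall a w, Phi (a *: w) = p a * Phi w &
      forall w a, Phi (w <* a) = Phi w * p2 a].
Proof.
pose HaM := GRing.isZmodMorphism.Build _ _ H HB.
pose Ha : {additive tensor (forms1 F) (forms1 F) -> R} := HB.pack H HaM.
pose f : forms2 F -> R := qlift Ha.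
have fE y : f (bimod_pi _ y) = H y.
  exact: (@qliftE _ (submod_subgroup (@forms2_rel A F)) _ Ha H_gen y).
have fB : zmod_morphism f.
  exact: (@qlift_additive _ (submod_subgroup (@forms2_rel A F)) _ Ha H_gen).
pose faM := GRing.isZmodMorphism.Build _ _ f fB.
pose fa : {additive forms2 F -> R} := HB.pack f faM.
exists fa; split=> [u w|a w|w a] /=.
- by rewrite /wedge fE HE.
- by elim/bimod_ind: w => y; rewrite -bimod_piZ !fE H_scale.
- by elim/bimod_ind: w => y; rewrite -bimod_piR !fE H_ract.
Qed.
End TwoFormLift.

Section FrameDerivation.
Variables (A : pzRingType) (F : fodc A) (R : comNzRingType).
Local Notation d := (fodc_d F).
Variables (p : {rmorphism A -> R}) (h : forms1 F -> forms1 F -> R).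
Hypothesis h_balanced : balanced h.
Hypothesis hZ : forall a u w, h (a *: u) w = p a * h u w.
Variables (k1 k2 : forms1 F -> A) (om oms : forms1 F) (e1 e2 : R).
Hypotheses (k1D : {morph k1 : u w / u + w}) (k2D : {morph k2 : u w / u + w}).
Hypothesis k1Z : forall a u, k1 (a *: u) = a * k1 u.
Hypothesis k2Z : forall a u, k2 (a *: u) = a * k2 u.
Hypothesis kE : forall u, u = k1 u *: om + k2 u *: oms.

(** The graded derivation along [d], for the product [h], with prescribed values
    [e1] and [e2] on the basis [om], [oms] of the one-forms. *)
Definition frame_d1 (u : forms1 F) : R :=
  (h (d (k1 u)) om + p (k1 u) * e1) + (h (d (k2 u)) oms + p (k2 u) * e2).

Lemma frame_d1D : {morph frame_d1 : u w / u + w}.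
Proof.
have [hDl _ _] := h_balanced.
move=> u w; rewrite /frame_d1 k1D k2D !(raddfD d) !(rmorphD p) !hDl; ring.
Qed.

Lemma frame_d1_scale a u : frame_d1 (a *: u) = h (d a) u + p a * frame_d1 u.
Proof.
have [hDl hDr hA] := h_balanced.
rewrite [in h _ u](kE u) /frame_d1 k1Z k2Z !fodc_leibniz !hDl !hDr !hA !hZ.
by rewrite !rmorphM; ring.
Qed.
End FrameDerivation.

(** * The pairing of one-forms with values in the circle *)

Section CircleModel.
Variables (C : fieldType) (A : algType C) (F : fodc A) (R : comNzRingType).
Local Notation d := (fodc_d F).
Variables (iota : {rmorphism C -> R}) (p p2 : {rmorphism A -> R}).
Variable h : forms1 F -> forms1 F -> R.
Hypothesis h_balanced : balanced h.
Hypothesis hZ : forall a u w, h (a *: u) w = p a * h u w.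
Hypothesis hR : forall a u w, h u (w <* a) = h u w * p2 a.
Hypothesis forms1_ract_alg : forall (c : C) (u : forms1 F), u <* c%:A = cscale c u.
Hypothesis d_alg : forall c : C, d c%:A = 0.
Hypothesis p_alg : forall c : C, p c%:A = iota c.
Hypothesis p2_alg : forall c : C, p2 c%:A = iota c.

Variables (D : forms1 F -> R).
Hypothesis D_add : {morph D : u w / u + w}.
Hypothesis D_scale : forall a u, D (a *: u) = h (d a) u + p a * D u.

Lemma d1_compatible_alg c a :
  d1_compatible p2 h D a -> d1_compatible p2 h D (c *: a).
Proof.
rewrite -mulr_algl; apply: d1_compatibleM => //; split=> [|u].
  by rewrite d_alg; apply: (addrI (D 0)); rewrite -D_add !addr0.
have [_ hDr _] := h_balanced.
have h0 : h u 0 = 0 by apply: (addrI (h u 0)); rewrite -hDr !addr0.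
have [hDl _ _] := h_balanced.
have h0l : h 0 u = 0 by apply: (addrI (h 0 u)); rewrite -hDl !addr0.
by rewrite forms1_ract_alg /cscale D_scale d_alg h0 h0l subr0 add0r p_alg p2_alg mulrC.
Qed.

Variables (t : C) (z zs : A) (om oms : forms1 F).
Hypotheses (t0 : t != 0) (t2 : t ^+ 2 + 1 != 0).
Hypotheses (omR : frame t z zs om) (omsR : frame t z zs oms).
Hypothesis om_span : forall u, exists a b, u = a *: om + b *: oms.
Hypotheses (dz : d z = zs *: om) (dzs : d zs = (t *: z) *: oms).
Local Notation U := (p z).
Local Notation V := (p zs).
Hypothesis UV : U * V = 1.
Hypotheses (p2z : p2 z = iota t ^+ 2 * U) (p2zs : p2 zs = iota t^-1 ^+ 2 * V).
Let g := iota ((t - 1) / (t ^+ 2 + 1)).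
Hypotheses (h11 : h om om = iota t ^+ 6 * g * U ^+ 4) (h12 : h om oms = 1).
Hypotheses (h21 : h oms om = - iota t ^+ 3).
Hypothesis h22 : h oms oms = iota t^-1 ^+ 2 * g * V ^+ 4.
Hypotheses (D1 : D om = iota t ^+ 4 * U ^+ 2) (D2 : D oms = - V ^+ 2).

Let pZ c a : p (c *: a) = iota c * p a.
Proof. by rewrite -mulr_algl rmorphM p_alg. Qed.

Let hz u w : frame t z zs u -> h u (z *: w) = iota t * U * h u w.
Proof. by have [_ _ hA] := h_balanced; case=> uz _; rewrite -hA uz hZ pZ. Qed.
Let hzs u w : frame t z zs u -> h u (zs *: w) = iota t^-1 * V * h u w.
Proof. by have [_ _ hA] := h_balanced; case=> _ uz; rewrite -hA uz hZ pZ. Qed.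
Let hc u w c a : h u ((c *: a) *: w) = iota c * h u (a *: w).
Proof.
have [_ _ hA] := h_balanced.
by rewrite scale_cscale /cscale -hA forms1_ract_alg hZ p_alg.
Qed.

Let Dc c a u : D ((c *: a) *: u) = iota c * D (a *: u).
Proof.
rewrite !D_scale (fodc_dZ d_alg) pZ /cscale hZ p_alg; ring.
Qed.

(* The Leibniz rule in [a] need only be checked on the two basis forms. *)
Let compatible_frame a :
  D (om <* a) = D om * p2 a - h om (d a) ->
  D (oms <* a) = D oms * p2 a - h oms (d a) ->
  forall u, D (u <* a) = D u * p2 a - h u (d a).
Proof.
have [hDl _ _] := h_balanced.
move=> h1 h2 u; have [b [c ->]] := om_span u.
rewrite ractDl !ractZ !D_add !D_scale h1 h2 !hDl !hZ !hR; ring.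
Qed.

Let kk : iota t * iota t^-1 = 1.
Proof. by rewrite -rmorphM mulfV // rmorph1. Qed.
Let gk : g * iota t ^+ 2 = iota t - 1 - g.
Proof.
apply/eqP; rewrite -subr_eq0 opprB addrC; apply/eqP.
rewrite -rmorphXn -(rmorph1 iota) -!rmorphB -rmorphM -rmorphD.
suff -> : (t - 1) / (t ^+ 2 + 1) - (t - 1) + (t - 1) / (t ^+ 2 + 1) * t ^+ 2 = 0.
  exact: rmorph0.
by field.
Qed.

Let gk' : g * iota t^-1 ^+ 2 = iota t^-1 - iota t^-1 ^+ 2 - g.
Proof.
have : (g * iota t ^+ 2) * iota t^-1 ^+ 2 = g by ring: kk.
rewrite gk => e; rewrite -[g in RHS]e; ring: kk.
Qed.

(** With the prescribed values, the conditions become identities between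
    monomials; the relation [gk] fixes the value of [g]. *)
Lemma d1_compatible_z : d1_compatible p2 h D z.
Proof.
have [omz omzs] := omR; have [omsz omszs] := omsR.
split.
  rewrite dz D_scale dzs hZ pZ h21 D1; ring: UV.
apply: compatible_frame.
  rewrite omz Dc D_scale dz hZ h11 D1 p2z hzs // h11.
  transitivity (iota t ^+ 5 * (g * iota t ^+ 2 + 1) * U ^+ 3); first by ring: UV.
  by rewrite gk; ring: kk UV.
rewrite omsz Dc D_scale dz hZ h12 D2 p2z hzs // h21; ring: kk UV.
Qed.

Lemma d1_compatible_zs : d1_compatible p2 h D zs.
Proof.
have [omz omzs] := omR; have [omsz omszs] := omsR.
split.
  rewrite dzs Dc D_scale dz hZ h12 D2; ring: UV.
apply: compatible_frame.
  rewrite omzs Dc D_scale dzs hZ pZ h21 D1 p2zs hc hz // h12; ring: kk UV.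
rewrite omszs Dc D_scale dzs hZ pZ h22 D2 p2zs hc hz // h22.
transitivity ((g * iota t^-1 ^+ 2 - iota t^-1) * V ^+ 3); first by ring: kk UV.
by rewrite gk'; ring: kk UV.
Qed.
End CircleModel.

Section BilinearForm.
Variables (R : comNzRingType) (c : bool -> bool -> R).

(** [c i j] is the value on the basis vectors [i] and [j], where [false] stands
    for the first one and [true] for the second. *)
Definition bil (u1 u2 w1 w2 : R) : R :=
  u1 * (c false false * w1 + c false true * w2) +
  u2 * (c true false * w1 + c true true * w2).

Lemma bilDl u1 u2 u1' u2' w1 w2 :
  bil (u1 + u1') (u2 + u2') w1 w2 = bil u1 u2 w1 w2 + bil u1' u2' w1 w2.
Proof. by rewrite /bil; ring. Qed.
Lemma bilDr u1 u2 w1 w2 w1' w2' :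
  bil u1 u2 (w1 + w1') (w2 + w2') = bil u1 u2 w1 w2 + bil u1 u2 w1' w2'.
Proof. by rewrite /bil; ring. Qed.
Lemma bilZ s u1 u2 w1 w2 : bil (s * u1) (s * u2) w1 w2 = s * bil u1 u2 w1 w2.
Proof. by rewrite /bil; ring. Qed.
Lemma bilA s u1 u2 w1 w2 : bil (u1 * s) (u2 * s) w1 w2 = bil u1 u2 (s * w1) (s * w2).
Proof. by rewrite /bil; ring. Qed.
Lemma bilR s u1 u2 w1 w2 : bil u1 u2 (w1 * s) (w2 * s) = bil u1 u2 w1 w2 * s.
Proof. by rewrite /bil; ring. Qed.
End BilinearForm.

Section FrameModel.
Variables (C : fieldType) (A : algType C) (F : fodc A) (R : comNzRingType).
Local Notation d := (fodc_d F).
Variables (iota : {rmorphism C -> R}) (sig : {rmorphism A -> A}) (p : {rmorphism A -> R}).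
Hypothesis forms1_ract_alg : forall (c : C) (u : forms1 F), u <* c%:A = cscale c u.
Hypothesis d_alg : forall c : C, d c%:A = 0.
Hypotheses (p_alg : forall c : C, p c%:A = iota c).
Hypotheses (sig_alg : forall c : C, sig c%:A = c%:A).
Variables (t : C) (z zs : A) (om oms : forms1 F).
Hypothesis A_ind : forall P : A -> Prop,
  P 0 -> (forall a b, P a -> P b -> P (a + b)) ->
  (forall c a, P a -> P (c *: a)) -> P 1 ->
  (forall a, P a -> P (z * a)) -> (forall a, P a -> P (zs * a)) ->
  forall a, P a.
Hypotheses (t0 : t != 0) (t2 : t ^+ 2 + 1 != 0).
Hypotheses (sz : sig z = t *: z) (szs : sig zs = t^-1 *: zs).
Hypotheses (dz : d z = zs *: om) (dzs : d zs = (t *: z) *: oms).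
Hypothesis UV : p z * p zs = 1.
Variables (k1 k2 : forms1 F -> A).
Hypotheses (k1D : {morph k1 : u w / u + w}) (k2D : {morph k2 : u w / u + w}).
Hypothesis k1Z : forall a u, k1 (a *: u) = a * k1 u.
Hypothesis k2Z : forall a u, k2 (a *: u) = a * k2 u.
Hypothesis k1R : forall a u, k1 (u <* a) = k1 u * sig a.
Hypothesis k2R : forall a u, k2 (u <* a) = k2 u * sig a.
Hypothesis kE : forall u, u = k1 u *: om + k2 u *: oms.
Hypotheses (k1om : k1 om = 1) (k2om : k2 om = 0).
Hypotheses (k1oms : k1 oms = 0) (k2oms : k2 oms = 1).

(** The products and differentials of the basis one-forms are given the values
    dictated by [fodc_two_form_relations], the product of [om] and [oms] being
    sent to [1]. *)
Lemma frame_forms2_lift : exists Phi : {additive forms2 F -> R},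
  [/\ Phi (wedge om oms) = 1,
      forall a w, Phi (a *: w) = p a * Phi w &
      forall w a, Phi (w <* a) = Phi w * p (sig (sig a))].
Proof.
pose p1 : {rmorphism A -> R} := p \o sig.
pose p2 : {rmorphism A -> R} := p1 \o sig.
pose g := iota ((t - 1) / (t ^+ 2 + 1)).
pose U := p z; pose V := p zs.
pose c (i j : bool) := match i, j with
  | false, false => iota t ^+ 6 * g * U ^+ 4
  | false, true => 1
  | true, false => - iota t ^+ 3
  | true, true => iota t^-1 ^+ 2 * g * V ^+ 4
  end.
pose h u w : R := bil c (p (k1 u)) (p (k2 u)) (p1 (k1 w)) (p1 (k2 w)).
have h_balanced : balanced h.
  split=> [u u' w|u w w'|u a w]; rewrite /h.
  - by rewrite k1D k2D !rmorphD bilDl.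
  - by rewrite k1D k2D !rmorphD bilDr.
  - by rewrite k1R k2R k1Z k2Z !rmorphM bilA.
have hZ a u w : h (a *: u) w = p a * h u w by rewrite /h k1Z k2Z !rmorphM bilZ.
have hR a u w : h u (w <* a) = h u w * p2 a by rewrite /h k1R k2R !rmorphM bilR.
have hom : [/\ h om om = c false false, h om oms = c false true,
    h oms om = c true false & h oms oms = c true true].
  rewrite /h /bil k1om k2om k1oms k2oms !rmorph1 !rmorph0.
  by split; rewrite ?mul1r ?mul0r ?mulr1 ?mulr0 ?addr0 ?add0r.
have [h11 h12 h21 h22] := hom.
pose e1 := iota t ^+ 4 * U ^+ 2; pose e2 := - V ^+ 2.
pose D := frame_d1 p h k1 k2 om oms e1 e2.
have D_add : {morph D : u w / u + w} := frame_d1D p h_balanced om oms e1 e2 k1D k2D.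
have D_scale : forall a u, D (a *: u) = h (d a) u + p a * D u.
  exact: (frame_d1_scale h_balanced hZ e1 e2 k1Z k2Z kE).
have h0 u : h 0 u = 0 by rewrite -(scale0r (0 : forms1 F)) hZ rmorph0 mul0r.
have D1 : D om = e1.
  rewrite /D /frame_d1 k1om k2om fodc_d1 raddf0 !h0 rmorph1 rmorph0.
  by rewrite mul1r mul0r !addr0 add0r.
have D2 : D oms = e2.
  rewrite /D /frame_d1 k1oms k2oms fodc_d1 raddf0 !h0 rmorph1 rmorph0.
  by rewrite mul1r mul0r !add0r.
have omR : frame t z zs om.
  by split; rewrite [LHS]kE k1R k2R k1om k2om mul1r mul0r scale0r addr0 ?sz ?szs.
have omsR : frame t z zs oms.
  by split; rewrite [LHS]kE k1R k2R k1oms k2oms mul1r mul0r scale0r add0r ?sz ?szs.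
have sigZ (b : C) a : sig (b *: a) = b *: sig a.
  by rewrite -[b *: a]mulr_algl rmorphM sig_alg mulr_algl.
have pZ (b : C) a : p (b *: a) = iota b * p a.
  by rewrite -[b *: a]mulr_algl rmorphM p_alg.
have p2z : p2 z = iota t ^+ 2 * U.
  by rewrite /= sz sigZ sz !pZ mulrA.
have p2zs : p2 zs = iota t^-1 ^+ 2 * V.
  by rewrite /= szs sigZ szs !pZ mulrA.
have p2_alg (c' : C) : p2 c'%:A = iota c' by rewrite /= !sig_alg p_alg.
have om_span u : exists a b, u = a *: om + b *: oms.
  by exists (k1 u), (k2 u).
have zC := d1_compatible_z h_balanced hZ hR d_alg p_alg D_add D_scale
  t0 t2 omR omsR om_span dz dzs UV p2z h11 h12 h21 D1 D2.
have zsC := d1_compatible_zs h_balanced hZ hR forms1_ract_alg d_alg p_alg D_add D_scale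
  t0 t2 omR omsR om_span dz dzs UV p2zs h12 h21 h22 D1 D2.
have compat : forall a, d1_compatible p2 h D a.
  apply: A_ind => [|a b|c' a||a|a].
  - exact: (d1_compatible0 p2 h_balanced D_add).
  - exact: (d1_compatibleD h_balanced D_add).
  - exact: (d1_compatible_alg h_balanced hR forms1_ract_alg d_alg p_alg p2_alg
      D_add D_scale).
  - exact: (d1_compatible1 p2 h_balanced D_add).
  - exact: (d1_compatibleM h_balanced hR D_add D_scale) zC.
  - exact: (d1_compatibleM h_balanced hR D_add D_scale) zsC.
have [Phi [PhiE PhiZ PhiR]] := forms2_lift h_balanced hZ hR D_add D_scale
  (fun a => proj1 (compat a)).
by exists Phi; split=> //; rewrite PhiE h12.
Qed.
End FrameModel.

(** * Cyclic modules over a quotient ring *)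

Section Descent.
Variables (B L : pzRingType) (p : {rmorphism B -> L}) (N : lmodType B).
Hypothesis p_surj : forall c, exists b, p b = c.
Hypothesis p_ann : forall b (n : N), p b = 0 -> b *: n = 0.

(** [N] as a module over [L], a scalar of [L] acting through any preimage. *)
Definition descended (_ : forall c, exists b, p b = c)
  (_ : forall b (n : N), p b = 0 -> b *: n = 0) : Type := N.
Local Notation M := (descended p_surj p_ann).
HB.instance Definition _ := GRing.Zmodule.on M.

Let lift (c : L) : B := projT1 (cid (p_surj c)).
Definition descended_scale (c : L) (n : M) : M := lift c *: (n : N).

Lemma descended_scaleE b n : descended_scale (p b) n = b *: (n : N).
Proof.
apply/eqP; rewrite -subr_eq0 -scalerBl; apply/eqP/p_ann.
by rewrite rmorphB /lift; case: cid => b' /= ->; rewrite subrr.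
Qed.

Fact descended_scaleA c e n :
  descended_scale c (descended_scale e n) = descended_scale (c * e) n.
Proof.
have [b <-] := p_surj c; have [b' <-] := p_surj e.
by rewrite -rmorphM !descended_scaleE scalerA.
Qed.
Fact descended_scale1 : left_id 1 descended_scale.
Proof. by move=> n; rewrite -(rmorph1 p) descended_scaleE scale1r. Qed.
Fact descended_scaleDr : right_distributive descended_scale +%R.
Proof. by move=> c n n'; rewrite /descended_scale scalerDr. Qed.
Fact descended_scaleDl n : {morph descended_scale^~ n : c e / c + e}.
Proof.
move=> c e; have [b <-] := p_surj c; have [b' <-] := p_surj e.
by rewrite -rmorphD !descended_scaleE scalerDl.
Qed.
HB.instance Definition _ := GRing.Zmodule_isLmodule.Build L M
  descended_scaleA descended_scale1 descended_scaleDr descended_scaleDl.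

(** A cyclic module over a ring is free of rank one over the quotient by the
    annihilator of its generator. *)
Lemma cyclic_free_quotient (v : N) :
  (forall n, exists b, n = b *: v) -> (forall b, b *: v = 0 -> p b = 0) ->
  exists (M : lmodType L) (j : {additive N -> M}),
    [/\ bijective j, forall b n, j (b *: n) = p b *: j n & free_on (j v)].
Proof.
move=> v_gen v_ann.
have jB : zmod_morphism (id : N -> M) by [].
pose jM := GRing.isZmodMorphism.Build N M (id : N -> M) jB.
pose j : {additive N -> M} := HB.pack (id : N -> M) jM.
exists M, j; split; first by exists id.
  by move=> b n; rewrite /= [RHS]descended_scaleE.
pose g (n : N) : L := p (projT1 (cid (v_gen n))).
exists g => [c|n]; rewrite /g; case: cid => b /=.
  have [b' <-] := p_surj c.
  rewrite [p b' *: _]descended_scaleE => /eqP.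
  rewrite -subr_eq0 -scalerBl => /eqP/v_ann/eqP.
  by rewrite rmorphB subr_eq0 => /eqP.
by move=> ->; rewrite [LHS]descended_scaleE.
Qed.
End Descent.

Section TorsionModules.
Variables (B : nzRingType) (N : lmodType B) (b : B).
Hypothesis b_ann : forall n : N, b *: n = 0.

Lemma torsion_ann : b != 0 -> torsion N.
Proof. by move=> b0 n; exists b. Qed.

Hypothesis b_reg : forall a, b * a = 0 -> a = 0.

(** [b] kills the image of every map to the regular module, where it is
    regular. *)
Lemma dual_is_zero_ann : dual_is_zero N.
Proof.
move=> f n; apply: b_reg.
by rewrite -[_ * _]/(b *: (f n : B^o)) -linearZ b_ann linear0.
Qed.

(** The surjection from the regular module onto a cyclic module cannot be split
    when there are no nonzero maps in the other direction. *)
Lemma dual_zero_not_projective (v : N) :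
  (forall n, exists a, n = a *: v) -> v != 0 -> ~ projective N.
Proof.
move=> v_gen v0 N_proj.
have gl : linear (fun a : B^o => a *: v).
  by move=> c a a'; rewrite scalerDl scalerA.
pose gM := GRing.isLinear.Build B B^o N _ _ gl.
pose g : {linear B^o -> N} := HB.pack (fun a : B^o => a *: v) gM.
have g_surj n : exists a, g a = n by have [a ->] := v_gen n; exists a.
have [s sE] := N_proj B^o N g (idfun : {linear N -> N}) g_surj.
have /= := sE v; rewrite dual_is_zero_ann scale0r => /esym/eqP.
exact/negP.
Qed.
End TorsionModules.

(** * Modules on which a map to the Laurent polynomials is defined *)

(** Here [p] is the restriction to the circle, with kernel generated by [x], and
    [Phi] is a coordinate with respect to the generator [v]. *)
Section CircleModule.
Variables (C : fieldType) (A : algType C) (M : bimodType A) (v : M) (x : A).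
Local Notation L := (laurent C).
Variables (sig : {rmorphism A -> A}) (p : {rmorphism A -> L}) (Phi : {additive M -> L}).
Hypothesis v_gen : forall w, exists a, w = a *: v.
Hypothesis v_ract : forall a, v <* a = sig (sig a) *: v.
Hypothesis sig_surj : forall a, exists b, sig b = a.
Hypothesis p_sig : forall a, p (sig a) = 0 -> p a = 0.
Hypothesis p_ker : forall a, p a = 0 <-> exists b, a = x * b.
Hypothesis x_comm : forall a, x * a = sig a * x.
Hypothesis sig_x : sig x = x.
Hypothesis xv : x *: v = 0.
Hypothesis x_lreg : forall a, x * a = 0 -> a = 0.
Hypothesis x_rreg : forall a, a * x = 0 -> a = 0.
Hypothesis p_surj : forall f, exists a, p a = f.
Hypotheses (Phi_v : Phi v = 1) (PhiZ : forall a w, Phi (a *: w) = p a * Phi w).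
Hypothesis PhiR : forall w a, Phi (w <* a) = Phi w * p (sig (sig a)).

Lemma sig_p a : p a = 0 -> p (sig a) = 0.
Proof. by move/p_ker=> [b ->]; apply/p_ker; exists (sig b); rewrite rmorphM sig_x. Qed.

Lemma Phi_eq0 w : Phi w = 0 -> w = 0.
Proof.
have [a ->] := v_gen w; rewrite PhiZ Phi_v mulr1 => /p_ker[b ->].
by rewrite x_comm -scalerA xv scaler0.
Qed.

Lemma Phi_inj : injective Phi.
Proof.
move=> w w' /eqP; rewrite -subr_eq0 -raddfB => /eqP/Phi_eq0/eqP.
by rewrite subr_eq0 => /eqP.
Qed.

Lemma v_neq0 : v != 0.
Proof.
apply/eqP=> v0; move: Phi_v; rewrite v0 raddf0 => /esym/eqP.
by rewrite oner_eq0.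
Qed.

Lemma v_gen_right w : exists a, w = v <* a.
Proof.
have [a ->] := v_gen w; have [b <-] := sig_surj a; have [c <-] := sig_surj b.
by exists c; rewrite v_ract.
Qed.

Lemma ann_left a (w : M) : p a = 0 -> a *: w = 0.
Proof. by move=> a0; apply: Phi_eq0; rewrite PhiZ a0 mul0r. Qed.

Lemma ann_right a (w : M) : p a = 0 -> w <* a = 0.
Proof. by move=> a0; apply: Phi_eq0; rewrite PhiR !sig_p // mulr0. Qed.

Lemma ann_v (a : A) : a *: v = 0 -> p a = 0.
Proof. by move=> av; have := PhiZ a v; rewrite av raddf0 Phi_v mulr1. Qed.

Lemma ann_v_right (a : A) : v <* a = 0 -> p a = 0.
Proof. by rewrite v_ract => /ann_v/p_sig/p_sig. Qed.

Lemma px : p x = 0. Proof. by apply/p_ker; exists 1; rewrite mulr1. Qed.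

Lemma circle_free_left : exists (N : lmodType L) (j : {additive M -> N}),
  [/\ bijective j, forall a w, j (a *: w) = p a *: j w & free_on (j v)].
Proof. 
apply: (@cyclic_free_quotient A L p M p_surj) => //; last exact: ann_v.
by move=> a w; apply: ann_left.
Qed.

Lemma circle_free_right : exists (N : lmodType L) (j : {additive M -> N}),
  [/\ bijective j, forall w a, j (w <* a) = p a *: j w & free_on (j v)].
Proof.
have pcB : zmod_morphism (p : A^c -> L) by move=> a b; apply: (raddfB p).
have pcM : monoid_morphism (p : A^c -> L).
  split=> [|a b]; first exact: (rmorph1 p).
  by rewrite mulrC; apply: (rmorphM p).
pose pc1 := GRing.isZmodMorphism.Build A^c L (p : A^c -> L) pcB.
pose pc2 := GRing.isMonoidMorphism.Build A^c L (p : A^c -> L) pcM.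
pose pc : {rmorphism A^c -> L} := HB.pack (p : A^c -> L) pc1 pc2.
have [N [j [j_bij jE jv]]] := @cyclic_free_quotient A^c L pc (right_lmod M) p_surj
  (fun a w => @ann_right a w) v v_gen_right ann_v_right.
exists N, j; split=> [||] // w a; exact: jE.
Qed.

Lemma circle_torsion : torsion M /\ @torsion A^c (right_lmod M).
Proof.
have x0 : x != 0.
  apply/eqP => x0; have /x_lreg/eqP : x * 1 = 0 by rewrite x0 mul0r.
  by rewrite oner_eq0.
split; first by apply: (@torsion_ann _ M x) => // w; apply/ann_left/px.
by apply: (@torsion_ann A^c (right_lmod M) x) => // w; apply/ann_right/px.
Qed.

Lemma circle_dual : dual_is_zero M /\ @dual_is_zero A^c (right_lmod M).
Proof.
split; first by apply: (@dual_is_zero_ann _ M x) => // w; apply/ann_left/px.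
by apply: (@dual_is_zero_ann A^c (right_lmod M) x) => // w; apply/ann_right/px.
Qed.

Lemma circle_not_projective : ~ projective M /\ ~ @projective A^c (right_lmod M).
Proof.
split; [apply: (@dual_zero_not_projective _ M x _ _ v) => //|
  apply: (@dual_zero_not_projective A^c (right_lmod M) x _ _ v) => //];
  try exact: v_neq0.
- by move=> w; apply/ann_left/px.
- by move=> w; apply/ann_right/px.
- exact: v_gen_right.
Qed.

Lemma circle_basis (e : int -> M) (c : int -> C) :
  (forall i, c i != 0) -> (forall i, Phi (e i) = c i *: laurentX C i) ->
  (forall f, p f%:A = f *: 1) -> is_basis e.
Proof.
move=> c0 eE p_alg.
have PhiE (s : seq int) (b : int -> C) :
    Phi (\sum_(i <- s) (b i)%:A *: e i) = \sum_(i <- s) (b i * c i) *: laurentX C i.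
  rewrite raddf_sum; apply: eq_bigr => i _ /=.
  by rewrite PhiZ eE p_alg mulr_algl scalerA.
split=> [w|s b us s0 i si].
  have [n [P PE]] := laurent_span (Phi w).
  exists [seq k%:Z - n%:Z | k <- index_iota 0%N (size P)],
    (fun i => P`_(absz (i + n%:Z)) / c i).
  apply: Phi_inj; rewrite PhiE PE big_map big_mkord; apply: eq_bigr => k _.
  by rewrite divfK // subrK.
have := congr1 Phi s0; rewrite PhiE raddf0 => /(laurentX_free us)/(_ i si)/eqP.
by rewrite mulf_eq0 (negPf (c0 i)) orbF => /eqP.
Qed.
End CircleModule.

(** * Two-forms of a calculus of disc type *)

Section FrameGeneration.
Variables (A : pzRingType) (F : fodc A) (sig : A -> A) (om oms : forms1 F).
Hypothesis omR : forall a, om <* a = sig a *: om.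
Hypothesis omsR : forall a, oms <* a = sig a *: oms.
Hypothesis om_span : forall u, exists a b, u = a *: om + b *: oms.

Lemma wedge_ract_frame (u w : forms1 F) a :
  (forall a, u <* a = sig a *: u) -> (forall a, w <* a = sig a *: w) ->
  wedge u w <* a = sig (sig a) *: wedge u w.
Proof. by move=> uR wR; rewrite -wedgeR wR -wedgeA uR wedgeZl. Qed.

Lemma forms2_cyclic (Q : forms2 F) :
  (exists a, wedge om om = a *: Q) -> (exists a, wedge om oms = a *: Q) ->
  (exists a, wedge oms om = a *: Q) -> (exists a, wedge oms oms = a *: Q) ->
  forall w : forms2 F, exists a, w = a *: Q.
Proof.
move=> Q11 Q12 Q21 Q22.
have QD (w w' : forms2 F) : (exists a, w = a *: Q) -> (exists a, w' = a *: Q) ->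
    exists a, w + w' = a *: Q.
  by move=> [a ->] [b ->]; exists (a + b); rewrite scalerDl.
have QZ c (w : forms2 F) : (exists a, w = a *: Q) -> exists a, c *: w = a *: Q.
  by move=> [a ->]; exists (c * a); rewrite scalerA.
elim/bimod_ind; elim/tens_ind => [|u w|y1 y2 IH1 IH2].
- by exists 0; rewrite scale0r raddf0.
- have [a [b ->]] := om_span u; have [c [e ->]] := om_span w.
  rewrite -[bimod_pi _ _]/(wedge _ _) wedgeDl !wedgeZl !wedgeDr.
  rewrite -!wedgeA !omR !omsR !wedgeZl.
  by apply: (QD _ _); apply: (QZ _ _); apply: (QD _ _); apply: (QZ _ _).
- by rewrite raddfB -scaleN1r; apply: QD => //; apply: QZ.
Qed.
End FrameGeneration.

(** The argument is carried out for an algebra and a calculus which have the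
    formal properties of the quantum disc. *)
Section Forms2OverCircle.
Variables (C : fieldType) (A : algType C) (F : fodc A).
Local Notation d := (fodc_d F).
Local Notation L := (laurent C).
Variables (sig : {rmorphism A -> A}) (p : {rmorphism A -> L}).
Hypothesis forms1_ract_alg : forall (c : C) (u : forms1 F), u <* c%:A = cscale c u.
Hypothesis d_alg : forall c : C, d c%:A = 0.
Hypothesis p_alg : forall c : C, p c%:A = laurentC c.
Hypothesis sig_alg : forall c : C, sig c%:A = c%:A.
Variables (q : C) (z zs : A) (om oms : forms1 F).
Local Notation t := (q ^+ 2).
Hypothesis A_ind : forall P : A -> Prop,
  P 0 -> (forall a b, P a -> P b -> P (a + b)) ->
  (forall c a, P a -> P (c *: a)) -> P 1 ->
  (forall a, P a -> P (z * a)) -> (forall a, P a -> P (zs * a)) ->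
  forall a, P a.
Hypotheses (t0 : t != 0) (t1 : 1 - t != 0) (t2 : 1 + t ^+ 2 != 0).
Hypothesis t3 : 1 - t ^+ 3 != 0.
Hypothesis zszE : zs * z = t *: (z * zs) + (1 - t)%:A.
Hypotheses (sz : sig z = t *: z) (szs : sig zs = t^-1 *: zs).
Hypotheses (dz : d z = zs *: om) (dzs : d zs = (t *: z) *: oms).
Hypotheses (pz : p z = laurentX C 1) (pzs : p zs = laurentX C (-1)).
Variables (k1 k2 : forms1 F -> A).
Hypotheses (k1D : {morph k1 : u w / u + w}) (k2D : {morph k2 : u w / u + w}).
Hypothesis k1Z : forall a u, k1 (a *: u) = a * k1 u.
Hypothesis k2Z : forall a u, k2 (a *: u) = a * k2 u.
Hypothesis k1R : forall a u, k1 (u <* a) = k1 u * sig a.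
Hypothesis k2R : forall a u, k2 (u <* a) = k2 u * sig a.
Hypothesis kE : forall u, u = k1 u *: om + k2 u *: oms.
Hypotheses (k1om : k1 om = 1) (k2om : k2 om = 0).
Hypotheses (k1oms : k1 oms = 0) (k2oms : k2 oms = 1).
Let x := 1 - z * zs.
Hypothesis sig_surj : forall a, exists b, sig b = a.
Hypothesis p_sig : forall a, p (sig a) = 0 -> p a = 0.
Hypothesis p_ker : forall a, p a = 0 <-> exists b, a = x * b.
Hypothesis x_comm : forall a, x * a = sig a * x.
Hypothesis x_lreg : forall a, x * a = 0 -> a = 0.
Hypothesis x_rreg : forall a, a * x = 0 -> a = 0.
Hypothesis p_surj : forall f, exists a, p a = f.

Let v : forms2 F := (q ^- 6 / (q ^+ 2 - 1))%:A *:
  (wedge oms om + (q ^+ 8)%:A *: wedge om oms).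

Let sigZ (b : C) a : sig (b *: a) = b *: sig a.
Proof. by rewrite -[b *: a]mulr_algl rmorphM sig_alg mulr_algl. Qed.
Let pZ (b : C) a : p (b *: a) = b *: p a.
Proof. by rewrite -[b *: a]mulr_algl rmorphM p_alg. Qed.

Let omR a : om <* a = sig a *: om.
Proof. by rewrite [LHS]kE k1R k2R k1om k2om mul1r mul0r scale0r addr0. Qed.
Let omsR a : oms <* a = sig a *: oms.
Proof. by rewrite [LHS]kE k1R k2R k1oms k2oms mul1r mul0r scale0r add0r. Qed.

Let relations := fodc_two_form_relations forms1_ract_alg d_alg t0 t1 t2 t3 zszE
  (conj (etrans (omR z) (congr1 (fun a => a *: om) sz))
        (etrans (omR zs) (congr1 (fun a => a *: om) szs)))
  (conj (etrans (omsR z) (congr1 (fun a => a *: oms) sz))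
        (etrans (omsR zs) (congr1 (fun a => a *: oms) szs))) dz dzs.

Let t1' : t - 1 != 0. Proof. by rewrite -oppr_eq0 opprB. Qed.
Let q0 : q != 0. Proof. by move: t0; rewrite expf_eq0. Qed.

Let vE : wedge om oms = v.
Proof.
have [PQ _ _ _ _] := relations.
rewrite /v PQ -[(q ^+ 8)%:A *: _]/(cscale _ _) -cscaleDl.
rewrite -[RHS]/(cscale _ (cscale _ _)) cscaleA -[LHS]cscale1; congr (cscale _ _).
by field; rewrite q0 t1'.
Qed.

Lemma forms2_relations :
  [/\ d1 om = (q ^+ 8 *: z ^+ 2) *: v /\ d1 oms = (- zs ^+ 2) *: v,
      wedge om oms = v,
      wedge oms om = (- (q ^+ 6)%:A) *: v,
      wedge om om = ((q ^+ 12 * ((q ^+ 2 - 1) / (q ^+ 4 + 1))) *: z ^+ 4) *: v &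
      wedge oms oms =
        ((q ^- 4 * ((q ^+ 2 - 1) / (q ^+ 4 + 1))) *: zs ^+ 4) *: v].
Proof.
have [PQ _ [DE D'E] RE SE] := relations; rewrite -vE.
have e8 : q ^+ 8 = t ^+ 4 by rewrite -exprM.
have e4 : q ^+ 4 = t ^+ 2 by rewrite -exprM.
have e12 : q ^+ 12 = t ^+ 6 by rewrite -exprM.
have e6 : q ^+ 6 = t ^+ 3 by rewrite -exprM.
rewrite e4 e6 e8 e12 !scale_cscale DE D'E PQ RE SE; split=> //.
- by split=> //; rewrite cscaleNl cscale1 scaleNr.
- by rewrite -scaleNr.
Qed.

Let xv : x *: v = 0.
Proof. by have [_ xQ _ _ _] := relations; rewrite -vE. Qed.

Let v_gen w : exists a, w = a *: v.
Proof.
have [_ E12 E21 E11 E22] := forms2_relations.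
apply: (forms2_cyclic omR omsR) w => [u||||].
- by exists (k1 u), (k2 u).
- by eexists; exact: E11.
- by exists 1; rewrite scale1r.
- by eexists; exact: E21.
- by eexists; exact: E22.
Qed.

Let v_ract a : v <* a = sig (sig a) *: v.
Proof. by rewrite -vE; apply: wedge_ract_frame. Qed.

Let sig_x : sig x = x.
Proof.
rewrite rmorphB rmorphM rmorph1 sz szs -scalerAl -scalerAr scalerA mulfV //.
by rewrite scale1r.
Qed.

Let UV : p z * p zs = 1. Proof. by rewrite pz pzs laurentX_inv. Qed.

Let t2' : t ^+ 2 + 1 != 0. Proof. by rewrite addrC. Qed.

Let lift := frame_forms2_lift forms1_ract_alg d_alg p_alg sig_alg A_ind t0 t2'
  sz szs dz dzs UV k1D k2D k1Z k2Z k1R k2R kE k1om k2om k1oms k2oms.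

Let p_exp (k : int) a : p a = laurentX C k -> sig a = (q ^ (2 * k)) *: a ->
  forall n, p (sig (sig (a ^+ n))) = (q ^ (2 * k)) ^+ n ^+ 2 *: laurentX C (k * n%:Z).
Proof.
move=> pa sa n; rewrite !rmorphXn /= sa sigZ sa !pZ pa.
by rewrite scalerA exprZn laurentX_exp exprMn -expr2.
Qed.

Lemma forms2_over_circle :
  [/\ [/\ forall w : forms2 F, exists a, w = a *: v,
          forall w : forms2 F, exists a, w = v <* a,
          forall a, v <* a = sig (sig a) *: v,
          x *: v = 0 & v <* x = 0],
      is_basis (fun k : int => match k with
                               | Posz n => v <* z ^+ n
                               | Negz m => v <* zs ^+ m.+1
                               end),
      [/\ forall a, (forall w : forms2 F, a *: w = 0 /\ w <* a = 0) <-> p a = 0,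
          (exists (M : lmodType L) (j : {additive forms2 F -> M}),
            [/\ bijective j, forall a w, j (a *: w) = p a *: j w & free_on (j v)]) /\
          (exists (M : lmodType L) (j : {additive forms2 F -> M}),
            [/\ bijective j, forall w a, j (w <* a) = p a *: j w & free_on (j v)]),
          @torsion A (forms2 F) /\ @torsion A^c (right_lmod (forms2 F)),
          @dual_is_zero A (forms2 F) /\ @dual_is_zero A^c (right_lmod (forms2 F)) &
          ~ @projective A (forms2 F) /\ ~ @projective A^c (right_lmod (forms2 F))] &
      [/\ d1 om = (q ^+ 8 *: z ^+ 2) *: v /\ d1 oms = (- zs ^+ 2) *: v,
          wedge om oms = v,
          wedge oms om = (- (q ^+ 6)%:A) *: v,
          wedge om om = ((q ^+ 12 * ((q ^+ 2 - 1) / (q ^+ 4 + 1))) *: z ^+ 4) *: v &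
          wedge oms oms =
            ((q ^- 4 * ((q ^+ 2 - 1) / (q ^+ 4 + 1))) *: zs ^+ 4) *: v]].
Proof.
have [Phi [Phi1 PhiZ PhiR]] := lift; have Phi_v : Phi v = 1 by rewrite -vE.
have px0 : p x = 0 by apply/p_ker; exists 1; rewrite mulr1.
split; last exact: forms2_relations.
- split=> //; first exact: (v_gen_right v_gen v_ract sig_surj).
  exact: (ann_right v_gen p_ker x_comm sig_x xv Phi_v PhiZ PhiR).
- pose c (k : int) : C := match k with
    | Posz n => (q ^ (2 * 1)) ^+ n ^+ 2
    | Negz m => (q ^ (2 * -1)) ^+ m.+1 ^+ 2 end.
  apply: (circle_basis v_gen p_ker x_comm xv Phi_v PhiZ (c := c)) => [k|k|f].
  + by case: k => n; rewrite /c !expf_neq0 // expfz_neq0.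
  + case: k => n; rewrite PhiR Phi_v mul1r.
      by rewrite (p_exp pz sz) mul1r.
    by rewrite (p_exp pzs) ?mulN1r // szs.
  + by rewrite p_alg laurentCE.
- split.
  + move=> a; split=> [aw|pa w]; first by have [/(ann_v Phi_v PhiZ)] := aw v.
    split; first exact: (ann_left v_gen p_ker x_comm xv Phi_v PhiZ).
    exact: (ann_right v_gen p_ker x_comm sig_x xv Phi_v PhiZ PhiR).
  + split.
      exact: (circle_free_left v_gen p_ker x_comm xv p_surj Phi_v PhiZ).
    exact: (circle_free_right v_gen v_ract sig_surj p_sig p_ker x_comm sig_x xv
      p_surj Phi_v PhiZ PhiR).
  + exact: (circle_torsion v_gen p_ker x_comm sig_x xv x_lreg Phi_v PhiZ PhiR).
  + exact: (circle_dual v_gen p_ker x_comm sig_x xv x_lreg x_rreg Phi_v PhiZ PhiR).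
  + exact: (circle_not_projective v_gen v_ract sig_surj p_ker x_comm sig_x xv
      x_lreg x_rreg Phi_v PhiZ PhiR).
Qed.
End Forms2OverCircle.

(** * The quantum disc algebra: normal forms and regularity of x *)

Section DiscSymbol.
Variables (C : numClosedFieldType) (q : C) (q01 : 0 < q < 1).
Local Notation disc := (disc q).
Local Notation z := (disc_z q).
Local Notation zs := (disc_zs q).
Local Notation x := (disc_x q).
Local Notation sigma := (disc_sigma q01).
Local Notation L := (laurent C).
Local Notation u := (laurentX C 1).
Local Notation us := (laurentX C (-1)).

Lemma laurentC_central (c : C) (f : L) : laurentC c * f = f * laurentC c.
Proof. exact: mulrC. Qed.

Fact symbol_rel : us * u - laurentC (q ^+ 2) * (u * us) = laurentC (1 - q ^+ 2).
Proof. by rewrite (mulrC us) laurentX_inv mulr1 rmorphB rmorph1. Qed.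

(** Restriction to the boundary circle. *)
Definition symbol : disc -> L := disc_lift u us laurentC_central.

Fact symbol_additive : zmod_morphism symbol.
Proof. exact: disc_lift_additive symbol_rel. Qed.
HB.instance Definition _ :=
  GRing.isZmodMorphism.Build disc L symbol symbol_additive.
Fact symbol_monoid : monoid_morphism symbol.
Proof. exact: disc_lift_monoid symbol_rel. Qed.
HB.instance Definition _ :=
  GRing.isMonoidMorphism.Build disc L symbol symbol_monoid.
Fact symbol_scalable : scalable symbol.
Proof. by move=> c a; apply: (disc_liftZ _ symbol_rel). Qed.
HB.instance Definition _ :=
  GRing.isScalable.Build C disc L *:%R symbol symbol_scalable.

Lemma symbol_z : symbol z = u.
Proof. exact: disc_lift_z symbol_rel. Qed.
Lemma symbol_zs : symbol zs = us.
Proof. exact: disc_lift_zs symbol_rel. Qed.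
Lemma symbol_x : symbol x = 0.
Proof. by rewrite rmorphB rmorphM rmorph1 /= symbol_z symbol_zs laurentX_inv subrr. Qed.

Lemma disc_zzsE : z * zs = 1 - x.
Proof. by rewrite /disc_x subKr. Qed.

Lemma disc_zszx : zs * z = 1 - q ^+ 2 *: x.
Proof.
rewrite disc_zszE disc_zzsE scalerBr scalerBl scale1r.
by rewrite addrC addrA subrK.
Qed.

Lemma mulBK (c : C) (a b : disc) : a - a * (1 - c *: b) = c *: (a * b).
Proof. by rewrite mulrBr mulr1 subKr scalerAr. Qed.

Lemma mulBKl (c : C) (a b : disc) : a - (1 - c *: b) * a = c *: (b * a).
Proof. by rewrite mulrBl mul1r subKr scalerAl. Qed.

Lemma disc_x_comm a : x * a = sigma a * x.
Proof.
elim/disc_ind: a => [|a b IHa IHb|c a IHa||a IHa|a IHa].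
- by rewrite raddf0 mulr0 mul0r.
- by rewrite [sigma _]raddfD mulrDr [RHS]mulrDl IHa IHb.
- by rewrite [sigma _]linearZ /= -scalerAr -scalerAl IHa.
- by rewrite rmorph1 mulr1 mul1r.
- rewrite rmorphM /= disc_sigma_z -[RHS]mulrA -IHa mulrA [RHS]mulrA; congr (_ * _).
  transitivity (z - z * (zs * z)); first by rewrite mulrBl mul1r mulrA.
  by rewrite disc_zszx mulBK -scalerAl.
- rewrite rmorphM /= disc_sigma_zs -[RHS]mulrA -IHa mulrA [RHS]mulrA; congr (_ * _).
  transitivity (q ^- 2 *: (zs - (zs * z) * zs)); last first.
    by rewrite -scalerAl /disc_x mulrBr mulr1 mulrA.
  rewrite disc_zszx mulBKl scalerA mulVf ?scale1r //.
  by rewrite expf_neq0 // (q_neq0 q01).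
Qed.

Lemma sigma_surj a : exists b, sigma b = a.
Proof.
have q2 : q ^+ 2 != 0 by rewrite expf_neq0 // (q_neq0 q01).
elim/disc_ind: a => [|a b [a' <-] [b' <-]|c a [a' <-]||a [a' <-]|a [a' <-]].
- by exists 0; rewrite raddf0.
- by exists (a' + b'); rewrite raddfD.
- by exists (c *: a'); rewrite linearZ.
- by exists 1; rewrite rmorph1.
- exists (q ^- 2 *: z * a').
  by rewrite rmorphM /= linearZ /= disc_sigma_z scalerA mulVf // scale1r.
- exists (q ^+ 2 *: zs * a').
  by rewrite rmorphM /= linearZ /= disc_sigma_zs scalerA mulfV // scale1r.
Qed.

(** The grading automorphism descends to the circle, where it rescales the
    monomials, hence is injective. *)
Lemma symbol_sigma_eq0 a : symbol (sigma a) = 0 -> symbol a = 0.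
Proof.
have [t tE] := @laurent_lift C L (fun i => q ^ (2 * i) *: laurentX C i).
have [t' t'E] := @laurent_lift C L (fun i => q ^ (- (2 * i)) *: laurentX C i).
have q0 := q_neq0 q01.
have tK f : t' (t f) = f.
  elim/laurent_ind: f => [|c i f IHf]; first by rewrite !linear0.
  rewrite !linearD !linearZ /= IHf tE linearZ /= t'E !scalerA.
  by rewrite -mulrA -expfzDr // subrr expr0z mulr1.
have tM i f : t (laurentX C i * f) = q ^ (2 * i) *: laurentX C i * t f.
  elim/laurent_ind: f => [|c j f IHf]; first by rewrite !(linear0, mulr0).
  rewrite mulrDr !linearD mulrDr IHf; congr (_ + _).
  rewrite -scalerAr -laurentXD !linearZ /= !tE -scalerAl -!scalerAr -laurentXD.
  by rewrite !scalerA mulrDr expfzDr // (mulrCA c).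
have ts b : symbol (sigma b) = t (symbol b).
  elim/disc_ind: b => [|b c IHb IHc|c b IHb||b IHb|b IHb].
  - by rewrite !raddf0.
  - by rewrite !raddfD /= IHb IHc.
  - by do 3!rewrite ?linearZ /=; rewrite IHb.
  - by rewrite !rmorph1 -laurentX0 tE mulr0 scale1r.
  - by rewrite !rmorphM /= disc_sigma_z linearZ /= !symbol_z tM IHb.
  - by rewrite !rmorphM /= disc_sigma_zs linearZ /= !symbol_zs tM IHb.
by rewrite ts => t0; rewrite -[LHS]tK t0 linear0.
Qed.

Definition disc_mono (i : int) : disc :=
  match i with Posz n => z ^+ n | Negz m => zs ^+ m.+1 end.

Lemma symbol_mono i : symbol (disc_mono i) = laurentX C i.
Proof.
case: i => n /=; rewrite rmorphXn /= ?symbol_z ?symbol_zs laurentX_exp ?mul1r //.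
by rewrite mulN1r.
Qed.

(** A linear section of [symbol], by [section_symbol]. *)
Lemma disc_section : exists S : {linear L -> disc},
  forall i, S (laurentX C i) = disc_mono i.
Proof. exact: laurent_lift. Qed.

Lemma section_symbol (S : {linear L -> disc}) f :
  (forall i, S (laurentX C i) = disc_mono i) -> symbol (S f) = f.
Proof.
move=> SE; elim/laurent_ind: f => [|c i f IHf]; first by rewrite !linear0.
by rewrite !linearD !linearZ /= IHf SE symbol_mono.
Qed.

Lemma mono_mulz i : exists c : C,
  z * disc_mono i = disc_mono (1 + i) + x * (c *: disc_mono (1 + i)).
Proof.
case: i => n; first by exists 0; rewrite scale0r mulr0 addr0 /= exprS.
have -> : disc_mono (1 + Negz n) = zs ^+ n.
  case: n => [|n] //; suff -> : 1 + Negz n.+1 = Negz n by [].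
  by rewrite !NegzE (intS n.+1) opprD addrA subrr add0r.
by exists (-1); rewrite /= exprS mulrA disc_zzsE mulrBl mul1r scaleN1r mulrN.
Qed.

Lemma mono_mulzs i : exists c : C,
  zs * disc_mono i = disc_mono (-1 + i) + x * (c *: disc_mono (-1 + i)).
Proof.
case: i => [[|n]|n].
- by exists 0; rewrite scale0r mulr0 addr0 /= mulr1.
- have -> : disc_mono (-1 + n.+1%:Z) = z ^+ n by rewrite intS addrA addNr add0r.
  exists (- q ^+ 2); rewrite /= exprS mulrA disc_zszx mulrBl mul1r.
  by rewrite -scalerAl -scalerAr scaleNr.
- exists 0; rewrite scale0r mulr0 addr0 !NegzE -opprD -intS -!NegzE.
  by rewrite /= [RHS]exprS.
Qed.

(** [a] is [\sum_(j < n) x ^+ j * b_j] with each [b_j] a combination of the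
    monomials [disc_mono i]; [S] recovers such a combination from its symbol. *)
Fixpoint x_length (S : L -> disc) (n : nat) (a : disc) : Prop :=
  if n is n'.+1 then exists2 b, a = S (symbol a) + x * b & x_length S n' b
  else a = 0.

Section Length.
Variable S : {linear L -> disc}.
Hypothesis SE : forall i, S (laurentX C i) = disc_mono i.
Local Notation xl := (x_length S).

Lemma x_lengthZD n c a b : xl n a -> xl n b -> xl n (c *: a + b).
Proof.
elim: n a b => [a b -> ->|n IHn a b /= [a' aE la] [b' bE lb]].
  by rewrite /= scaler0 addr0.
exists (c *: a' + b'); last exact: IHn.
by rewrite {1}aE {1}bE !linearP /= scalerDr mulrDr -scalerAr addrACA.
Qed.

Lemma x_length0 n : xl n 0.
Proof. by elim: n => //= n IHn; exists 0; rewrite ?mulr0 ?addr0 ?raddf0. Qed.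

Lemma x_lengthS n a : xl n a -> xl n.+1 a.
Proof.
elim: n a => [a ->|n IHn a [b aE lb]]; first exact: x_length0.
by exists b => //; apply: IHn.
Qed.

Lemma x_lengthD n a b : xl n a -> xl n b -> xl n (a + b).
Proof. by move=> la lb; rewrite -[a]scale1r; apply: x_lengthZD. Qed.

Lemma x_lengthW m n a : (m <= n)%N -> xl m a -> xl n a.
Proof.
by move=> /subnK <-; elim: (n - m)%N => //= k IHk /IHk; apply: x_lengthS.
Qed.

Lemma x_lengthx n a : xl n a -> xl n.+1 (x * a).
Proof. by exists a; rewrite // rmorphM /= symbol_x mul0r raddf0 add0r. Qed.

Lemma x_length_section f : xl 1 (S f).
Proof. by exists 0 => //; rewrite section_symbol // mulr0 addr0. Qed.

(** Multiplying by a generator [g] on the left raises the length by at most one: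
    [gM] holds for [z] and [zs] because [z * zs] and [zs * z] are [1] up to a
    multiple of [x]. *)
Lemma x_length_mul (g : disc) (d : int) (c : C) (n : nat) a :
  (forall i, exists e : C, g * disc_mono i =
    disc_mono (d + i) + x * (e *: disc_mono (d + i))) ->
  g * x = c *: (x * g) -> xl n a -> xl n.+1 (g * a).
Proof.
move=> gM gx; elim: n a => [a ->|n IHn a [b -> lb]].
  by rewrite mulr0; apply: x_length0.
rewrite mulrDr; apply: x_lengthD; last first.
  rewrite mulrA gx -scalerAl -mulrA -[_ *: _]addr0.
  by apply: x_lengthZD; [apply/x_lengthx/IHn|apply: x_length0].
apply: (@x_lengthW 2) => //.
elim/laurent_ind: (symbol a) => [|e i f IHf].
  by rewrite raddf0 mulr0; apply: x_length0.
rewrite linearD linearZ_LR SE mulrDr -scalerAr; apply: x_lengthZD => //.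
have [e' ->] := gM i; rewrite -SE; apply: x_lengthD.
  exact/x_lengthS/x_length_section.
by apply: x_lengthx; rewrite -linearZ; apply: x_length_section.
Qed.

Lemma x_length_ex a : exists n, xl n a.
Proof.
have q2 : q ^+ 2 != 0 by rewrite expf_neq0 // (q_neq0 q01).
elim/disc_ind: a => [|a b [m la] [n lb]|c a [n la]||a [n la]|a [n la]].
- by exists 0.
- exists (maxn m n); apply: x_lengthD.
    exact: x_lengthW (leq_maxl _ _) la.
  exact: x_lengthW (leq_maxr _ _) lb.
- by exists n; rewrite -[_ *: _]addr0; apply: x_lengthZD => //; apply: x_length0.
- have <- : S (laurentX C 0) = 1 by rewrite SE.
  by exists 1; apply: x_length_section.
- exists n.+1; apply: (@x_length_mul z 1 (q ^- 2)) la; first exact: mono_mulz.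
  by rewrite disc_x_comm disc_sigma_z -scalerAl scalerA mulVf // scale1r.
- exists n.+1; apply: (@x_length_mul zs (-1) (q ^+ 2)) la; first exact: mono_mulzs.
  by rewrite disc_x_comm disc_sigma_zs -scalerAl scalerA mulfV // scale1r.
Qed.
End Length.

Lemma symbol_eq0 a : symbol a = 0 -> exists b, a = x * b.
Proof.
have [S SE] := disc_section; have [n] := x_length_ex SE a.
by case: n => [->|n [b aE _] sa]; [exists 0; rewrite mulr0 |
  exists b; rewrite {1}aE sa raddf0 add0r].
Qed.

Lemma x_idealP a : disc_x_ideal a <-> symbol a = 0.
Proof.
split; last first.
  move=> /symbol_eq0[b ->]; rewrite -[x]mul1r; exact: ideal_genM.
by apply: ideal_gen_morph => s ->; apply: symbol_x.
Qed.

(** The scalar is nonzero as a sum of positive terms up to the common factor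
    [- q ^- 2]. *)
Lemma partial_x_exp n : exists2 c : C, c != 0 &
  disc_partial q01 (x ^+ n.+1) = c *: (x ^+ n * zs ^+ 2).
Proof.
have q0 := q_neq0 q01; have q2 : q ^+ 2 != 0 by rewrite expf_neq0.
have xzs : zs ^+ 2 * x = q ^+ 4 *: (x * zs ^+ 2).
  rewrite disc_x_comm rmorphXn /= disc_sigma_zs exprZn -scalerAl scalerA.
  by rewrite -exprVn -exprM -exprMn mulfV // expr1n scale1r.
have px : disc_partial q01 x = - q ^- 2 *: zs ^+ 2.
  rewrite raddfB /= disc_partialM disc_partial_z disc_partial_zs mulr0 addr0.
  rewrite disc_sigma_zs -scalerAr scaleNr.
  have /eqP : disc_partial q01 (1 * 1) = _ := disc_partialM q01 1 1.
  by rewrite mulr1 rmorph1 mulr1 mul1r -subr_eq subrr => /eqP <-; rewrite sub0r.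
have sx : sigma x = x.
  rewrite rmorphB /= rmorphM /= rmorph1 disc_sigma_z disc_sigma_zs.
  by rewrite -scalerAl -scalerAr scalerA mulfV // scale1r.
suff [c c0 ->] : exists2 c : C, 0 < c &
    disc_partial q01 (x ^+ n.+1) = (- q ^- 2 * c) *: (x ^+ n * zs ^+ 2).
  exists (- q ^- 2 * c) => //; apply: mulf_neq0; last by rewrite gt_eqF.
  by rewrite oppr_eq0 invr_eq0.
elim: n => [|n [c c0 IHn]].
  by exists 1; rewrite ?ltr01 // expr1 expr0 px mulr1 mul1r.
exists ((q ^+ 4) ^+ n.+1 + c).
  by rewrite addr_gt0 // !exprn_gt0 //; case/andP: q01.
rewrite exprS disc_partialM IHn rmorphXn /= sx px.
rewrite -scalerAr mulrA -exprS mulrDr scalerDl; congr (_ + _).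
rewrite -scalerAl -scalerA; congr (_ *: _).
elim: n.+1 => [|m IHm]; first by rewrite !expr0 mulr1 mul1r scale1r.
rewrite [x ^+ m.+1]exprSr mulrA IHm -scalerAl -[_ * zs ^+ 2 * x]mulrA xzs.
rewrite -scalerAr scalerA.
by rewrite [(q ^+ 4) ^+ m.+1]exprSr [x ^+ m * (x * _)]mulrA.
Qed.

(** Induction on [n]: applying [partial] to [x ^+ n.+1 * b = 0] and factoring
    [x ^+ n] on the left, the other factor has symbol a unit times that of
    [sigma b]. *)
Lemma x_exp_symbol n b : x ^+ n * b = 0 -> symbol b = 0.
Proof.
elim: n b => [b|n IHn b xb]; first by rewrite mul1r => ->; rewrite raddf0.
have [c c0 px] := partial_x_exp n.
apply/symbol_sigma_eq0.
have : x ^+ n * (c *: (zs ^+ 2 * sigma b) + x * disc_partial q01 b) = 0.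
  rewrite mulrDr mulrA -exprSr -scalerAr mulrA scalerAl -px -disc_partialM xb.
  exact: raddf0.
move/IHn; rewrite rmorphD rmorphM /= symbol_x mul0r addr0 linearZ /=.
rewrite rmorphM rmorphXn /= symbol_zs => h.
have -> : symbol (sigma b) = (c^-1 *: u ^+ 2) * (c *: (us ^+ 2 * symbol (sigma b))).
  rewrite -scalerAl -scalerAr scalerA mulVf // scale1r mulrA -exprMn.
  by rewrite laurentX_inv expr1n mul1r.
by rewrite h mulr0.
Qed.

(** By induction on the length of [b], for all powers of [x] at once: if
    [x ^+ n * b = 0] then [b = x * b'] with [b'] shorter, and
    [x ^+ n.+1 * b' = 0]. *)
Lemma x_lreg b : x * b = 0 -> b = 0.
Proof.
have [S SE] := disc_section; have [N lb] := x_length_ex SE b.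
suff gen n : x ^+ n * b = 0 -> b = 0 by move=> xb; apply: (gen 1); rewrite expr1.
elim: N n b lb => [//|N IHN] n b /= [b' bE lb] xb.
have b0 := x_exp_symbol xb; move: bE xb; rewrite b0 raddf0 add0r => ->.
by rewrite mulrA -exprSr => /IHN ->; rewrite ?mulr0.
Qed.

(** [x] commutes with every element up to the automorphism [sigma]. *)
Lemma x_rreg b : b * x = 0 -> b = 0.
Proof.
have [b' <-] := sigma_surj b; rewrite -disc_x_comm => /x_lreg ->.
exact: raddf0.
Qed.

Lemma symbol_surj f : exists a, symbol a = f.
Proof.
have [S SE] := disc_section; exists (S f); exact: section_symbol.
Qed.

End DiscSymbol.

(** * The two-forms on the quantum disc *)

Section DiscTwoForms.
Variables (C : numClosedFieldType) (q : C) (q01 : 0 < q < 1).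
Local Notation disc := (disc q).
Local Notation z := (disc_z q).
Local Notation zs := (disc_zs q).
Local Notation x := (disc_x q).
Local Notation sigma := (disc_sigma q01).
Local Notation F := (disc_calculus q01).
Local Notation Om1 := (disc_forms1 q01).
Local Notation Om2 := (disc_forms2 q01).
Local Notation om := (omega q01).
Local Notation oms := (omegabar q01).
Local Notation d := (disc_d q01).
Local Notation L := (laurent C).
Local Notation symbol := (@symbol C q).
Local Notation t := (q ^+ 2).

Lemma disc_forms1_ract_alg (c : C) (u : forms1 F) : u <* (c%:A : disc) = cscale c u.
Proof.
case: u => a b; rewrite /cscale form_ract form_scale.
have -> : sigma c%:A = c%:A by rewrite linearZ /= rmorph1.
by rewrite !alg_central.
Qed.

Lemma disc_d_alg (c : C) : d c%:A = 0.
Proof.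
have : d 1 = 0 := fodc_d1 F.
rewrite !disc_dE !linearZ /= => -[-> ->].
by rewrite !scaler0.
Qed.

Lemma form_sum (u : Om1) : u = u.1 *: om + u.2 *: oms.
Proof. by case: u => a b; rewrite form_omega. Qed.

Lemma disc_dz : d z = zs *: om.
Proof. by rewrite /disc_d disc_partial_z disc_partialbar_z scale0r addr0. Qed.

Lemma disc_dzs : d zs = (t *: z) *: oms.
Proof. by rewrite /disc_d disc_partial_zs disc_partialbar_zs scale0r add0r. Qed.

Lemma disc_scalars_neq0 : [/\ t != 0, 1 - t != 0, 1 + t ^+ 2 != 0 & 1 - t ^+ 3 != 0].
Proof.
have /andP[q0 q1] := q01.
have t_gt0 : 0 < t by rewrite exprn_gt0.
have t_lt1 : t < 1 by rewrite exprn_ilt1 // ltW.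
split; first by rewrite gt_eqF.
- by rewrite subr_eq0 eq_sym lt_eqF.
- by rewrite gt_eqF // addr_gt0 // exprn_gt0.
- by rewrite subr_eq0 eq_sym lt_eqF // exprn_ilt1 // ltW.
Qed.

End DiscTwoForms.

Section DiscCircle.
Variables (C : numClosedFieldType) (q : C) (q01 : 0 < q < 1).
Local Notation disc := (disc q).
Local Notation z := (disc_z q).
Local Notation zs := (disc_zs q).
Local Notation x := (disc_x q).
Local Notation sigma := (disc_sigma q01).
Local Notation F := (disc_calculus q01).
Local Notation om := (omega q01).
Local Notation oms := (omegabar q01).
Local Notation L := (laurent C).
Local Notation symbol := (@symbol C q).
Local Notation t := (q ^+ 2).
Local Notation v := (disc_v q01).

Lemma disc_mod_x_laurent :
  exists phi : {lrmorphism disc_mod_x q -> L},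
    bijective phi /\ forall a, phi (disc_mod_x_pi a) = symbol a.
Proof.
have sx (s : disc) : s = x -> symbol s = 0 by move=> ->; apply: symbol_x.
pose f : disc_mod_x q -> L := alg_lift symbol.
have fE a : f (disc_mod_x_pi a) = symbol a by apply: alg_liftE.
have fB : zmod_morphism f by apply: alg_lift_additive.
have fM : monoid_morphism f by apply: alg_lift_monoid.
have fZ : scalable f.
  move=> c w; elim/alg_ind: w => a; rewrite -[alg_pi _ a]/(disc_mod_x_pi a).
  by rewrite -linearZ !fE linearZ.
pose i1 := GRing.isZmodMorphism.Build _ _ f fB.
pose i2 := GRing.isMonoidMorphism.Build _ _ f fM.
pose i3 := GRing.isScalable.Build C _ L *:%R f fZ.
pose phi : {lrmorphism disc_mod_x q -> L} := HB.pack f i1 i2 i3.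
exists phi; split=> //.
pose g (c : L) : disc_mod_x q := disc_mod_x_pi (projT1 (cid (symbol_surj q c))).
exists g => [w|c] /=; rewrite /g; case: cid => b /= bE; last by rewrite fE.
elim/alg_ind: w bE => a; rewrite -[alg_pi _ a]/(disc_mod_x_pi a) fE => /eqP.
rewrite -subr_eq0 -raddfB => /eqP sab; apply/alg_piE.
exact/(x_idealP q01).
Qed.

Lemma symbol_kerP a : symbol a = 0 <-> exists b, a = x * b.
Proof.
split=> [|[b ->]]; first exact: symbol_eq0.
by rewrite rmorphM /= symbol_x mul0r.
Qed.

Lemma disc_p_alg (c : C) : symbol (c%:A : disc) = laurentC c.
Proof. by rewrite linearZ /= rmorph1 laurentCE. Qed.

Lemma disc_sigma_alg (c : C) : sigma c%:A = c%:A.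
Proof. by rewrite linearZ /= rmorph1. Qed.

(** [forms2_over_circle] for the quantum disc. *)
Definition disc_forms2_over_circle :=
  let: And4 t0 t1 t2 t3 := disc_scalars_neq0 q01 in
  @forms2_over_circle C disc F sigma symbol
  (@disc_forms1_ract_alg _ _ q01) (disc_d_alg q01) disc_p_alg disc_sigma_alg
  q z zs om oms (@disc_ind C q)
  t0 t1 t2 t3 (disc_zszE q) (disc_sigma_z q01) (disc_sigma_zs q01)
  (disc_dz q01) (disc_dzs q01) (symbol_z q) (symbol_zs q)
  (fun u : forms1 F => u.1) (fun u : forms1 F => u.2)
  (fun _ _ => erefl) (fun _ _ => erefl) (fun _ _ => erefl) (fun _ _ => erefl)
  (fun _ _ => erefl) (fun _ _ => erefl) (@form_sum _ _ q01) erefl erefl erefl erefl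
  (sigma_surj q01) (@symbol_sigma_eq0 _ _ q01) symbol_kerP (disc_x_comm q01)
  (x_lreg q01) (x_rreg q01) (symbol_surj q).
End DiscCircle.

(** The scalars may be any algebraically closed field with a conjugation. *)
Lemma disc_forms2_structure (C : numClosedFieldType) (q : C) (q01 : 0 < q < 1) :
  let z : disc q := disc_z q in
  let zs : disc q := disc_zs q in
  let x : disc q := disc_x q in
  let sigma : disc q -> disc q := disc_sigma q01 in
  let om : disc_forms1 q01 := omega q01 in
  let oms : disc_forms1 q01 := omegabar q01 in
  let mul : disc_forms1 q01 -> disc_forms1 q01 -> disc_forms2 q01 :=
    @disc_mul1 _ q q01 in
  let d : disc_forms1 q01 -> disc_forms2 q01 := @disc_d1 _ q q01 in
  let v : disc_forms2 q01 := disc_v q01 in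
  let pi : disc q -> disc_mod_x q := @disc_mod_x_pi _ q in
  [/\
    [/\ forall w : disc_forms2 q01, exists a : disc q, w = a *: v,
        forall w : disc_forms2 q01, exists a : disc q, w = v <* a,
        forall a : disc q, v <* a = sigma (sigma a) *: v,
        x *: v = 0 & v <* x = 0],
    is_basis (fun k : int => match k with
                             | Posz n => v <* z ^+ n
                             | Negz m => v <* zs ^+ m.+1
                             end),
    [/\ forall a : disc q,
          (forall w : disc_forms2 q01, a *: w = 0 /\ w <* a = 0) <->
          disc_x_ideal a,
        exists phi : {lrmorphism disc_mod_x q -> laurent C},
          [/\ bijective phi,
              exists (M : lmodType (laurent C))
                     (j : {additive disc_forms2 q01 -> M}),
                [/\ bijective j,
                    forall a w, j (a *: w) = phi (pi a) *: j w &
                    free_on (j v)] &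
              exists (M : lmodType (laurent C))
                     (j : {additive disc_forms2 q01 -> M}),
                [/\ bijective j,
                    forall w a, j (w <* a) = phi (pi a) *: j w &
                    free_on (j v)]],
        @torsion (disc q) (disc_forms2 q01) /\
          @torsion (disc q)^c (right_lmod (disc_forms2 q01)),
        @dual_is_zero (disc q) (disc_forms2 q01) /\
          @dual_is_zero (disc q)^c (right_lmod (disc_forms2 q01)) &
        ~ @projective (disc q) (disc_forms2 q01) /\
          ~ @projective (disc q)^c (right_lmod (disc_forms2 q01))] &
    [/\ d om = (q ^+ 8 *: z ^+ 2) *: v /\ d oms = (- zs ^+ 2) *: v,
        mul om oms = v,
        mul oms om = (- (q ^+ 6)%:A) *: v,
        mul om om =
          ((q ^+ 12 * ((q ^+ 2 - 1) / (q ^+ 4 + 1))) *: z ^+ 4) *: v &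
        mul oms oms =
          ((q ^- 4 * ((q ^+ 2 - 1) / (q ^+ 4 + 1))) *: zs ^+ 4) *: v]].
Proof.
move=> z zs x sigma om oms mul d v pi.
case: (disc_forms2_over_circle q01) => p1 p2 [p31 p32 p33 p34 p35] p4.
have [phi [phi_bij phiE]] := disc_mod_x_laurent q01.
(* [disc_forms2 q01] carries the module structures of
   [forms2 (disc_calculus q01)] repackaged; unification is slow to see through
   this, so the comparison is left to the kernel. *)
split; [exact_no_check p1|exact_no_check p2| |exact_no_check p4].
split; [|exists phi; split; [exact: phi_bij| |]
  |exact_no_check p33|exact_no_check p34|exact_no_check p35].
- exact_no_check (fun a => iff_trans (p31 a) (iff_sym (x_idealP q01 a))).
- have [M [j [j_bij jE jv]]] := proj1 p32; exists M.
  exists j; split; [exact_no_check j_bij| |exact_no_check jv].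
  move=> a w; rewrite phiE; exact_no_check (jE a w).
- have [M [j [j_bij jE jv]]] := proj2 p32; exists M.
  exists j; split; [exact_no_check j_bij| |exact_no_check jv].
  move=> w a; rewrite phiE; exact_no_check (jE w a).
Qed.

Theorem mainTheorem2 (R : realType) (q0 : R) (hq : 0 < q0 < 1) :
  let q : R[i] := q0%:C%C in
  let q01 : 0 < q < 1 := complex_01 hq in
  let z : disc q := disc_z q in
  let zs : disc q := disc_zs q in
  let x : disc q := disc_x q in
  let sigma : disc q -> disc q := disc_sigma q01 in
  let om : disc_forms1 q01 := omega q01 in
  let oms : disc_forms1 q01 := omegabar q01 in
  let mul : disc_forms1 q01 -> disc_forms1 q01 -> disc_forms2 q01 :=
    @disc_mul1 _ q q01 in
  let d : disc_forms1 q01 -> disc_forms2 q01 := @disc_d1 _ q q01 in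
  let v : disc_forms2 q01 := disc_v q01 in
  let pi : disc q -> disc_mod_x q := @disc_mod_x_pi _ q in
  [/\
    (* (1) *)
    [/\ forall w : disc_forms2 q01, exists a : disc q, w = a *: v,
        forall w : disc_forms2 q01, exists a : disc q, w = v <* a,
        forall a : disc q, v <* a = sigma (sigma a) *: v,
        x *: v = 0 & v <* x = 0],
    (* (2) *)
    is_basis (fun k : int => match k with
                             | Posz n => v <* z ^+ n
                             | Negz m => v <* zs ^+ m.+1
                             end),
    (* (3) *)
    [/\ forall a : disc q,
          (forall w : disc_forms2 q01, a *: w = 0 /\ w <* a = 0) <->
          disc_x_ideal a,
        exists phi : {lrmorphism disc_mod_x q -> laurent R[i]},
          [/\ bijective phi,
              exists (M : lmodType (laurent R[i]))
                     (j : {additive disc_forms2 q01 -> M}),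
                [/\ bijective j,
                    forall a w, j (a *: w) = phi (pi a) *: j w &
                    free_on (j v)] &
              exists (M : lmodType (laurent R[i]))
                     (j : {additive disc_forms2 q01 -> M}),
                [/\ bijective j,
                    forall w a, j (w <* a) = phi (pi a) *: j w &
                    free_on (j v)]],
        @torsion (disc q) (disc_forms2 q01) /\
          @torsion (disc q)^c (right_lmod (disc_forms2 q01)),
        @dual_is_zero (disc q) (disc_forms2 q01) /\
          @dual_is_zero (disc q)^c (right_lmod (disc_forms2 q01)) &
        ~ @projective (disc q) (disc_forms2 q01) /\
          ~ @projective (disc q)^c (right_lmod (disc_forms2 q01))] &
    (* (4) *)
    [/\ d om = (q ^+ 8 *: z ^+ 2) *: v /\ d oms = (- zs ^+ 2) *: v,
        mul om oms = v,
        mul oms om = (- (q ^+ 6)%:A) *: v,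
        mul om om =
          ((q ^+ 12 * ((q ^+ 2 - 1) / (q ^+ 4 + 1))) *: z ^+ 4) *: v &
        mul oms oms =
          ((q ^- 4 * ((q ^+ 2 - 1) / (q ^+ 4 + 1))) *: zs ^+ 4) *: v]].
Proof. exact: disc_forms2_structure (complex_01 hq). Qed.
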